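(* Let $\rho$ be a primitive $k$th root of unity, $L\in\mathbb Z_{\ge1}$, $\delta>0$, $C>0$. For all integers $N\ge1$ with $k\mid N$ and all $z$ with $\mathrm{Re}(z)\le-\delta$, $|z|\le C$, $$\frac{1}{(\rho e^{z/N})_N}=\Big(\frac kN\Big)^{1/2}g_\rho(z)\exp\Big(\frac Nk\,p(kz)+\sum_{\ell=1}^{L-1}\frac{f_{\rho,\ell}(z)}{N^{\ell}}+O(N^{-L})\Big),$$ with implied constant depending only on $L,k,\delta,C$.
   Context: $(q)_N:=(1-q)(1-q^2)\cdots(1-q^N)$ (so $(\rho e^{z/N})_N=\prod_{j=1}^N(1-\rho^je^{jz/N})$). Polylogarithms: $\mathrm{Li}_2(w)=\sum w^n/n^2$ ($|w|\le1$); $\mathrm{Li}_1(w)=-\log(1-w)$ (principal); for integer $s\le0$ and $w\ne1$, $\mathrm{Li}_s(w)$ is the rational function $(w\frac{d}{dw})^{-s}\big(\frac{w}{1-w}\big)$, equal to $\sum n^{-s}w^n$ for $|w|<1$. $p(z):=(\mathrm{Li}_2(e^z)-\mathrm{Li}_2(1))/z$. Bernoulli polynomials: $ze^{\lambda z}/(e^z-1)=\sum B_n(\lambda)z^n/n!$, $B_n=B_n(0)$. Define (all powers principal) $g_\rho(z):=\Big(\frac{-z}{2\pi(1-e^z)}\Big)^{1/2}\prod_{j=1}^{k-1}\Big(\frac{1-\rho^{-j}e^z}{1-\rho^{-j}}\Big)^{j/k-1/2}$ and, for $\ell\ge1$, $f_{\rho,\ell}(z):=\frac{(-1)^{\ell+1}(kz)^\ell}{(\ell+1)!}\Big(\delta_{1,\ell}\frac1{12}+B_{\ell+1}\mathrm{Li}_{1-\ell}(e^z)+\sum_{j=1}^{k-1}B_{\ell+1}(j/k)\big\{\mathrm{Li}_{1-\ell}(\rho^{-j}e^z)-\mathrm{Li}_{1-\ell}(\rho^{-j})\big\}\Big)$.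 *)

(* Defs.v *)
From Stdlib Require Import Reals Lra Lia List Arith ClassicalEpsilon.
Open Scope R_scope.

Record CC := mkC { Cre : R; Cim : R }.

Definition RtoC (r : R) : CC := mkC r 0.
Definition C0 : CC := RtoC 0.
Definition C1 : CC := RtoC 1.
Definition Ci : CC := mkC 0 1.
Definition Cadd (z w : CC) : CC := mkC (Cre z + Cre w) (Cim z + Cim w).
Definition Copp (z : CC) : CC := mkC (- Cre z) (- Cim z).
Definition Csub (z w : CC) : CC := Cadd z (Copp w).
Definition Cmul (z w : CC) : CC :=
  mkC (Cre z * Cre w - Cim z * Cim w) (Cre z * Cim w + Cim z * Cre w).
Definition Cinv (z : CC) : CC :=
  let d := Cre z * Cre z + Cim z * Cim z in mkC (Cre z / d) (- Cim z / d).
Definition Cdiv (z w : CC) : CC := Cmul z (Cinv w).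
Fixpoint Cpow (z : CC) (n : nat) : CC :=
  match n with O => C1 | S m => Cmul z (Cpow z m) end.
Definition Cnorm (z : CC) : R := sqrt (Cre z * Cre z + Cim z * Cim z).

Definition Cexp (z : CC) : CC := mkC (exp (Cre z) * cos (Cim z)) (exp (Cre z) * sin (Cim z)).

(* principal argument, with values in (-PI, PI] (Arg 0 := 0) *)
Definition Carg (z : CC) : R :=
  let x := Cre z in let y := Cim z in
  if Rlt_dec 0 x then atan (y / x)
  else if Rlt_dec x 0 then
    (if Rle_dec 0 y then atan (y / x) + PI else atan (y / x) - PI)
  else if Rlt_dec 0 y then PI / 2
  else if Rlt_dec y 0 then - (PI / 2) else 0.

Definition Clog (z : CC) : CC := mkC (ln (Cnorm z)) (Carg z).

(* principal power w^a := exp (a * Log w)  (only used for w <> 0) *)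
Definition Cpowc (w a : CC) : CC := Cexp (Cmul a (Clog w)).

Declare Scope C_scope.
Delimit Scope C_scope with C.
Notation "x + y" := (Cadd x y) : C_scope.
Notation "x - y" := (Csub x y) : C_scope.
Notation "- x" := (Copp x) : C_scope.
Notation "x * y" := (Cmul x y) : C_scope.
Notation "x / y" := (Cdiv x y) : C_scope.
Notation "x ^ n" := (Cpow x n) : C_scope.

Definition Csum_range (a b : nat) (f : nat -> CC) : CC :=
  fold_right (fun i acc => Cadd (f i) acc) C0 (seq a (S b - a)).
Definition Cprod_range (a b : nat) (f : nat -> CC) : CC :=
  fold_right (fun i acc => Cmul (f i) acc) C1 (seq a (S b - a)).

Definition inhR : inhabited R := inhabits 0.
Definition inhC : inhabited CC := inhabits C0.

(* limit of a real sequence (meaningful when it converges) *)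
Definition lim_seq (u : nat -> R) : R := epsilon inhR (fun l => Un_cv u l).

(* complex derivative of f at w (meaningful when f is complex-differentiable at w) *)
Definition Cderiv (f : CC -> CC) (w : CC) : CC :=
  epsilon inhC (fun D => forall eps : R, 0 < eps -> exists d : R, 0 < d /\
     forall h : CC, h <> C0 -> Cnorm h < d ->
       Cnorm (Csub (Cdiv (Csub (f (Cadd w h)) (f w)) h) D) < eps).

Definition Li2_partial (w : CC) (m : nat) : CC :=
  Csum_range 1 m (fun n => Cdiv (Cpow w n) (RtoC (INR n ^ 2))).
Definition Li2 (w : CC) : CC :=
  mkC (lim_seq (fun m => Cre (Li2_partial w m))) (lim_seq (fun m => Cim (Li2_partial w m))).

Fixpoint Li_neg (m : nat) : CC -> CC :=
  match m with
  | O => fun w => Cdiv w (Csub C1 w)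
  | S m' => fun w => Cmul w (Cderiv (Li_neg m') w)
  end.

Definition Li_1m (l : nat) (w : CC) : CC := Li_neg (l - 1) w.

Definition pfun (z : CC) : CC := Cdiv (Csub (Li2 (Cexp z)) (Li2 C1)) z.

(* B_0 = 1, sum_{j=0}^{n} binom(n+1, j) B_j = 0 for n >= 1 (so B_1 = -1/2):
   the coefficients of z/(e^z-1) = sum B_n z^n/n! *)
Fixpoint bern_list (n : nat) : list R :=
  match n with
  | O => 1 :: nil
  | S n' => let l := bern_list n' in
      l ++ (- / INR (S n) *
            fold_right Rplus 0 (map (fun j => Binomial.C (S n) j * nth j l 0) (seq 0 n))) :: nil
  end.
Definition bernoulli (n : nat) : R := nth n (bern_list n) 0.

(* B_n(x) = sum_{j=0}^{n} binom(n,j) B_j x^(n-j), the coefficients of z e^{xz}/(e^z-1) *)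
Definition bernoulli_poly (n : nat) (x : R) : R :=
  fold_right Rplus 0 (map (fun j => Binomial.C n j * bernoulli j * x ^ (n - j)) (seq 0 (S n))).

Definition qpoch (q : CC) (N : nat) : CC := Cprod_range 1 N (fun j => Csub C1 (Cpow q j)).

Definition primitive_root (k : nat) (rho : CC) : Prop :=
  (1 <= k)%nat /\ Cpow rho k = C1 /\ (forall j : nat, (0 < j < k)%nat -> Cpow rho j <> C1).

Definition Cpow_neg (rho : CC) (j : nat) : CC := Cinv (Cpow rho j).

Definition gfun (k : nat) (rho z : CC) : CC :=
  Cmul (Cpowc (Cdiv (Copp z) (Cmul (RtoC (2 * PI)) (Csub C1 (Cexp z)))) (RtoC (1/2)))
       (Cprod_range 1 (k - 1) (fun j =>
          Cpowc (Cdiv (Csub C1 (Cmul (Cpow_neg rho j) (Cexp z))) (Csub C1 (Cpow_neg rho j)))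
                (RtoC (INR j / INR k - 1/2)))).

Definition ffun (k : nat) (rho : CC) (l : nat) (z : CC) : CC :=
  Cmul (Cdiv (Cmul (RtoC ((-1) ^ (S l))) (Cpow (Cmul (RtoC (INR k)) z) l)) (RtoC (INR (fact (S l)))))
   (Cadd (RtoC (if Nat.eqb l 1 then 1/12 else 0))
    (Cadd (Cmul (RtoC (bernoulli (S l))) (Li_1m l (Cexp z)))
          (Csum_range 1 (k - 1) (fun j =>
             Cmul (RtoC (bernoulli_poly (S l) (INR j / INR k)))
                  (Csub (Li_1m l (Cmul (Cpow_neg rho j) (Cexp z))) (Li_1m l (Cpow_neg rho j))))))).

(* Main.v *)
(* Write [N = k M] and group the factors [1 - q ^ j] of the q-Pochhammer symbol by the residue of
   [- j] modulo [k].  For the residue [i] the logarithms of the factors are samples, at the points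
   [t = (m + 1 - i / k) / M], of [t |-> Log (1 - rho ^ (-i) e ^ (t z))] on [0, 1], and shifted
   Euler-Maclaurin summation expands their sum: the main term is an integral, which is a difference
   of dilogarithms, and the boundary derivatives are the polylogarithms of nonpositive order.
   For [i = 0] the function is singular at [t = 0]; splitting off [ln t] leaves the smooth function
   [Log ((1 - e ^ (t z)) / t)], and the sum of the [ln t] is evaluated by Stirling's series.  By
   parity only the first derivative of the smooth function at [0] meets a nonzero Bernoulli number;
   it is the source of the constant [1/12].  The dilogarithms recombine by the distribution
   relation over the [k]-th roots of unity. *)
From Stdlib Require Import Reals Lra Lia List Arith ClassicalEpsilon.
From Coquelicot Require Import Rbar Hierarchy Rcomplements Continuity Derive
  RInt RInt_analysis Lim_seq.
Require Import Defs.
Open Scope R_scope.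

(** * Complex arithmetic *)

(** The implied constant may depend neither on [rho] nor on [z], and this shapes the proof. Both are
    carried as parameters of families ([ubd]) with derivatives bounded uniformly on [0, 1], and the
    gap [1 / k] between 1 and the other [k]-th roots of unity serves all [rho] at once. The factors
    [1 - q ^ j], and the numerators and denominators of the bases in [gfun], lie in the open right
    half-plane; hence principal logarithms are smooth along the paths and split over quotients
    without multiples of 2 pi i. Everything is followed along the ray [t * z] by real calculus in
    [t]; complex differentiation serves only to evaluate [Cderiv] inside [Li_neg]. At [t = 0] the
    dilogarithm reaches the unit circle, so it is not differentiated itself: its partial sums are
    compared with the primitive, with an error O(1/m). The Euler-Maclaurin remainder needs no
    periodic Bernoulli function: on one cell the formula is exact for polynomials, and Taylor's
    formula does the rest. The last term of each Euler-Maclaurin expansion has the size of the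
    remainder and is moved into it. *)

Lemma CC_eq (z w : CC) : Cre z = Cre w -> Cim z = Cim w -> z = w.
Proof. destruct z, w; simpl; intros -> ->; reflexivity. Qed.

Lemma C_sumsq_neq0 (z : CC) : z <> C0 -> Cre z * Cre z + Cim z * Cim z <> 0.
Proof.
  intros Hz E; apply Hz; destruct z as [x y]; simpl in *.
  apply CC_eq; simpl; nra.
Qed.

Lemma CC_field_theory :
  field_theory C0 C1 Cadd Cmul Csub Copp Cdiv Cinv (@eq CC).
Proof.
  split; [split|..]; intros; try reflexivity;
    try (apply CC_eq; simpl; ring).
  - intros E; apply (f_equal Cre) in E; simpl in E; lra.
  - pose proof (C_sumsq_neq0 p H) as Hd.
    apply CC_eq; simpl; field; exact Hd.
Qed.


Add Field CCfield : CC_field_theory.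

Lemma C1_neq_C0 : C1 <> C0.
Proof. intros E; apply (f_equal Cre) in E; simpl in E; lra. Qed.

Lemma RtoC_add a b : RtoC (a + b) = (RtoC a + RtoC b)%C.
Proof. apply CC_eq; simpl; ring. Qed.
Lemma RtoC_mul a b : RtoC (a * b) = (RtoC a * RtoC b)%C.
Proof. apply CC_eq; simpl; ring. Qed.
Lemma RtoC_opp a : RtoC (- a) = (- RtoC a)%C.
Proof. apply CC_eq; simpl; ring. Qed.
Lemma RtoC_sub a b : RtoC (a - b) = (RtoC a - RtoC b)%C.
Proof. apply CC_eq; simpl; ring. Qed.
Lemma RtoC_inv a : RtoC (/ a) = Cinv (RtoC a).
Proof.
  destruct (Req_dec a 0) as [->|Ha].
  - rewrite Rinv_0; apply CC_eq; simpl; unfold Rdiv;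
      rewrite ?Rmult_0_l, ?Ropp_0, ?Rmult_0_l; reflexivity.
  - apply CC_eq; simpl; field; nra.
Qed.
Lemma RtoC_div a b : RtoC (a / b) = (RtoC a / RtoC b)%C.
Proof. unfold Rdiv; rewrite RtoC_mul, RtoC_inv; reflexivity. Qed.
Lemma RtoC_pow a n : RtoC (a ^ n) = (RtoC a ^ n)%C.
Proof. induction n; simpl; [reflexivity|]; rewrite RtoC_mul, IHn; reflexivity. Qed.
Lemma RtoC_neq0 a : a <> 0 -> RtoC a <> C0.
Proof. intros H E; apply (f_equal Cre) in E; simpl in E; lra. Qed.

Lemma Cre_RtoC_mul a z : Cre (RtoC a * z)%C = a * Cre z.
Proof. simpl; ring. Qed.
Lemma Cim_RtoC_mul a z : Cim (RtoC a * z)%C = a * Cim z.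
Proof. simpl; ring. Qed.

Lemma Cmul_integral (a b : CC) : a <> C0 -> b <> C0 -> (a * b)%C <> C0.
Proof.
  intros Ha Hb E; apply Hb.
  replace b with (Cinv a * (a * b))%C by (field; exact Ha).
  rewrite E; ring.
Qed.

Lemma Cre_pos_neq0 (a : CC) : 0 < Cre a -> a <> C0.
Proof. intros H E; rewrite E in H; simpl in H; lra. Qed.

(** * Norm *)

Lemma Cnorm_ge0 z : 0 <= Cnorm z.
Proof. apply sqrt_pos. Qed.

Lemma Cnorm_sqr z : Cnorm z * Cnorm z = Cre z * Cre z + Cim z * Cim z.
Proof. apply sqrt_sqrt; nra. Qed.

Lemma Cnorm_eq0 z : Cnorm z = 0 -> z = C0.
Proof.
  intros E; pose proof (Cnorm_sqr z) as H; rewrite E in H.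
  apply CC_eq; simpl; nra.
Qed.

Lemma Cnorm_pos z : z <> C0 -> 0 < Cnorm z.
Proof.
  intros Hz; destruct (Cnorm_ge0 z) as [H|H]; auto.
  elim Hz; apply Cnorm_eq0; auto.
Qed.

Lemma Cnorm_uniq z r : 0 <= r -> r * r = Cre z * Cre z + Cim z * Cim z -> Cnorm z = r.
Proof. intros Hr E; unfold Cnorm; rewrite <- E; apply sqrt_square; auto. Qed.

Lemma Cnorm_mul z w : Cnorm (z * w)%C = Cnorm z * Cnorm w.
Proof.
  apply Cnorm_uniq.
  - apply Rmult_le_pos; apply Cnorm_ge0.
  - replace (Cnorm z * Cnorm w * (Cnorm z * Cnorm w))
      with ((Cnorm z * Cnorm z) * (Cnorm w * Cnorm w)) by ring.
    rewrite !Cnorm_sqr; simpl; ring.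
Qed.

Lemma Cnorm_RtoC a : Cnorm (RtoC a) = Rabs a.
Proof.
  apply Cnorm_uniq; [apply Rabs_pos|]; simpl.
  rewrite <- Rabs_mult, Rabs_right; nra.
Qed.

Lemma Cnorm_C1 : Cnorm C1 = 1.
Proof. unfold C1; rewrite Cnorm_RtoC; apply Rabs_R1. Qed.

Lemma Cnorm_C0 : Cnorm C0 = 0.
Proof. unfold C0; rewrite Cnorm_RtoC; apply Rabs_R0. Qed.

Lemma Cnorm_opp z : Cnorm (- z)%C = Cnorm z.
Proof. apply Cnorm_uniq; [apply Cnorm_ge0|]; rewrite Cnorm_sqr; simpl; ring. Qed.

Lemma Cnorm_inv z : z <> C0 -> Cnorm (Cinv z) = / Cnorm z.
Proof.
  intros Hz; pose proof (Cnorm_pos z Hz).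
  apply Rmult_eq_reg_r with (Cnorm z); [|lra].
  rewrite <- Cnorm_mul; replace (Cinv z * z)%C with C1 by (field; auto).
  rewrite Cnorm_C1; field; lra.
Qed.

Lemma Cnorm_pow z n : Cnorm (z ^ n)%C = Cnorm z ^ n.
Proof. induction n; simpl; [apply Cnorm_C1|]; rewrite Cnorm_mul, IHn; reflexivity. Qed.

Lemma Cre_le_norm z : Rabs (Cre z) <= Cnorm z.
Proof. unfold Cnorm; rewrite <- sqrt_Rsqr_abs; apply sqrt_le_1_alt; unfold Rsqr; nra. Qed.
Lemma Cim_le_norm z : Rabs (Cim z) <= Cnorm z.
Proof. unfold Cnorm; rewrite <- sqrt_Rsqr_abs; apply sqrt_le_1_alt; unfold Rsqr; nra. Qed.

Lemma Cnorm_add z w : Cnorm (z + w)%C <= Cnorm z + Cnorm w.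
Proof.
  pose proof (Cnorm_ge0 z); pose proof (Cnorm_ge0 w); pose proof (Cnorm_ge0 (z + w)%C).
  pose proof (Cnorm_sqr z); pose proof (Cnorm_sqr w); pose proof (Cnorm_sqr (z + w)%C) as Hs.
  simpl in Hs.
  assert (Hc : Cre z * Cre w + Cim z * Cim w <= Cnorm z * Cnorm w).
  { assert (E : (Cnorm z * Cnorm w) * (Cnorm z * Cnorm w) =
       (Cre z * Cre w + Cim z * Cim w) * (Cre z * Cre w + Cim z * Cim w)
       + (Cre z * Cim w - Cim z * Cre w) * (Cre z * Cim w - Cim z * Cre w)).
    { replace (Cnorm z * Cnorm w * (Cnorm z * Cnorm w))
      with ((Cnorm z * Cnorm z) * (Cnorm w * Cnorm w)) by ring.
      rewrite !Cnorm_sqr; ring. }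
    apply Rsqr_incr_0_var; [|apply Rmult_le_pos; auto].
      pose proof (Rle_0_sqr (Cre z * Cim w - Cim z * Cre w)); unfold Rsqr in *.
      rewrite E; lra. }
  apply Rsqr_incr_0_var; [|lra]. unfold Rsqr. nra.
Qed.

Lemma Cnorm_sub z w : Cnorm (z - w)%C <= Cnorm z + Cnorm w.
Proof. unfold Csub; rewrite <- (Cnorm_opp w); apply Cnorm_add. Qed.

Lemma Cnorm_sub_ge z w : Cnorm z - Cnorm w <= Cnorm (z - w)%C.
Proof.
  assert (Cnorm z <= Cnorm (z - w)%C + Cnorm w); [|lra].
  replace (Cnorm z) with (Cnorm ((z - w) + w)%C) by (f_equal; ring).
  apply Cnorm_add.
Qed.

Lemma Cnorm_le_re_im z : Cnorm z <= Rabs (Cre z) + Rabs (Cim z).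
Proof.
  replace z with (RtoC (Cre z) + mkC 0 (Cim z))%C at 1 by (apply CC_eq; simpl; ring).
  eapply Rle_trans; [apply Cnorm_add|].
  rewrite Cnorm_RtoC. apply Rplus_le_compat_l.
  right; apply Cnorm_uniq; [apply Rabs_pos|]; simpl.
  rewrite <- Rabs_mult, Rabs_right; nra.
Qed.

(** * Powers and the exponential *)

Lemma Cpow_add (z : CC) m n : (z ^ (m + n))%C = (z ^ m * z ^ n)%C.
Proof. induction m; simpl; [ring|]; rewrite IHm; ring. Qed.
Lemma Cpow_mul_l (z w : CC) n : ((z * w) ^ n)%C = (z ^ n * w ^ n)%C.
Proof. induction n; simpl; [ring|]; rewrite IHn; ring. Qed.
Lemma Cpow_mul_r (z : CC) m n : (z ^ (m * n))%C = ((z ^ m) ^ n)%C.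
Proof.
  induction n; [rewrite Nat.mul_0_r; reflexivity|].
  rewrite Nat.mul_succ_r, Nat.add_comm, Cpow_add, IHn; reflexivity.
Qed.
Lemma Cpow_C1 n : (C1 ^ n)%C = C1.
Proof. induction n; simpl; [reflexivity|]; rewrite IHn; ring. Qed.
Lemma Cpow_neq0 (z : CC) n : z <> C0 -> (z ^ n)%C <> C0.
Proof. intros Hz; induction n; simpl; [apply C1_neq_C0|apply Cmul_integral; auto]. Qed.
Lemma Cpow_inv (z : CC) n : z <> C0 -> (Cinv z ^ n)%C = Cinv (z ^ n)%C.
Proof.
  intros Hz; induction n; simpl.
  - field; apply C1_neq_C0.
  - rewrite IHn; field; split; [apply Cpow_neq0|]; auto.
Qed.

Lemma Cexp_add z w : Cexp (z + w)%C = (Cexp z * Cexp w)%C.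
Proof. apply CC_eq; simpl; rewrite exp_plus, ?cos_plus, ?sin_plus; ring. Qed.
Lemma Cexp_0 : Cexp C0 = C1.
Proof. apply CC_eq; simpl; rewrite exp_0, ?cos_0, ?sin_0; ring. Qed.
Lemma Cnorm_exp z : Cnorm (Cexp z) = exp (Cre z).
Proof.
  apply Cnorm_uniq; [left; apply exp_pos|]; simpl.
  pose proof (sin2_cos2 (Cim z)) as H; unfold Rsqr in H.
  replace (exp (Cre z) * exp (Cre z)) with
    (exp (Cre z) * exp (Cre z) * (sin (Cim z) * sin (Cim z) + cos (Cim z) * cos (Cim z)))
    by (rewrite H; ring).
  ring.
Qed.
Lemma Cexp_neq0 z : Cexp z <> C0.
Proof.
  intros E; pose proof (Cnorm_exp z) as H; rewrite E, Cnorm_C0 in H.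
  pose proof (exp_pos (Cre z)); lra.
Qed.
Lemma Cexp_opp z : Cexp (- z)%C = Cinv (Cexp z).
Proof.
  assert (H : (Cexp (- z) * Cexp z)%C = C1).
  { rewrite <- Cexp_add, <- Cexp_0; f_equal; ring. }
  replace (Cexp (- z)%C) with (Cexp (- z) * Cexp z * Cinv (Cexp z))%C
    by (field; apply Cexp_neq0).
  rewrite H; field; apply Cexp_neq0.
Qed.
Lemma Cexp_RtoC a : Cexp (RtoC a) = RtoC (exp a).
Proof. apply CC_eq; simpl; rewrite ?cos_0, ?sin_0; ring. Qed.
Lemma Cexp_pow z n : (Cexp z ^ n)%C = Cexp (RtoC (INR n) * z)%C.
Proof.
  induction n; simpl Cpow.
  - rewrite <- Cexp_0; f_equal; apply CC_eq; simpl; ring.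
  - rewrite IHn, <- Cexp_add; f_equal.
    rewrite S_INR; apply CC_eq; simpl; ring.
Qed.

(** * The principal logarithm *)

(** The half difference lies strictly between [- PI] and [PI], where the sine vanishes only at 0. *)
Lemma cos_sin_inj a b :
  - PI < a <= PI -> - PI < b <= PI -> cos a = cos b -> sin a = sin b -> a = b.
Proof.
  intros Ha Hb Hc Hs.
  assert (H : cos (a - b) = 1).
  { rewrite cos_minus, Hc, Hs; pose proof (sin2_cos2 b) as E; unfold Rsqr in E; lra. }
  assert (H2 : sin ((a - b) / 2) = 0).
  { pose proof (cos_2a_sin ((a - b) / 2)) as E.
    replace (2 * ((a - b) / 2)) with (a - b) in E by field. nra. }
  assert (Hpi := PI_RGT_0).
  destruct (Rtotal_order ((a - b) / 2) 0) as [Hl|[He|Hg]]; [|lra|].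
  - assert (0 < sin (- ((a - b) / 2))) by (apply sin_gt_0; lra).
    rewrite sin_neg in *; lra.
  - assert (0 < sin ((a - b) / 2)) by (apply sin_gt_0; lra); lra.
Qed.

Lemma Cexp_Clog z : z <> C0 -> Cexp (Clog z) = z.
Proof.
  intros Hz; pose proof (Cnorm_pos z Hz) as Hn; pose proof (Cnorm_sqr z) as Hs.
  assert (Hc : forall x y, x <> 0 ->
     cos (atan (y / x)) = Rabs x / sqrt (x * x + y * y) /\
     sin (atan (y / x)) = Rabs x / x * y / sqrt (x * x + y * y)).
  { intros x y Hx.
    assert (E : sqrt (1 + (y / x)²) = sqrt (x * x + y * y) / Rabs x).
    { rewrite <- sqrt_Rsqr_abs, <- sqrt_div_alt by (unfold Rsqr; nra).
      f_equal; unfold Rsqr; field; auto. }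
    assert (0 < sqrt (x * x + y * y)) by (apply sqrt_lt_R0; nra).
    pose proof (Rabs_pos_lt x Hx).
    rewrite cos_atan, sin_atan, E; split; field; repeat split; lra. }
  destruct z as [x y]; unfold Cexp, Clog, Carg; simpl in *.
  rewrite exp_ln by auto.
  assert (En : Cnorm (mkC x y) = sqrt (x * x + y * y)) by reflexivity.
  assert (Hpi := PI_RGT_0).
  destruct (Rlt_dec 0 x).
  { destruct (Hc x y) as [-> ->]; [lra|]; rewrite <- En, Rabs_right by lra.
    f_equal; field; lra. }
  destruct (Rlt_dec x 0).
  (* The sign [e] treats at once the two branches [+ PI] and [- PI] of [Carg] on the left
     half-plane. *)
  { assert (G : forall e, (e = 1 \/ e = -1) ->
       {| Cre := Cnorm {| Cre := x; Cim := y |} * cos (atan (y / x) + e * PI);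
     Cim := Cnorm {| Cre := x; Cim := y |} * sin (atan (y / x) + e * PI) |} =
  {| Cre := x; Cim := y |}).
    { intros e He.
      assert (cos (e * PI) = -1 /\ sin (e * PI) = 0) as [E1 E2].
      { destruct He as [-> | ->].
        - rewrite Rmult_1_l, cos_PI, sin_PI; auto.
        - replace (-1 * PI) with (- PI) by ring.
          rewrite cos_neg, sin_neg, cos_PI, sin_PI; split; ring. }
      rewrite cos_plus, sin_plus, E1, E2.
      destruct (Hc x y) as [-> ->]; [lra|]; rewrite <- En, Rabs_left by lra.
      f_equal; field; lra. }
    destruct (Rle_dec 0 y).
    - replace (atan (y / x) + PI) with (atan (y / x) + 1 * PI) by ring; apply G; auto.
    - replace (atan (y / x) - PI) with (atan (y / x) + -1 * PI) by ring; apply G; auto. }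
  assert (x = 0) by lra; subst x.
  destruct (Rlt_dec 0 y).
  { rewrite cos_PI2, sin_PI2; f_equal; [ring|].
    replace (Cnorm _) with y; [ring|symmetry; apply Cnorm_uniq; simpl; nra]. }
  destruct (Rlt_dec y 0).
  { rewrite cos_neg, sin_neg, cos_PI2, sin_PI2; f_equal; [ring|].
    replace (Cnorm _) with (-y); [ring|symmetry; apply Cnorm_uniq; simpl; nra]. }
  elim Hz; apply CC_eq; simpl; lra.
Qed.

Lemma Carg_range z : - PI < Carg z <= PI.
Proof.
  assert (Hpi := PI_RGT_0).
  unfold Carg; pose proof (atan_bound (Cim z / Cre z)) as Ha.
  destruct (Rlt_dec 0 (Cre z)); [lra|].
  destruct (Rlt_dec (Cre z) 0).
  { destruct (Rle_dec 0 (Cim z)).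
    - split; [lra|].
      assert (atan (Cim z / Cre z) <= 0); [|lra].
      rewrite <- atan_0.
      assert (Cim z / Cre z <= 0).
      { unfold Rdiv; assert (/ Cre z < 0) by (apply Rinv_lt_0_compat; auto); nra. }
      destruct (Rle_lt_or_eq_dec _ _ H) as [Hl|E].
      + left; apply atan_increasing; auto.
      + rewrite E; lra.
    - split; [|lra].
      assert (0 < atan (Cim z / Cre z)); [|lra].
      rewrite <- atan_0; apply atan_increasing.
      unfold Rdiv; assert (/ Cre z < 0) by (apply Rinv_lt_0_compat; auto); nra. }
  destruct (Rlt_dec 0 (Cim z)); [lra|].
  destruct (Rlt_dec (Cim z) 0); lra.
Qed.

(** Reduces every identity between principal logarithms to an exponential identity and a range check
    on the imaginary part. *)
Lemma Clog_uniq z w : Cexp w = z -> - PI < Cim w <= PI -> Clog z = w.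
Proof.
  intros E Hw.
  assert (Hz : z <> C0) by (rewrite <- E; apply Cexp_neq0).
  assert (Hn : Cnorm z = exp (Cre w)) by (rewrite <- E; apply Cnorm_exp).
  pose proof (Cexp_Clog z Hz) as El. rewrite <- E in El at 2.
  assert (Er : Cre (Clog z) = Cre w) by (simpl; rewrite Hn; apply ln_exp).
  apply CC_eq; auto.
  pose proof (exp_pos (Cre w)).
  apply cos_sin_inj; auto; [apply Carg_range|..].
  - assert (H1 : exp (Cre (Clog z)) * cos (Cim (Clog z)) = exp (Cre w) * cos (Cim w))
      by exact (f_equal Cre El).
    rewrite Er in H1; apply Rmult_eq_reg_l in H1; auto; lra.
  - assert (H1 : exp (Cre (Clog z)) * sin (Cim (Clog z)) = exp (Cre w) * sin (Cim w))
      by exact (f_equal Cim El).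
    rewrite Er in H1; apply Rmult_eq_reg_l in H1; auto; lra.
Qed.

Lemma Carg_re_pos z : 0 < Cre z -> - (PI / 2) < Carg z < PI / 2.
Proof.
  intros H; unfold Carg; destruct (Rlt_dec 0 (Cre z)); [|lra].
  pose proof (atan_bound (Cim z / Cre z)); lra.
Qed.

(** Both arguments lie in (-PI/2, PI/2), so their difference stays in the principal range and no
    multiple of 2 pi i appears. *)
Lemma Clog_div a b : 0 < Cre a -> 0 < Cre b -> Clog (a / b)%C = (Clog a - Clog b)%C.
Proof.
  intros Ha Hb; pose proof (Carg_re_pos a Ha); pose proof (Carg_re_pos b Hb).
  apply Clog_uniq.
  - unfold Csub; rewrite Cexp_add, Cexp_opp, !Cexp_Clog by (apply Cre_pos_neq0; auto).
    reflexivity.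
  - simpl; lra.
Qed.

Lemma Clog_RtoC_mul r a : 0 < r -> a <> C0 -> Clog (RtoC r * a)%C = (RtoC (ln r) + Clog a)%C.
Proof.
  intros Hr Ha. apply Clog_uniq.
  - rewrite Cexp_add, Cexp_RtoC, exp_ln, Cexp_Clog; auto.
  - pose proof (Carg_range a); simpl; lra.
Qed.

Lemma Clog_C1 : Clog C1 = C0.
Proof. apply Clog_uniq; [apply Cexp_0|]; simpl; pose proof PI_RGT_0; lra. Qed.

(** * Complex functions of a real variable *)

(** Differentiation in a real parameter, by components, so that the real theory applies. It suffices
    because functions are only followed along the segment [t * z]. *)
Definition cder (f : R -> CC) (x : R) (l : CC) : Prop :=
  is_derive (fun t => Cre (f t)) x (Cre l) /\ is_derive (fun t => Cim (f t)) x (Cim l).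

Lemma cder_eq f x l l' : cder f x l -> l = l' -> cder f x l'.
Proof. intros H <-; exact H. Qed.

Lemma cder_ext_loc f g x l :
  locally x (fun t => f t = g t) -> cder f x l -> cder g x l.
Proof.
  intros He [H1 H2]; split.
  - eapply is_derive_ext_loc; [|exact H1].
    eapply filter_imp; [|exact He]; simpl; intros t ->; reflexivity.
  - eapply is_derive_ext_loc; [|exact H2].
    eapply filter_imp; [|exact He]; simpl; intros t ->; reflexivity.
Qed.

Lemma cder_ext f g x l : (forall t, f t = g t) -> cder f x l -> cder g x l.
Proof. intros He; apply cder_ext_loc; apply filter_forall; auto. Qed.

Lemma cder_uniq f x l l' : cder f x l -> cder f x l' -> l = l'.
Proof.
  intros [H1 H2] [H3 H4]; apply CC_eq.
  - rewrite <- (is_derive_unique _ _ _ H1); apply is_derive_unique; auto.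
  - rewrite <- (is_derive_unique _ _ _ H2); apply is_derive_unique; auto.
Qed.

Lemma is_derive_constR (c x : R) : is_derive (fun _ : R => c) x 0.
Proof. apply is_derive_Reals, derivable_pt_lim_const. Qed.

Lemma cder_const c x : cder (fun _ => c) x C0.
Proof. split; simpl; apply is_derive_constR. Qed.

Lemma cder_RtoC g x l : is_derive g x l -> cder (fun t => RtoC (g t)) x (RtoC l).
Proof.
  intros H; split; simpl; auto.
  apply is_derive_constR.
Qed.

Lemma is_derive_idR (x : R) : is_derive (fun t : R => t) x 1.
Proof. apply is_derive_Reals, derivable_pt_lim_id. Qed.

Lemma cder_id x : cder RtoC x C1.
Proof. apply (cder_RtoC (fun t => t)), is_derive_idR. Qed.

Lemma is_derive_plusR (f g : R -> R) x a b :
  is_derive f x a -> is_derive g x b -> is_derive (fun t => f t + g t) x (a + b).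
Proof. rewrite !is_derive_Reals; apply derivable_pt_lim_plus. Qed.
Lemma is_derive_minusR (f g : R -> R) x a b :
  is_derive f x a -> is_derive g x b -> is_derive (fun t => f t - g t) x (a - b).
Proof. rewrite !is_derive_Reals; apply derivable_pt_lim_minus. Qed.
Lemma is_derive_oppR (f : R -> R) x a :
  is_derive f x a -> is_derive (fun t => - f t) x (- a).
Proof. rewrite !is_derive_Reals; apply derivable_pt_lim_opp. Qed.
Lemma is_derive_multR (f g : R -> R) x a b :
  is_derive f x a -> is_derive g x b -> is_derive (fun t => f t * g t) x (a * g x + f x * b).
Proof. rewrite !is_derive_Reals; apply derivable_pt_lim_mult. Qed.
Lemma is_derive_divR (f g : R -> R) x a b :
  is_derive f x a -> is_derive g x b -> g x <> 0 ->
  is_derive (fun t => f t / g t) x ((a * g x - b * f x) / Rsqr (g x)).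
Proof. rewrite !is_derive_Reals; apply derivable_pt_lim_div. Qed.
Lemma is_derive_compR (f g : R -> R) x a b :
  is_derive f x a -> is_derive g (f x) b -> is_derive (fun t => g (f t)) x (b * a).
Proof. rewrite !is_derive_Reals; apply derivable_pt_lim_comp. Qed.
Lemma is_derive_eq (f : R -> R) x (a b : R) : is_derive f x a -> a = b -> is_derive f x b.
Proof. intros H <-; exact H. Qed.

Lemma cder_add f g x a b :
  cder f x a -> cder g x b -> cder (fun t => f t + g t)%C x (a + b)%C.
Proof. intros [] []; split; simpl; apply is_derive_plusR; auto. Qed.

Lemma cder_opp f x a : cder f x a -> cder (fun t => - f t)%C x (- a)%C.
Proof. intros []; split; simpl; apply is_derive_oppR; auto. Qed.

Lemma cder_sub f g x a b :
  cder f x a -> cder g x b -> cder (fun t => f t - g t)%C x (a - b)%C.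
Proof. intros; apply cder_add; auto; apply cder_opp; auto. Qed.

Lemma cder_mul f g x a b :
  cder f x a -> cder g x b -> cder (fun t => f t * g t)%C x (a * g x + f x * b)%C.
Proof.
  intros [H1 H2] [H3 H4]; split; simpl.
  - eapply is_derive_eq.
    + apply is_derive_minusR; apply is_derive_multR; eauto.
    + cbv beta; ring.
  - eapply is_derive_eq.
    + apply is_derive_plusR; apply is_derive_multR; eauto.
    + cbv beta; ring.
Qed.

Lemma cder_scal c f x a : cder f x a -> cder (fun t => c * f t)%C x (c * a)%C.
Proof.
  intros H; eapply cder_eq; [apply cder_mul; [apply cder_const|exact H]|]; cbv beta; ring.
Qed.

Lemma cder_inv f x a :
  cder f x a -> f x <> C0 -> cder (fun t => Cinv (f t)) x (- (a * (Cinv (f x) * Cinv (f x))))%C.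
Proof.
  intros [H1 H2] Hx; pose proof (C_sumsq_neq0 _ Hx) as Hd.
  assert (H3 : is_derive (fun t => Cre (f t) * Cre (f t) + Cim (f t) * Cim (f t)) x
    (Cre a * Cre (f x) + Cre (f x) * Cre a + (Cim a * Cim (f x) + Cim (f x) * Cim a))).
  { apply is_derive_plusR; apply is_derive_multR; auto. }
  split; simpl.
  - eapply is_derive_eq.
    + apply is_derive_divR; eauto.
    + unfold Rsqr; cbv beta; field; auto.
  - eapply is_derive_eq.
    + apply is_derive_divR; [apply is_derive_oppR; eauto|eauto|auto].
    + unfold Rsqr; cbv beta; field; auto.
Qed.

Lemma cder_Cexp f x a : cder f x a -> cder (fun t => Cexp (f t)) x (Cexp (f x) * a)%C.
Proof.
  intros [H1 H2].
  assert (He : is_derive (fun t => exp (Cre (f t))) x (exp (Cre (f x)) * Cre a)).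
  { apply (is_derive_compR _ exp); auto; apply is_derive_Reals, derivable_pt_lim_exp. }
  assert (Hc : is_derive (fun t => cos (Cim (f t))) x (- sin (Cim (f x)) * Cim a)).
  { apply (is_derive_compR _ cos); auto; apply is_derive_Reals, derivable_pt_lim_cos. }
  assert (Hs : is_derive (fun t => sin (Cim (f t))) x (cos (Cim (f x)) * Cim a)).
  { apply (is_derive_compR _ sin); auto; apply is_derive_Reals, derivable_pt_lim_sin. }
  split; simpl.
  - eapply is_derive_eq; [apply is_derive_multR; eauto|]; cbv beta; ring.
  - eapply is_derive_eq; [apply is_derive_multR; eauto|]; cbv beta; ring.
Qed.

Lemma is_derive_cont (f : R -> R) x l : is_derive f x l -> continuous f x.
Proof. intros H; apply (ex_derive_continuous (V := R_NormedModule)); exists l; auto. Qed.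

(** In the right half-plane [Carg] agrees near the point with [atan (y / x)]; every logarithm
    differentiated below takes its argument there. *)
Lemma cder_Clog f x a :
  cder f x a -> 0 < Cre (f x) -> cder (fun t => Clog (f t)) x (a / f x)%C.
Proof.
  intros [H1 H2] Hx.
  assert (Hp : 0 < Cre (f x) * Cre (f x) + Cim (f x) * Cim (f x)) by nra.
  split; simpl.
  - unfold Cnorm.
    assert (H3 : is_derive (fun t => Cre (f t) * Cre (f t) + Cim (f t) * Cim (f t)) x
      (Cre a * Cre (f x) + Cre (f x) * Cre a + (Cim a * Cim (f x) + Cim (f x) * Cim a))).
    { apply is_derive_plusR; apply is_derive_multR; auto. }
    eapply is_derive_eq.
    + apply (is_derive_compR (fun t => sqrt (Cre (f t) * Cre (f t) + Cim (f t) * Cim (f t))) ln).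
      * apply (is_derive_compR _ sqrt); [exact H3|].
        apply is_derive_Reals, derivable_pt_lim_sqrt; auto.
      * apply is_derive_Reals, derivable_pt_lim_ln; apply sqrt_lt_R0; auto.
    + cbv beta; pose proof (sqrt_lt_R0 _ Hp).
      set (s := sqrt _) in *.
      assert (E : s * s = Cre (f x) * Cre (f x) + Cim (f x) * Cim (f x))
        by (apply sqrt_sqrt; lra).
      apply Rmult_eq_reg_r with (s * s); [|nra].
      transitivity (Cre a * Cre (f x) + Cim (f x) * Cim a); [field; lra|].
      rewrite E; field; lra.
  - apply is_derive_ext_loc with (fun t => atan (Cim (f t) / Cre (f t))).
    + assert (Hl : locally x (fun t => 0 < Cre (f t))).
      { apply (is_derive_cont _ _ _ H1 (fun y => 0 < y)), (open_gt 0 (Cre (f x))); auto. }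
      eapply filter_imp; [|exact Hl]; simpl; intros t Ht; unfold Carg.
      destruct (Rlt_dec 0 (Cre (f t))); [reflexivity|lra].
    + eapply is_derive_eq.
      * apply (is_derive_compR _ atan); [apply is_derive_divR; eauto; lra|].
        apply is_derive_Reals, derivable_pt_lim_atan.
      * unfold Rsqr; cbv beta; field; repeat split; nra.
Qed.

Lemma cder_continuity f x l : cder f x l ->
  continuous (fun t => Cre (f t)) x /\ continuous (fun t => Cim (f t)) x.
Proof. intros [H1 H2]; split; eapply is_derive_cont; eauto. Qed.

Definition cint (f : R -> CC) (x : R) : CC :=
  mkC (RInt (fun t => Cre (f t)) 0 x) (RInt (fun t => Cim (f t)) 0 x).

Lemma is_derive_RInt_cont (f : R -> R) x :
  (forall t, continuous f t) -> is_derive (fun y => RInt f 0 y) x (f x).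
Proof.
  intros H; apply (is_derive_RInt f (fun y => RInt f 0 y) 0 x); [|auto].
  apply filter_forall; intros y; apply (RInt_correct (V := R_CompleteNormedModule)), (ex_RInt_continuous (V := R_CompleteNormedModule)); auto.
Qed.

Lemma cder_cint f x :
  (forall t, exists l, cder f t l) -> cder (cint f) x (f x).
Proof.
  intros H; split; simpl; apply is_derive_RInt_cont; intros t; destruct (H t) as [l Hl];
    destruct (cder_continuity _ _ _ Hl); auto.
Qed.

Lemma cint_0 f : cint f 0 = C0.
Proof. apply CC_eq; simpl; apply (RInt_point (V := R_CompleteNormedModule)). Qed.

Lemma is_derive_continuity_pt (f : R -> R) x l : is_derive f x l -> continuity_pt f x.
Proof. intros H; apply continuity_pt_filterlim; eapply is_derive_cont; eauto. Qed.

(** The functions [g - f] and [g + f] are nondecreasing, by the mean value theorem. This replaces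
    bounds on integrals. *)
Lemma derive_dominated (f g f' g' : R -> R) a b : a <= b ->
  (forall t, a <= t <= b -> is_derive f t (f' t)) ->
  (forall t, a <= t <= b -> is_derive g t (g' t)) ->
  (forall t, a <= t <= b -> Rabs (f' t) <= g' t) ->
  Rabs (f b - f a) <= g b - g a.
Proof.
  intros Hab Hf Hg Hd.
  assert (Hs : forall s, (s = 1 \/ s = -1) -> s * (f b - f a) <= g b - g a).
  { intros s Hs.
    destruct (MVT_gen (fun t => g t - s * f t) a b (fun t => g' t - s * f' t))
      as (c & Hc & E); rewrite ?Rmin_left, ?Rmax_right in * by auto.
    - intros t Ht; apply is_derive_minusR; [apply Hg; lra|].
      eapply is_derive_eq; [apply is_derive_multR; [apply is_derive_constR|apply Hf; lra]|].
      cbv beta; ring.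
    - intros t Ht. apply is_derive_continuity_pt with (g' t - s * f' t).
      apply is_derive_minusR; [apply Hg; lra|].
      eapply is_derive_eq; [apply is_derive_multR; [apply is_derive_constR|apply Hf; lra]|].
      cbv beta; ring.
    - cbv beta in E; assert (0 <= g' c - s * f' c).
      { pose proof (Hd c Hc) as H. apply Rabs_le_between in H. destruct Hs as [-> | ->]; lra. }
      assert (0 <= (g' c - s * f' c) * (b - a)) by (apply Rmult_le_pos; lra). lra. }
  pose proof (Hs 1 (or_introl eq_refl)); pose proof (Hs (-1) (or_intror eq_refl)).
  apply Rabs_le; lra.
Qed.

(** The factor 2 is the price of adding the bounds for the real and the imaginary part; only orders
    of magnitude matter later. *)
Lemma cder_dominated f f' (g g' : R -> R) a b : a <= b ->
  (forall t, a <= t <= b -> cder f t (f' t)) ->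
  (forall t, a <= t <= b -> is_derive g t (g' t)) ->
  (forall t, a <= t <= b -> Cnorm (f' t) <= g' t) ->
  Cnorm (f b - f a)%C <= 2 * (g b - g a).
Proof.
  intros Hab Hf Hg Hd.
  eapply Rle_trans; [apply Cnorm_le_re_im|].
  assert (Rabs (Cre (f b) - Cre (f a)) <= g b - g a).
  { apply (derive_dominated (fun t => Cre (f t)) g (fun t => Cre (f' t)) g'); auto.
    - intros t Ht; apply Hf; auto.
    - intros t Ht; eapply Rle_trans; [apply Cre_le_norm|auto]. }
  assert (Rabs (Cim (f b) - Cim (f a)) <= g b - g a).
  { apply (derive_dominated (fun t => Cim (f t)) g (fun t => Cim (f' t)) g'); auto.
    - intros t Ht; apply Hf; auto.
    - intros t Ht; eapply Rle_trans; [apply Cim_le_norm|auto]. }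
  simpl; unfold Rminus in *; lra.
Qed.

Lemma cder_zero_const f a b : a <= b ->
  (forall t, a <= t <= b -> cder f t C0) -> f b = f a.
Proof.
  intros Hab Hf.
  assert (H : Cnorm (f b - f a)%C <= 2 * ((fun _ => 0) b - (fun _ => 0) a)).
  { apply cder_dominated with (f' := fun _ => C0) (g := fun _ => 0) (g' := fun _ => 0); auto.
    - intros; apply is_derive_constR.
    - intros; rewrite Cnorm_C0; lra. }
  simpl in H; pose proof (Cnorm_ge0 (f b - f a)%C).
  assert (E : (f b - f a)%C = C0) by (apply Cnorm_eq0; lra).
  replace (f b) with (f a + (f b - f a))%C by ring; rewrite E; ring.
Qed.

(** * Finite sums *)

Fixpoint csum (n : nat) (f : nat -> CC) : CC :=
  match n with O => C0 | S m => (csum m f + f m)%C end.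

Fixpoint rsum (n : nat) (f : nat -> R) : R :=
  match n with O => 0 | S m => rsum m f + f m end.

Lemma rsum_ext n f g : (forall i, (i < n)%nat -> f i = g i) -> rsum n f = rsum n g.
Proof. induction n; simpl; intros H; auto; rewrite IHn, H; auto. Qed.

Lemma csum_ext n f g : (forall i, (i < n)%nat -> f i = g i) -> csum n f = csum n g.
Proof. induction n; simpl; intros H; auto; rewrite IHn, H; auto. Qed.

Lemma rsum_add n f g : rsum n (fun i => f i + g i) = rsum n f + rsum n g.
Proof. induction n; simpl; [ring|]; rewrite IHn; ring. Qed.
Lemma rsum_scal n c f : rsum n (fun i => c * f i) = c * rsum n f.
Proof. induction n; simpl; [ring|]; rewrite IHn; ring. Qed.
Lemma csum_add n f g : csum n (fun i => f i + g i)%C = (csum n f + csum n g)%C.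
Proof. induction n; simpl; [ring|]; rewrite IHn; ring. Qed.
Lemma csum_scal n c f : csum n (fun i => c * f i)%C = (c * csum n f)%C.
Proof. induction n; simpl; [ring|]; rewrite IHn; ring. Qed.
Lemma csum_sub n f g : csum n (fun i => f i - g i)%C = (csum n f - csum n g)%C.
Proof. induction n; simpl; [ring|]; rewrite IHn; ring. Qed.
Lemma csum_const n c : csum n (fun _ => c) = (RtoC (INR n) * c)%C.
Proof.
  induction n; [apply CC_eq; simpl; ring|].
  rewrite S_INR, RtoC_add; simpl csum; rewrite IHn; change (RtoC 1) with C1; ring.
Qed.
Lemma Cre_csum n f : Cre (csum n f) = rsum n (fun i => Cre (f i)).
Proof. induction n; simpl; auto; rewrite IHn; auto. Qed.
Lemma Cim_csum n f : Cim (csum n f) = rsum n (fun i => Cim (f i)).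
Proof. induction n; simpl; auto; rewrite IHn; auto. Qed.
Lemma RtoC_rsum n f : RtoC (rsum n f) = csum n (fun i => RtoC (f i)).
Proof. induction n; simpl; auto; rewrite RtoC_add, IHn; auto. Qed.
Lemma csum_swap n m f :
  csum n (fun i => csum m (fun j => f i j)) = csum m (fun j => csum n (fun i => f i j)).
Proof.
  induction n; simpl.
  - induction m; simpl; auto; rewrite <- IHm; ring.
  - rewrite IHn, <- csum_add; auto.
Qed.
Lemma csum_shift n f : csum (S n) f = (f 0%nat + csum n (fun i => f (S i)))%C.
Proof. induction n; [simpl; ring|]. simpl in *; rewrite IHn; ring. Qed.
Lemma rsum_shift n f : rsum (S n) f = f 0%nat + rsum n (fun i => f (S i)).
Proof. induction n; [simpl; ring|]. simpl in *; rewrite IHn; ring. Qed.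
Lemma csum_rev n f : csum n f = csum n (fun i => f (n - S i)%nat).
Proof.
  induction n; auto.
  rewrite (csum_shift n (fun i => f (S n - S i)%nat)).
  simpl; rewrite IHn, Nat.sub_0_r. ring.
Qed.
Lemma csum_cat m n f : csum (m + n) f = (csum m f + csum n (fun i => f (m + i)%nat))%C.
Proof.
  induction n; [rewrite Nat.add_0_r; simpl; ring|].
  rewrite Nat.add_succ_r; simpl; rewrite IHn; ring.
Qed.

(** Within a block the order is reversed: [S (k * m + (k - S i)) = k * (m + 1) - i], so for
    exponents counted from 1 the index [i] is the residue of minus the exponent modulo [k]. *)
Lemma csum_blocks k M f :
  csum (k * M) f = csum M (fun m => csum k (fun i => f (k * m + (k - S i))%nat)).
Proof.
  induction M; [rewrite Nat.mul_0_r; reflexivity|].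
  rewrite Nat.mul_succ_r, csum_cat, IHM; simpl; f_equal.
  rewrite csum_rev; reflexivity.
Qed.

Lemma Cnorm_csum_le n f g : (forall i, (i < n)%nat -> Cnorm (f i) <= g i) ->
  Cnorm (csum n f) <= rsum n g.
Proof.
  induction n; simpl; intros H; [rewrite Cnorm_C0; lra|].
  eapply Rle_trans; [apply Cnorm_add|]; apply Rplus_le_compat; auto.
Qed.
Lemma Rabs_rsum_le n f g : (forall i, (i < n)%nat -> Rabs (f i) <= g i) ->
  Rabs (rsum n f) <= rsum n g.
Proof.
  induction n; simpl; intros H; [rewrite Rabs_R0; lra|].
  eapply Rle_trans; [apply Rabs_triang|]; apply Rplus_le_compat; auto.
Qed.
Lemma rsum_le n f g : (forall i, (i < n)%nat -> f i <= g i) -> rsum n f <= rsum n g.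
Proof. induction n; simpl; intros H; [lra|]; apply Rplus_le_compat; auto. Qed.
Lemma rsum_const n c : rsum n (fun _ => c) = INR n * c.
Proof. induction n; [simpl; ring|]; rewrite S_INR; simpl rsum; rewrite IHn; ring. Qed.
Lemma rsum_ge0 n f : (forall i, (i < n)%nat -> 0 <= f i) -> 0 <= rsum n f.
Proof.
  intros H; replace 0 with (rsum n (fun _ => 0)) by (rewrite rsum_const; ring).
  apply rsum_le; auto.
Qed.

Lemma fold_seq_csum f a n :
  fold_right (fun i acc => Cadd (f i) acc) C0 (seq a n) = csum n (fun i => f (a + i)%nat).
Proof.
  revert a; induction n; intros a; [reflexivity|].
  rewrite csum_shift; simpl; rewrite IHn, Nat.add_0_r; f_equal.
  apply csum_ext; intros; f_equal; lia.
Qed.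

Lemma Csum_range_csum n f : Csum_range 1 n f = csum n (fun i => f (S i)).
Proof.
  unfold Csum_range; rewrite fold_seq_csum; replace (S n - 1)%nat with n by lia.
  apply csum_ext; intros; f_equal; lia.
Qed.

Lemma Cprod_range_exp n f g :
  (forall i, (i < n)%nat -> f (S i) = Cexp (g i)) -> Cprod_range 1 n f = Cexp (csum n g).
Proof.
  unfold Cprod_range; replace (S n - 1)%nat with n by lia.
  assert (G : forall a, (forall i, (i < n)%nat -> f (a + i)%nat = Cexp (g i)) ->
    fold_right (fun i acc => Cmul (f i) acc) C1 (seq a n) = Cexp (csum n g)); [|intros; apply G; auto].
  revert g; induction n; intros g a H; simpl; [symmetry; apply Cexp_0|].
  rewrite (IHn (fun i => g (S i))).
  - change (csum n g + g n)%C with (csum (S n) g).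
    rewrite csum_shift, Cexp_add, <- (H 0%nat), Nat.add_0_r by lia; reflexivity.
  - intros i Hi; rewrite <- H by lia; f_equal; lia.
Qed.

Lemma fold_map_seq_rsum f a n :
  fold_right Rplus 0 (map f (seq a n)) = rsum n (fun i => f (a + i)%nat).
Proof.
  revert a; induction n; intros a; [reflexivity|].
  rewrite rsum_shift; simpl; rewrite IHn, Nat.add_0_r; f_equal.
  apply rsum_ext; intros; f_equal; lia.
Qed.

Lemma cder_csum n (F F' : nat -> R -> CC) x :
  (forall i, (i < n)%nat -> cder (F i) x (F' i x)) ->
  cder (fun t => csum n (fun i => F i t)) x (csum n (fun i => F' i x)).
Proof.
  induction n; simpl; intros H; [apply cder_const|].
  apply cder_add; auto.
Qed.

Lemma is_derive_rsum n (F F' : nat -> R -> R) x :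
  (forall i, (i < n)%nat -> is_derive (F i) x (F' i x)) ->
  is_derive (fun t => rsum n (fun i => F i t)) x (rsum n (fun i => F' i x)).
Proof.
  induction n; simpl; intros H.
  - apply is_derive_constR.
  - apply is_derive_plusR; auto.
Qed.

(** * Complex differentiation and the polylogarithms of nonpositive order *)

Definition lim0 (r : CC -> CC) : Prop :=
  forall eps, 0 < eps -> exists d, 0 < d /\
    forall h, h <> C0 -> Cnorm h < d -> Cnorm (r h) < eps.

Lemma lim0_ext r s : (exists d, 0 < d /\ forall h, h <> C0 -> Cnorm h < d -> r h = s h) ->
  lim0 r -> lim0 s.
Proof.
  intros (d0 & Hd0 & He) H eps Heps; destruct (H eps Heps) as (d & Hd & Hr).
  exists (Rmin d d0); split; [apply Rmin_pos; auto|].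
  intros h Hh Hn; rewrite <- He; auto.
  - apply Hr; auto; eapply Rlt_le_trans; [exact Hn|apply Rmin_l].
  - eapply Rlt_le_trans; [exact Hn|apply Rmin_r].
Qed.

Lemma lim0_add r s : lim0 r -> lim0 s -> lim0 (fun h => r h + s h)%C.
Proof.
  intros Hr Hs eps Heps.
  destruct (Hr (eps / 2)) as (d & Hd & H1); [lra|].
  destruct (Hs (eps / 2)) as (e & He & H2); [lra|].
  exists (Rmin d e); split; [apply Rmin_pos; auto|].
  intros h Hh Hn; eapply Rle_lt_trans; [apply Cnorm_add|].
  pose proof (Rmin_l d e); pose proof (Rmin_r d e).
  pose proof (H1 h Hh ltac:(lra)); pose proof (H2 h Hh ltac:(lra)); lra.
Qed.

Lemma lim0_mul_bounded r s B :
  (exists d, 0 < d /\ forall h, h <> C0 -> Cnorm h < d -> Cnorm (s h) <= B) ->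
  lim0 r -> lim0 (fun h => s h * r h)%C.
Proof.
  intros (d0 & Hd0 & HB) Hr eps Heps.
  set (B' := Rmax B 0 + 1).
  assert (0 < B') by (unfold B'; pose proof (Rmax_r B 0); lra).
  destruct (Hr (eps / B')) as (d & Hd & H1); [apply Rdiv_lt_0_compat; auto|].
  exists (Rmin d d0); split; [apply Rmin_pos; auto|].
  intros h Hh Hn; rewrite Cnorm_mul.
  pose proof (Rmin_l d d0); pose proof (Rmin_r d d0).
  pose proof (H1 h Hh ltac:(lra)) as H5; pose proof (HB h Hh ltac:(lra)).
  assert (Cnorm (s h) <= B') by (unfold B'; pose proof (Rmax_l B 0); lra).
  apply Rle_lt_trans with (B' * Cnorm (r h)).
  - apply Rmult_le_compat_r; [apply Cnorm_ge0|auto].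
  - apply Rmult_lt_reg_l with (/ B'); [apply Rinv_0_lt_compat; auto|].
    replace (/ B' * (B' * Cnorm (r h))) with (Cnorm (r h)) by (field; lra).
    replace (/ B' * eps) with (eps / B') by (field; lra); auto.
Qed.

Lemma lim0_id : lim0 (fun h => h).
Proof. intros eps H; exists eps; auto. Qed.

Lemma lim0_scal c r : lim0 r -> lim0 (fun h => c * r h)%C.
Proof.
  apply lim0_mul_bounded with (Cnorm c); exists 1; split; [lra|]; intros; lra.
Qed.

(** Convertible with the predicate chosen from in [Cderiv], so that [epsilon_spec] applies directly
    in [Cderiv_uniq]. *)
Definition Cdiff (f : CC -> CC) (w D : CC) : Prop :=
  lim0 (fun h => (f (w + h) - f w) / h - D)%C.

Lemma Cdiff_uniq f w D D' : Cdiff f w D -> Cdiff f w D' -> D = D'.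
Proof.
  intros H1 H2.
  destruct (Req_dec (Cnorm (D - D')%C) 0) as [E|E].
  { apply Cnorm_eq0 in E; replace D with (D' + (D - D'))%C by ring; rewrite E; ring. }
  exfalso; pose proof (Cnorm_ge0 (D - D')%C).
  destruct (H1 (Cnorm (D - D')%C / 2)) as (d & Hd & H3); [lra|].
  destruct (H2 (Cnorm (D - D')%C / 2)) as (e & He & H4); [lra|].
  pose proof (Rmin_l d e); pose proof (Rmin_r d e); pose proof (Rmin_pos d e Hd He).
  set (h := RtoC (Rmin d e / 2)).
  assert (Hh : h <> C0) by (apply RtoC_neq0; lra).
  assert (Hn : Cnorm h = Rmin d e / 2) by (unfold h; rewrite Cnorm_RtoC, Rabs_right; lra).
  pose proof (H3 h Hh ltac:(lra)) as A1; pose proof (H4 h Hh ltac:(lra)) as A2.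
  pose proof (Cnorm_sub ((f (w + h) - f w) / h - D')%C ((f (w + h) - f w) / h - D)%C) as A3.
  replace (((f (w + h) - f w) / h - D') - ((f (w + h) - f w) / h - D))%C with (D - D')%C in A3 by (field; auto).
  lra.
Qed.

Lemma Cderiv_uniq f w D : Cdiff f w D -> Cderiv f w = D.
Proof.
  intros H; apply (Cdiff_uniq f w); auto.
  exact (epsilon_spec inhC (Cdiff f w) (ex_intro _ D H)).
Qed.

Lemma Cdiff_ext_loc f g w D :
  (exists d, 0 < d /\ forall h, Cnorm h < d -> f (w + h)%C = g (w + h)%C) ->
  Cdiff f w D -> Cdiff g w D.
Proof.
  intros (d & Hd & He); apply lim0_ext; exists d; split; auto.
  intros h Hh Hn; rewrite He by auto.
  assert (E : f (w + C0)%C = g (w + C0)%C) by (apply He; rewrite Cnorm_C0; auto).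
  replace (w + C0)%C with w in E by ring; rewrite E; auto.
Qed.

Lemma Cdiff_const c w : Cdiff (fun _ => c) w C0.
Proof.
  apply lim0_ext with (fun h => C0 * h)%C; [|apply lim0_scal, lim0_id].
  exists 1; split; [lra|]; intros; field; auto.
Qed.

Lemma Cdiff_id w : Cdiff (fun x => x) w C1.
Proof.
  apply lim0_ext with (fun h => C0 * h)%C; [|apply lim0_scal, lim0_id].
  exists 1; split; [lra|]; intros; field; auto.
Qed.

Lemma Cdiff_add f g w D E : Cdiff f w D -> Cdiff g w E ->
  Cdiff (fun x => f x + g x)%C w (D + E)%C.
Proof.
  intros H1 H2; eapply lim0_ext; [|exact (lim0_add _ _ H1 H2)].
  exists 1; split; [lra|]; intros; simpl; field; auto.
Qed.

Lemma Cdiff_mul f g w D E : Cdiff f w D -> Cdiff g w E ->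
  Cdiff (fun x => f x * g x)%C w (D * g w + f w * E)%C.
Proof.
  intros H1 H2.
  set (r := fun h => ((f (w + h) - f w) / h - D)%C).
  set (s := fun h => ((g (w + h) - g w) / h - E)%C).
  change (lim0 r) in H1; change (lim0 s) in H2.
  (* The quotient of the product exceeds the two linear terms by the product of both difference
     quotients times [h]; boundedness of that product makes the excess vanish. *)
  assert (Hb : exists d, 0 < d /\ forall h, h <> C0 -> Cnorm h < d ->
     Cnorm ((D + r h) * (E + s h))%C <= (Cnorm D + 1) * (Cnorm E + 1)).
  { destruct (H1 1) as (d & Hd & A1); [lra|].
    destruct (H2 1) as (e & He & A2); [lra|].
    exists (Rmin d e); split; [apply Rmin_pos; auto|].
    pose proof (Rmin_l d e); pose proof (Rmin_r d e).
    intros h Hh Hn; rewrite Cnorm_mul; apply Rmult_le_compat; try apply Cnorm_ge0.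
    - eapply Rle_trans; [apply Cnorm_add|]. pose proof (A1 h Hh ltac:(lra)); lra.
    - eapply Rle_trans; [apply Cnorm_add|]. pose proof (A2 h Hh ltac:(lra)); lra. }
  eapply lim0_ext; [|exact (lim0_add _ _ (lim0_add _ _ (lim0_scal (g w) _ H1)
    (lim0_scal (f w) _ H2)) (lim0_mul_bounded _ _ _ Hb lim0_id))].
  exists 1; split; [lra|]; intros h Hh _; unfold r, s; simpl; field; auto.
Qed.

Lemma Cdiff_inv_sub w : w <> C1 ->
  Cdiff (fun x => Cinv (C1 - x)%C) w (Cinv (C1 - w) * Cinv (C1 - w))%C.
Proof.
  intros Hw.
  assert (Hv : (C1 - w)%C <> C0).
  { intros E; apply Hw; replace w with (C1 - (C1 - w))%C by ring; rewrite E; ring. }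
  set (v := (C1 - w)%C) in *; pose proof (Cnorm_pos v Hv) as Hp.
  assert (Hs : forall h, Cnorm h < Cnorm v / 2 -> Cnorm v / 2 <= Cnorm (v - h)%C).
  { intros h Hh; pose proof (Cnorm_sub_ge v h); lra. }
  assert (Hs' : forall h, Cnorm h < Cnorm v / 2 -> (v - h)%C <> C0).
  { intros h Hh E; pose proof (Hs h Hh) as H; rewrite E, Cnorm_C0 in H; lra. }
  (* With [v = 1 - w], the difference quotient minus [1 / v^2] is exactly [h / (v^2 (v - h))]. *)
  apply lim0_ext with (fun h => (Cinv v * Cinv v * Cinv (v - h)) * h)%C.
  - exists (Cnorm v / 2); split; [lra|]; intros h Hh Hn.
    cbv beta; fold v; replace (C1 - (w + h))%C with (v - h)%C by (unfold v; ring).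
    field; repeat split; auto.
  - apply lim0_mul_bounded with (Cnorm (Cinv v * Cinv v)%C * (2 / Cnorm v)); [|apply lim0_id].
    exists (Cnorm v / 2); split; [lra|]; intros h Hh Hn.
    rewrite Cnorm_mul; apply Rmult_le_compat_l; [apply Cnorm_ge0|].
    rewrite Cnorm_inv by auto.
    replace (2 / Cnorm v) with (/ (Cnorm v / 2)) by (field; lra).
    apply Rinv_le_contravar; auto; lra.
Qed.

(* [RY] stands for [1 / (1 - w)]. *)
Inductive rexp := RX | RY | R1c | R0c | RAdd (a b : rexp) | RMul (a b : rexp).

Fixpoint reval (e : rexp) (w : CC) : CC :=
  match e with
  | RX => w
  | RY => Cinv (C1 - w)%C
  | R1c => C1
  | R0c => C0
  | RAdd a b => (reval a w + reval b w)%C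
  | RMul a b => (reval a w * reval b w)%C
  end.

Fixpoint rder (e : rexp) : rexp :=
  match e with
  | RX => R1c
  | RY => RMul RY RY
  | R1c | R0c => R0c
  | RAdd a b => RAdd (rder a) (rder b)
  | RMul a b => RAdd (RMul (rder a) b) (RMul a (rder b))
  end.

Lemma Cdiff_reval e w : w <> C1 -> Cdiff (reval e) w (reval (rder e) w).
Proof.
  intros Hw; induction e; simpl.
  - apply Cdiff_id.
  - apply Cdiff_inv_sub; auto.
  - apply Cdiff_const.
  - apply Cdiff_const.
  - apply Cdiff_add; auto.
  - apply Cdiff_mul; auto.
Qed.

Lemma cder_reval e (f : R -> CC) x a : cder f x a -> f x <> C1 ->
  cder (fun t => reval e (f t)) x (reval (rder e) (f x) * a)%C.
Proof.
  intros Hf Hx.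
  assert (Hv : (C1 - f x)%C <> C0).
  { intros E; apply Hx; replace (f x) with (C1 - (C1 - f x))%C by ring; rewrite E; ring. }
  induction e; simpl.
  - eapply cder_eq; [exact Hf|ring].
  - eapply cder_eq; [apply cder_inv; [apply cder_sub; [apply cder_const|exact Hf]|exact Hv]|]; simpl; cbv beta; ring.
  - eapply cder_eq; [apply cder_const|ring].
  - eapply cder_eq; [apply cder_const|ring].
  - eapply cder_eq; [apply cder_add; eassumption|cbv beta; ring].
  - eapply cder_eq; [apply cder_mul; eassumption|cbv beta; ring].
Qed.

(** A syntactic mirror of [Li_neg]: the iterated choice-based derivative becomes a polynomial in [w]
    and [1 / (1 - w)], with a symbolic derivative. *)
Fixpoint Li_expr (m : nat) : rexp :=
  match m with O => RMul RX RY | S m' => RMul RX (rder (Li_expr m')) end.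

Lemma Li_neg_reval m w : w <> C1 -> Li_neg m w = reval (Li_expr m) w.
Proof.
  revert w; induction m; intros w Hw; [reflexivity|]; simpl; f_equal.
  apply Cderiv_uniq.
  assert (Hv : (C1 - w)%C <> C0).
  { intros E; apply Hw; replace w with (C1 - (C1 - w))%C by ring; rewrite E; ring. }
  apply Cdiff_ext_loc with (reval (Li_expr m)); [|apply Cdiff_reval; auto].
  (* The induction hypothesis fails at 1, so it is used on the largest disc around [w] that avoids
     1. *)
  exists (Cnorm (C1 - w)%C); split; [apply Cnorm_pos; auto|].
  intros h Hh; symmetry; apply IHm; intros E.
  assert (E' : (C1 - w)%C = h) by (rewrite <- E; ring).
  rewrite E' in Hh; lra.
Qed.

(** The hypothesis is the differential equation of [om * exp (t * a)]; along such a path d/dt acts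
    as [a] times [w d/dw], which raises the order by one. *)
Lemma cder_Li_neg m (f : R -> CC) x a :
  cder f x (f x * a)%C -> f x <> C1 ->
  cder (fun t => Li_neg m (f t)) x (a * Li_neg (S m) (f x))%C.
Proof.
  intros Hf Hx.
  assert (Hl : locally x (fun t => f t <> C1)).
  { destruct (cder_continuity _ _ _ Hf) as [Hc1 Hc2].
    destruct (Req_dec (Cre (f x)) 1) as [E1|E1].
    - destruct (Req_dec (Cim (f x)) 0) as [E2|E2]; [elim Hx; apply CC_eq; auto|].
      apply (filter_imp (fun t => Cim (f t) <> 0)).
      + intros t Ht E; apply Ht; rewrite E; reflexivity.
      + apply (Hc2 (fun y => y <> 0)), (open_neq 0); auto.
    - apply (filter_imp (fun t => Cre (f t) <> 1)).
      + intros t Ht E; apply Ht; rewrite E; reflexivity.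
      + apply (Hc1 (fun y => y <> 1)), (open_neq 1); auto. }
  apply cder_ext_loc with (fun t => reval (Li_expr m) (f t)).
  { eapply filter_imp; [|exact Hl]; simpl; intros t Ht; symmetry; apply Li_neg_reval; auto. }
  rewrite Li_neg_reval by auto.
  eapply cder_eq; [apply cder_reval; eauto|]; simpl; cbv beta; ring.
Qed.

(** * Bernoulli polynomials *)

Lemma INR_fact_pos n : 0 < INR (fact n).
Proof. apply lt_0_INR, lt_O_fact. Qed.

Lemma length_bern_list n : length (bern_list n) = S n.
Proof.
  induction n; [reflexivity|].
  simpl bern_list; rewrite length_app, IHn; simpl; lia.
Qed.

Lemma nth_bern_list n j : (j <= n)%nat -> nth j (bern_list n) 0 = bernoulli j.
Proof.
  induction n; intros H.
  - replace j with 0%nat by lia; reflexivity.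
  - destruct (Nat.eq_dec j (S n)) as [->|Hj]; [reflexivity|].
    rewrite <- IHn by lia; simpl bern_list.
    apply app_nth1; rewrite length_bern_list; lia.
Qed.

Lemma C_n_n n : Binomial.C n n = 1.
Proof.
  unfold Binomial.C; rewrite Nat.sub_diag; pose proof (INR_fact_pos n); simpl; field; lra.
Qed.

Lemma C_S_n n : Binomial.C (S n) n = INR (S n).
Proof.
  unfold Binomial.C; replace (S n - n)%nat with 1%nat by lia.
  pose proof (INR_fact_pos n); rewrite fact_simpl, mult_INR; simpl (INR (fact 1)); field; lra.
Qed.

Lemma bernoulli_sum n : (1 <= n)%nat ->
  rsum (S n) (fun j => Binomial.C (S n) j * bernoulli j) = 0.
Proof.
  intros Hn; destruct n as [|n]; [lia|]; clear Hn.
  assert (E : bernoulli (S n) = - / INR (S (S n)) *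
    rsum (S n) (fun j => Binomial.C (S (S n)) j * bernoulli j)).
  { transitivity (nth (S n) (bern_list (S n)) 0); [reflexivity|].
    simpl bern_list; rewrite app_nth2; rewrite length_bern_list; [|lia].
    rewrite Nat.sub_diag; cbn [nth].
    match goal with |- _ * ?x = _ => change x with (fold_right Rplus 0
      (map (fun j => Binomial.C (S (S n)) j * nth j (bern_list n) 0) (seq 0 (S n)))) end.
    rewrite fold_map_seq_rsum; f_equal.
    apply rsum_ext; intros i Hi; simpl; rewrite nth_bern_list by lia; reflexivity. }
  change (rsum (S (S n)) (fun j => Binomial.C (S (S n)) j * bernoulli j)) with
    (rsum (S n) (fun j => Binomial.C (S (S n)) j * bernoulli j)
     + Binomial.C (S (S n)) (S n) * bernoulli (S n)).
  rewrite C_S_n, E; field; apply not_0_INR; lia.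
Qed.

Lemma bpoly_sum n x :
  bernoulli_poly n x = rsum (S n) (fun j => Binomial.C n j * bernoulli j * x ^ (n - j)).
Proof. unfold bernoulli_poly; rewrite fold_map_seq_rsum; reflexivity. Qed.

Lemma bpoly_0 x : bernoulli_poly 0 x = 1.
Proof. rewrite bpoly_sum; simpl; rewrite C_n_n; unfold bernoulli; simpl; ring. Qed.

Lemma bpoly_at_0 n : bernoulli_poly n 0 = bernoulli n.
Proof.
  rewrite bpoly_sum; simpl rsum; rewrite C_n_n, Nat.sub_diag; simpl pow.
  rewrite (rsum_ext n _ (fun _ => 0)); [rewrite rsum_const; ring|].
  intros i Hi; rewrite pow_i by lia; ring.
Qed.

Lemma bpoly_at_1 n : (2 <= n)%nat -> bernoulli_poly n 1 = bernoulli n.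
Proof.
  intros Hn; rewrite bpoly_sum; simpl rsum.
  rewrite C_n_n, pow1; destruct n as [|n]; [lia|].
  rewrite (rsum_ext (S n) _ (fun j => Binomial.C (S n) j * bernoulli j)).
  - rewrite bernoulli_sum by lia; ring.
  - intros i Hi; rewrite pow1; ring.
Qed.

Lemma C_S_mul n j : (j <= n)%nat ->
  Binomial.C (S n) j * INR (S n - j) = INR (S n) * Binomial.C n j.
Proof.
  intros H; unfold Binomial.C; replace (S n - j)%nat with (S (n - j)) by lia.
  rewrite !fact_simpl, !mult_INR.
  pose proof (INR_fact_pos j); pose proof (INR_fact_pos (n - j)).
  pose proof (lt_0_INR (S (n - j)) ltac:(lia)).
  field; lra.
Qed.

Lemma C_S_S_mul n l : (l <= n)%nat ->
  Binomial.C (S n) (S l) * INR (S l) = INR (S n) * Binomial.C n l.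
Proof.
  intros H; unfold Binomial.C; replace (S n - S l)%nat with (n - l)%nat by lia.
  rewrite !fact_simpl, !mult_INR.
  pose proof (INR_fact_pos l); pose proof (INR_fact_pos (n - l)).
  pose proof (lt_0_INR (S l) ltac:(lia)).
  field; lra.
Qed.

Lemma is_derive_powR n x : is_derive (fun t => t ^ n) x (INR n * x ^ pred n).
Proof. apply is_derive_Reals, derivable_pt_lim_pow. Qed.

Lemma is_derive_scalR c (f : R -> R) x a :
  is_derive f x a -> is_derive (fun t => c * f t) x (c * a).
Proof.
  intros H; eapply is_derive_eq; [apply is_derive_multR; [apply is_derive_constR|exact H]|].
  cbv beta; ring.
Qed.

Lemma is_derive_extR (f g : R -> R) x l :
  (forall t, f t = g t) -> is_derive f x l -> is_derive g x l.
Proof. intros E; apply is_derive_ext; auto. Qed.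

Lemma is_derive_bpoly n x : is_derive (bernoulli_poly (S n)) x (INR (S n) * bernoulli_poly n x).
Proof.
  apply is_derive_extR with
    (fun t => rsum (S (S n)) (fun j => Binomial.C (S n) j * bernoulli j * t ^ (S n - j))).
  { intros t; symmetry; apply bpoly_sum. }
  eapply is_derive_eq.
  - apply is_derive_rsum with (F' := fun j t =>
      Binomial.C (S n) j * bernoulli j * (INR (S n - j) * t ^ pred (S n - j))).
    intros i Hi; apply is_derive_scalR, is_derive_powR.
  - change (rsum (S (S n))) with (fun f => rsum (S n) f + f (S n)); cbv beta.
    rewrite Nat.sub_diag, bpoly_sum, <- rsum_scal; change (INR 0) with 0; rewrite !Rmult_0_l, Rmult_0_r, Rplus_0_r.
    apply rsum_ext; intros j Hj; cbv beta.
    replace (pred (S n - j)) with (n - j)%nat by lia.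
    transitivity (Binomial.C (S n) j * INR (S n - j) * bernoulli j * x ^ (n - j)); [ring|].
    rewrite C_S_mul by lia; ring.
Qed.

Lemma is_derive_zero_const (f : R -> R) : (forall t, is_derive f t 0) -> forall x y, f x = f y.
Proof.
  assert (G : (forall t, is_derive f t 0) -> forall x y, x <= y -> f y = f x).
  { intros H x y Hxy.
    assert (E : Rabs (f y - f x) <= (fun _ => 0) y - (fun _ => 0) x).
    { apply (derive_dominated f (fun _ => 0) (fun _ => 0) (fun _ => 0)); auto.
      - intros; apply is_derive_constR.
      - intros; rewrite Rabs_R0; lra. }
    cbv beta in E; apply Rabs_le_between in E; lra. }
  intros H x y; destruct (Rle_dec x y); [symmetry|]; apply G; auto; lra.
Qed.

(** Equivalent to B_n(x+1) - B_n(x) = n x^(n-1). By induction the two sides have the same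
    derivative, and at 0 they agree by the recursion of the Bernoulli numbers. *)
Lemma bpoly_binomial_sum i x :
  rsum (S i) (fun l => Binomial.C (S i) l * bernoulli_poly l x) = INR (S i) * x ^ i.
Proof.
  revert x; induction i; intros x.
  - simpl; rewrite bpoly_0; replace (Binomial.C 1 0) with 1 by (unfold Binomial.C; simpl; field); ring.
  - set (T := fun x => rsum (S (S i)) (fun l => Binomial.C (S (S i)) l * bernoulli_poly l x)
      - INR (S (S i)) * x ^ S i).
    assert (HT : T x = T 0).
    { apply is_derive_zero_const; intros t; unfold T.
      eapply is_derive_eq.
      - apply is_derive_minusR; [|apply is_derive_scalR, is_derive_powR].
        apply is_derive_rsum with (F' := fun l t =>
          Binomial.C (S (S i)) l * (INR l * bernoulli_poly (pred l) t)).
        intros [|l] Hl; apply is_derive_scalR.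
        + apply is_derive_extR with (fun _ => 1); [intros; symmetry; apply bpoly_0|].
          eapply is_derive_eq; [apply is_derive_constR|simpl; ring].
        + apply is_derive_bpoly.
      - rewrite rsum_shift; simpl pred.
        rewrite (rsum_ext (S i) _ (fun l => INR (S (S i)) * (Binomial.C (S i) l * bernoulli_poly l t))).
        + rewrite rsum_scal, IHi; simpl (INR 0); ring.
        + intros l Hl; rewrite <- Rmult_assoc, C_S_S_mul by lia; simpl pred; ring. }
    unfold T in HT.
    rewrite (rsum_ext (S (S i)) (fun l => _ * bernoulli_poly l 0)
      (fun l => Binomial.C (S (S i)) l * bernoulli l)), bernoulli_sum, pow_i in HT by (try lia; intros; rewrite bpoly_at_0; auto).
    lra.
Qed.

(** The defect [D n] satisfies [D (n+1)' = (n+1) D n]. If [D n] vanishes then [D (n+1)] is a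
    constant, and the next defect shows that this constant is 0. *)
Lemma bpoly_reflect n x : bernoulli_poly n (1 - x) = (-1) ^ n * bernoulli_poly n x.
Proof.
  set (D := fun n x => (-1) ^ n * bernoulli_poly n (1 - x) - bernoulli_poly n x).
  assert (HD : forall n t, is_derive (D (S n)) t (INR (S n) * D n t)).
  { intros m t; unfold D; eapply is_derive_eq.
    - apply is_derive_minusR; [|apply is_derive_bpoly].
      apply is_derive_scalR.
      apply (is_derive_compR (fun t => 1 - t)); [|apply is_derive_bpoly].
      apply is_derive_minusR; [apply is_derive_constR|apply is_derive_idR].
    - cbv beta; simpl pow; ring. }
  assert (H0 : forall n x, D n x = 0).
  { clear n x; induction n; intros x.
    - unfold D; rewrite !bpoly_0; simpl; ring.
    - assert (Hc : forall y, D (S n) y = D (S n) x).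
      { intros y; apply is_derive_zero_const; intros t.
        eapply is_derive_eq; [apply HD|]; rewrite IHn; ring. }
      set (d := D (S n) x) in *.
      (* [D (S (S n))] is affine of slope [INR (S (S n)) * d], but takes equal values at 0 and 1
         because B_m(0) = B_m(1) for m >= 2. *)
      assert (E : D (S (S n)) 1 - INR (S (S n)) * d * 1 = D (S (S n)) 0 - INR (S (S n)) * d * 0).
      { apply (is_derive_zero_const (fun y => D (S (S n)) y - INR (S (S n)) * d * y)); intros t.
        eapply is_derive_eq.
        - apply is_derive_minusR; [apply HD|apply is_derive_scalR, is_derive_idR].
        - rewrite Hc; ring. }
      unfold D in E at 1 2.
      replace (1 - 1) with 0 in E by ring; replace (1 - 0) with 1 in E by ring.
      rewrite bpoly_at_0, bpoly_at_1 in E by lia.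
      assert (INR (S (S n)) * d = 0) as E2 by lra.
      apply Rmult_integral in E2; destruct E2 as [E2|E2]; auto.
      exfalso; apply (not_0_INR (S (S n))); auto. }
  specialize (H0 n x); unfold D in H0.
  assert (E : (-1) ^ n * (-1) ^ n = 1) by (rewrite <- Rpow_mult_distr; replace (-1 * -1) with 1 by ring; apply pow1).
  replace (bernoulli_poly n x) with ((-1) ^ n * bernoulli_poly n (1 - x)) by lra.
  rewrite <- Rmult_assoc, E; ring.
Qed.

Lemma bernoulli_odd n : (1 <= n)%nat -> bernoulli (S (2 * n)) = 0.
Proof.
  intros Hn; pose proof (bpoly_reflect (S (2 * n)) 0) as H.
  rewrite Rminus_0_r, bpoly_at_0, bpoly_at_1, pow_1_odd in H by lia; lra.
Qed.

Definition bpoly_bound (n : nat) : R := rsum (S n) (fun j => Rabs (Binomial.C n j * bernoulli j)).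

Lemma bpoly_bound_ge0 n : 0 <= bpoly_bound n.
Proof. apply rsum_ge0; intros; apply Rabs_pos. Qed.

Lemma bpoly_le_bound n x : 0 <= x <= 1 -> Rabs (bernoulli_poly n x) <= bpoly_bound n.
Proof.
  intros Hx; rewrite bpoly_sum; apply Rabs_rsum_le; intros i Hi.
  rewrite Rabs_mult, (Rabs_right (x ^ _)) by (apply Rle_ge, pow_le; lra).
  rewrite <- (Rmult_1_r (Rabs (Binomial.C n i * bernoulli i))) at 2.
  apply Rmult_le_compat_l; [apply Rabs_pos|].
  rewrite <- (pow1 (n - i)); apply pow_incr; lra.
Qed.

(** * Euler-Maclaurin summation *)

(** [a l] stands for the [l]-th derivative. The derivative of the remainder is the remainder of one
    order less for the shifted family. The factorial in the bound is dropped, since only the power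
    of [h] matters. *)
Lemma taylor_bound n : forall (a : nat -> R -> R) u h K, 0 <= h ->
  (forall l t, (l <= n)%nat -> u <= t <= u + h -> is_derive (a l) t (a (S l) t)) ->
  (forall t, u <= t <= u + h -> Rabs (a (S n) t) <= K) ->
  forall y, 0 <= y <= h ->
  Rabs (a 0%nat (u + y) - rsum (S n) (fun i => a i u * (y ^ i / INR (fact i)))) <= K * h ^ S n.
Proof.
  induction n; intros a u h K Hh Ha HK y Hy.
  - assert (H : Rabs (a 0%nat (u + y) - a 0%nat u) <= (fun t => K * t) (u + y) - (fun t => K * t) u).
    { apply derive_dominated with (a 1%nat) (fun _ => K); [lra|..].
      - intros t Ht; apply Ha; [lia|lra].
      - intros t Ht; eapply is_derive_eq; [apply is_derive_scalR, is_derive_idR|ring].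
      - intros t Ht; apply HK; lra. }
    simpl in *; replace (0 + a 0%nat u * (1 / 1)) with (a 0%nat u) by field.
    assert (0 <= K) by (eapply Rle_trans; [apply Rabs_pos|apply (HK u); lra]).
    nra.
  - set (r := fun y => a 0%nat (u + y) - rsum (S (S n)) (fun i => a i u * (y ^ i / INR (fact i)))).
    set (r' := fun y => a 1%nat (u + y) - rsum (S n) (fun i => a (S i) u * (y ^ i / INR (fact i)))).
    assert (Hr : forall t, 0 <= t <= h -> is_derive r t (r' t)).
    { intros t Ht; unfold r, r'; eapply is_derive_eq.
      - apply is_derive_minusR.
        + apply (is_derive_compR (fun y => u + y)); [apply is_derive_plusR; [apply is_derive_constR|apply is_derive_idR]|].
          apply Ha; [lia|lra].
        + apply is_derive_rsum with (F' := fun i t => a i u * (/ INR (fact i) * (INR i * t ^ pred i))).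
          intros i Hi; apply is_derive_scalR.
          apply is_derive_extR with (fun t => / INR (fact i) * t ^ i); [intros; unfold Rdiv; ring|].
          apply is_derive_scalR, is_derive_powR.
      - rewrite (rsum_shift (S n)); simpl (INR 0).
        rewrite (rsum_ext (S n) _ (fun i => a (S i) u * (t ^ i / INR (fact i)))); [ring|].
        intros i Hi; rewrite fact_simpl, mult_INR; simpl pred.
        pose proof (INR_fact_pos i); pose proof (lt_0_INR (S i) ltac:(lia)); field; lra. }
    assert (Hb : forall t, 0 <= t <= h -> Rabs (r' t) <= K * h ^ S n).
    { intros t Ht; apply (IHn (fun i => a (S i)) u h K); auto.
      intros l s Hl Hs; apply Ha; [lia|auto]. }
    assert (H : Rabs (r y - r 0) <= (fun t => K * h ^ S n * t) y - (fun t => K * h ^ S n * t) 0).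
    { apply derive_dominated with r' (fun _ => K * h ^ S n); [lra|..].
      - intros t Ht; apply Hr; lra.
      - intros t Ht; eapply is_derive_eq; [apply is_derive_scalR, is_derive_idR|ring].
      - intros t Ht; apply Hb; lra. }
    assert (E : r 0 = 0).
    { unfold r; rewrite rsum_shift, (rsum_ext (S n) _ (fun _ => 0)), rsum_const.
      - simpl; rewrite Rplus_0_r; field.
      - intros i Hi; rewrite pow_i by lia; unfold Rdiv; ring. }
    rewrite E in H; fold (r y).
    replace (r y) with (r y - 0) by ring.
    eapply Rle_trans; [exact H|]; cbv beta.
    replace (K * h ^ S (S n)) with (K * h ^ S n * h) by (simpl; ring).
    assert (0 <= K * h ^ S n) by (eapply Rle_trans; [apply Rabs_pos|apply (Hb 0); lra]).
    nra.
Qed.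

(** Regroups a Cauchy product by total order [l + S i = S p], so as to read off the coefficient of
    each derivative at the base point. *)
Lemma rsum_triangle n (b c d : nat -> R) :
  rsum (S n) (fun l => b l * rsum (n - l) (fun i => c (l + S i)%nat * d (S i)))
  = rsum n (fun p => c (S p) * rsum (S p) (fun l => b l * d (S p - l)%nat)).
Proof.
  induction n; [simpl; ring|].
  change (rsum (S n) (fun p => c (S p) * rsum (S p) (fun l => b l * d (S p - l)%nat))) with
    (rsum n (fun p => c (S p) * rsum (S p) (fun l => b l * d (S p - l)%nat))
     + c (S n) * rsum (S n) (fun l => b l * d (S n - l)%nat)).
  rewrite <- IHn, <- rsum_scal, <- rsum_add.
  change (rsum (S (S n))) with (fun f => rsum (S n) f + f (S n)); cbv beta.
  rewrite Nat.sub_diag; simpl (rsum 0); rewrite Rmult_0_r, Rplus_0_r.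
  apply rsum_ext; intros l Hl.
  replace (S n - l)%nat with (S (n - l)) by lia; simpl rsum.
  replace (l + S (n - l))%nat with (S n) by lia; ring.
Qed.

(** The summand 1 pays for the Taylor error of the sampled [a 1], the sum for the errors in the
    differences [a l (u + h) - a l u]. *)
Definition em_const (n : nat) : R := 1 + rsum (S n) (fun l => bpoly_bound l / INR (fact l)).

Lemma em_const_pos n : 0 < em_const n.
Proof.
  unfold em_const; assert (0 <= rsum (S n) (fun l => bpoly_bound l / INR (fact l))); [|lra].
  apply rsum_ge0; intros i _; apply Rdiv_le_0_compat; [apply bpoly_bound_ge0|apply INR_fact_pos].
Qed.

(* Exact on polynomials by [bpoly_binomial_sum], hence small by Taylor expansion at [u]. *)
Lemma euler_maclaurin_cell n (a : nat -> R -> R) u h lam K : (1 <= n)%nat -> 0 <= h ->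
  0 <= lam <= 1 ->
  (forall l t, (l <= n)%nat -> u <= t <= u + h -> is_derive (a l) t (a (S l) t)) ->
  (forall t, u <= t <= u + h -> Rabs (a (S n) t) <= K) ->
  Rabs (h * a 1%nat (u + lam * h)
        - rsum (S n) (fun l => bernoulli_poly l lam / INR (fact l) * h ^ l * (a l (u + h) - a l u)))
  <= em_const n * K * h ^ S n.
Proof.
  intros Hn Hh Hlam Ha HK.
  assert (Ht : forall l y, (l <= n)%nat -> 0 <= y <= h ->
    Rabs (a l (u + y) - rsum (S (n - l)) (fun i => a (l + i)%nat u * (y ^ i / INR (fact i))))
      <= K * h ^ S (n - l)).
  { intros l y Hl Hy.
    pose proof (taylor_bound (n - l) (fun i => a (l + i)%nat) u h K Hh) as H.
    cbv beta in H; rewrite Nat.add_0_r in H; apply H; auto.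
    - intros j t Hj Ht'; rewrite Nat.add_succ_r; apply Ha; [lia|auto].
    - replace (l + S (n - l))%nat with (S n) by lia; auto. }
  (* [P] is the Taylor polynomial of [a 1] at the sample point, [Q l] that of the increment of [a l]
     over the cell. *)
  set (P := rsum n (fun i => a (S i) u * ((lam * h) ^ i / INR (fact i)))).
  set (Q := fun l => rsum (n - l) (fun i => a (l + S i)%nat u * (h ^ S i / INR (fact (S i))))).
  (* Exactness on Taylor polynomials: the coefficients of [a (S p) u] on both sides agree by
     [bpoly_binomial_sum] with [i = p]. *)
  assert (E : h * P = rsum (S n) (fun l => bernoulli_poly l lam / INR (fact l) * h ^ l * Q l)).
  { unfold P, Q.
    rewrite (rsum_triangle n (fun l => bernoulli_poly l lam / INR (fact l) * h ^ l) (fun l => a l u)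
      (fun i => h ^ i / INR (fact i))), <- rsum_scal.
    apply rsum_ext; intros p Hp.
    rewrite (rsum_ext (S p) _ (fun l => h ^ S p / INR (fact (S p)) * (Binomial.C (S p) l * bernoulli_poly l lam))).
    - rewrite rsum_scal, bpoly_binomial_sum, fact_simpl, mult_INR, Rpow_mult_distr; simpl pow.
      pose proof (INR_fact_pos p); pose proof (lt_0_INR (S p) ltac:(lia)); field; lra.
    - intros l Hl; unfold Binomial.C.
      replace (h ^ S p) with (h ^ l * h ^ (S p - l)) by (rewrite <- pow_add; f_equal; lia).
      pose proof (INR_fact_pos l); pose proof (INR_fact_pos (S p - l)); pose proof (INR_fact_pos (S p)).
      field; lra. }
  replace (h * a 1%nat (u + lam * h)
        - rsum (S n) (fun l => bernoulli_poly l lam / INR (fact l) * h ^ l * (a l (u + h) - a l u)))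
    with (h * (a 1%nat (u + lam * h) - P) +
      rsum (S n) (fun l => (- (bernoulli_poly l lam / INR (fact l) * h ^ l)) * (a l (u + h) - a l u - Q l))).
  2:{ rewrite (rsum_ext (S n) (fun l => - _ * _) (fun l =>
        -1 * (bernoulli_poly l lam / INR (fact l) * h ^ l * (a l (u + h) - a l u)) +
        bernoulli_poly l lam / INR (fact l) * h ^ l * Q l)) by (intros; ring).
      rewrite rsum_add, <- E, rsum_scal; ring. }
  eapply Rle_trans; [apply Rabs_triang|].
  assert (0 <= K) by (eapply Rle_trans; [apply Rabs_pos|apply (HK u); lra]).
  unfold em_const; rewrite !Rmult_plus_distr_r; apply Rplus_le_compat.
  - rewrite Rabs_mult, (Rabs_right h) by lra; rewrite Rmult_1_l.
    replace (K * h ^ S n) with (h * (K * h ^ n)) by (simpl; ring).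
    apply Rmult_le_compat_l; auto.
    pose proof (Ht 1%nat (lam * h) Hn ltac:(nra)) as H1.
    replace (S (n - 1)) with n in H1 by lia; exact H1.
  - rewrite Rmult_assoc, Rmult_comm, <- rsum_scal; apply Rabs_rsum_le; intros l Hl.
    rewrite Rabs_mult, Rabs_Ropp, Rabs_mult, (Rabs_right (h ^ l)) by (apply Rle_ge, pow_le; auto).
    assert (H1 : Rabs (a l (u + h) - a l u - Q l) <= K * h ^ S (n - l)).
    { pose proof (Ht l h ltac:(lia) ltac:(lra)) as H1.
      rewrite rsum_shift in H1; unfold Q.
      rewrite Nat.add_0_r in H1; simpl (h ^ 0) in H1; simpl (INR (fact 0)) in H1.
      match goal with |- Rabs ?x <= _ => match type of H1 with Rabs ?y <= _ =>
        replace x with y by field end end; exact H1. }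
    assert (H2 : Rabs (bernoulli_poly l lam / INR (fact l)) <= bpoly_bound l / INR (fact l)).
    { unfold Rdiv; pose proof (INR_fact_pos l).
      rewrite Rabs_mult, (Rabs_right (/ _)) by (apply Rle_ge, Rlt_le, Rinv_0_lt_compat; auto).
      apply Rmult_le_compat_r; [apply Rlt_le, Rinv_0_lt_compat; auto|].
      apply bpoly_le_bound; auto. }
    replace (K * h ^ S n) with (h ^ l * (K * h ^ S (n - l))).
    2:{ replace (S n) with (l + S (n - l))%nat by lia; rewrite pow_add; ring. }
    rewrite Rmult_assoc, Rmult_comm.
    apply Rmult_le_compat; auto.
    + apply Rmult_le_pos; [apply pow_le; auto|apply Rabs_pos].
    + apply Rabs_pos.
    + apply Rmult_le_compat_l; auto; apply pow_le; auto.
Qed.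

Lemma rsum_swap n m f :
  rsum n (fun i => rsum m (fun j => f i j)) = rsum m (fun j => rsum n (fun i => f i j)).
Proof.
  induction n; simpl.
  - rewrite rsum_const; ring.
  - rewrite IHn, <- rsum_add; auto.
Qed.

Lemma rsum_telescope n (f : nat -> R) : rsum n (fun i => f (S i) - f i) = f n - f 0%nat.
Proof. induction n; simpl; [ring|]; rewrite IHn; ring. Qed.

(** The summed function is [a 1] and [a 0] is an antiderivative of it, so the term [l = 0] is [M]
    times the integral. Adding the cells of width [1 / M] makes the boundary differences
    telescope. *)
Lemma euler_maclaurin_R n M (a : nat -> R -> R) lam K : (1 <= n)%nat -> (1 <= M)%nat ->
  0 <= lam <= 1 ->
  (forall l t, (l <= n)%nat -> 0 <= t <= 1 -> is_derive (a l) t (a (S l) t)) ->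
  (forall t, 0 <= t <= 1 -> Rabs (a (S n) t) <= K) ->
  Rabs (rsum M (fun m => a 1%nat ((INR m + lam) / INR M))
        - rsum (S n) (fun l => bernoulli_poly l lam / INR (fact l) * (INR M * (/ INR M) ^ l) * (a l 1 - a l 0)))
  <= em_const n * K * (INR M * (/ INR M) ^ n).
Proof.
  intros Hn HM Hlam Ha HK.
  assert (HM' : 0 < INR M) by (apply lt_0_INR; lia).
  set (h := / INR M); assert (Hh : 0 < h) by (apply Rinv_0_lt_compat; auto).
  assert (Hp : forall m, (m < M)%nat -> 0 <= INR m * h /\ INR m * h + h <= 1).
  { intros m Hm; split; [apply Rmult_le_pos; [apply pos_INR|lra]|].
    assert (INR m + 1 <= INR M) by (rewrite <- S_INR; apply le_INR; lia).
    replace 1 with (INR M * h) by (unfold h; field; lra); nra. }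
  assert (Hc : forall m, (m < M)%nat ->
    Rabs (a 1%nat ((INR m + lam) / INR M) - INR M * rsum (S n) (fun l => bernoulli_poly l lam / INR (fact l) * h ^ l
      * (a l (INR (S m) * h) - a l (INR m * h)))) <= INR M * (em_const n * K * h ^ S n)).
  { intros m Hm; destruct (Hp m Hm) as [H1 H2].
    pose proof (euler_maclaurin_cell n a (INR m * h) h lam K Hn ltac:(lra) Hlam) as H.
    replace (INR m * h + lam * h) with ((INR m + lam) / INR M) in H by (unfold h; field; lra).
    replace (INR m * h + h) with (INR (S m) * h) in * by (rewrite S_INR; ring).
    match goal with |- Rabs ?x <= _ => replace x with (INR M * (h * a 1%nat ((INR m + lam) / INR M)
        - rsum (S n) (fun l => bernoulli_poly l lam / INR (fact l) * h ^ l * (a l (INR (S m) * h) - a l (INR m * h)))))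
        end.
    2:{ rewrite Rmult_minus_distr_l, <- Rmult_assoc; replace (INR M * h) with 1 by (unfold h; field; lra); ring. }
    rewrite Rabs_mult, (Rabs_right (INR M)) by lra.
    apply Rmult_le_compat_l; [lra|]; apply H.
    - intros l t Hl Ht; apply Ha; auto; lra.
    - intros t Ht; apply HK; lra. }
  (* There are [M] cells, each with the error of the cell formula scaled by [M]; one of the two
     factors [M] cancels one [h]. *)
  replace (em_const n * K * (INR M * h ^ n)) with (INR M * (INR M * (em_const n * K * h ^ S n))).
  2:{ simpl pow; unfold h at 1; field; lra. }
  rewrite <- (rsum_const M).
  match goal with |- Rabs ?x <= _ => replace x with (rsum M (fun m => a 1%nat ((INR m + lam) / INR M)
     - INR M * rsum (S n) (fun l => bernoulli_poly l lam / INR (fact l) * h ^ l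
      * (a l (INR (S m) * h) - a l (INR m * h))))) end.
  { apply Rabs_rsum_le; auto. }
  rewrite (rsum_ext M _ (fun m => a 1%nat ((INR m + lam) / INR M) + (- INR M) *
    rsum (S n) (fun l => bernoulli_poly l lam / INR (fact l) * h ^ l
      * (a l (INR (S m) * h) - a l (INR m * h))))) by (intros; ring).
  rewrite rsum_add, rsum_scal, rsum_swap.
  match goal with |- ?p + - INR M * ?q = ?p - ?r =>
    cut (INR M * q = r); [intros <-; ring|] end.
  rewrite <- rsum_scal.
  apply rsum_ext; intros l Hl; rewrite rsum_scal, (rsum_telescope M (fun m => a l (INR m * h))).
  replace (INR M * h) with 1 by (unfold h; field; lra); simpl (INR 0); rewrite Rmult_0_l; ring.
Qed.

Lemma euler_maclaurin n M (A : nat -> R -> CC) lam K : (1 <= n)%nat -> (1 <= M)%nat ->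
  0 <= lam <= 1 ->
  (forall l t, (l <= n)%nat -> 0 <= t <= 1 -> cder (A l) t (A (S l) t)) ->
  (forall t, 0 <= t <= 1 -> Cnorm (A (S n) t) <= K) ->
  Cnorm (csum M (fun m => A 1%nat ((INR m + lam) / INR M)%R)
        - csum (S n) (fun l => RtoC (bernoulli_poly l lam / INR (fact l) * (INR M * (/ INR M) ^ l))%R * (A l 1 - A l 0)))%C
  <= 2 * (em_const n * K * (INR M * (/ INR M) ^ n)).
Proof.
  intros Hn HM Hlam HA HK.
  eapply Rle_trans; [apply Cnorm_le_re_im|].
  pose proof (euler_maclaurin_R n M (fun l t => Cre (A l t)) lam K Hn HM Hlam) as H1.
  pose proof (euler_maclaurin_R n M (fun l t => Cim (A l t)) lam K Hn HM Hlam) as H2.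
  match goal with |- Rabs (Cre ?x) + _ <= _ => set (X := x) end.
  replace (Cre X) with (rsum M (fun m => Cre (A 1%nat ((INR m + lam) / INR M)))
        - rsum (S n) (fun l => bernoulli_poly l lam / INR (fact l) * (INR M * (/ INR M) ^ l) * (Cre (A l 1) - Cre (A l 0)))).
  2:{ unfold X; change (Cre (?a - ?b)%C) with (Cre a - Cre b); rewrite !Cre_csum; f_equal.
      apply rsum_ext; intros; rewrite Cre_RtoC_mul; simpl; ring. }
  replace (Cim X) with (rsum M (fun m => Cim (A 1%nat ((INR m + lam) / INR M)))
        - rsum (S n) (fun l => bernoulli_poly l lam / INR (fact l) * (INR M * (/ INR M) ^ l) * (Cim (A l 1) - Cim (A l 0)))).
  2:{ unfold X; change (Cim (?a - ?b)%C) with (Cim a - Cim b); rewrite !Cim_csum; f_equal.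
      apply rsum_ext; intros; rewrite Cim_RtoC_mul; simpl; ring. }
  rewrite <- Rplus_diag; apply Rplus_le_compat; [apply H1|apply H2].
  - intros l t Hl Ht; apply (proj1 (HA l t Hl Ht)).
  - intros t Ht; eapply Rle_trans; [apply Cre_le_norm|auto].
  - intros l t Hl Ht; apply (proj2 (HA l t Hl Ht)).
  - intros t Ht; eapply Rle_trans; [apply Cim_le_norm|auto].
Qed.

(** * Stirling's series *)

Definition wallis (n : nat) : R := RInt (fun x => sin x ^ n) 0 (PI / 2).

Lemma is_RInt_wallis n : is_RInt (fun x => sin x ^ n) 0 (PI / 2) (wallis n).
Proof.
  apply (RInt_correct (V := R_CompleteNormedModule)), (ex_RInt_continuous (V := R_CompleteNormedModule)).
  intros x _; eapply is_derive_cont.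
  apply (is_derive_compR sin (fun t => t ^ n)); [apply is_derive_Reals, derivable_pt_lim_sin|apply is_derive_powR].
Qed.

Lemma wallis_0 : wallis 0 = PI / 2.
Proof.
  unfold wallis; simpl; rewrite RInt_const; unfold scal; simpl; unfold mult; simpl; ring.
Qed.

Lemma wallis_1 : wallis 1 = 1.
Proof.
  apply (is_RInt_unique (V := R_CompleteNormedModule)).
  replace 1 with (minus (- cos (PI / 2)) (- cos 0)).
  2:{ rewrite cos_PI2, cos_0; unfold minus, plus, opp; simpl; ring. }
  apply (is_RInt_derive (V := R_CompleteNormedModule) (fun x => - cos x)).
  - intros x _; eapply is_derive_eq; [apply is_derive_oppR, is_derive_Reals, derivable_pt_lim_cos|ring].
  - intros x _; eapply is_derive_cont.
    apply (is_derive_compR sin (fun t => t ^ 1)); [apply is_derive_Reals, derivable_pt_lim_sin|apply is_derive_powR].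
Qed.

(** The integrand [f] is the derivative of [- cos x * sin x ^ S n], which vanishes at both ends: the
    cosine at [PI / 2], the sine at 0. *)
Lemma wallis_rec n : INR (S (S n)) * wallis (S (S n)) = INR (S n) * wallis n.
Proof.
  set (f := fun x => INR (S (S n)) * sin x ^ S (S n) - INR (S n) * sin x ^ n).
  assert (H1 : is_RInt f 0 (PI / 2) (INR (S (S n)) * wallis (S (S n)) - INR (S n) * wallis n)).
  { apply (is_RInt_minus (V := R_NormedModule)); apply (is_RInt_scal (V := R_NormedModule)); apply is_RInt_wallis. }
  assert (H2 : is_RInt f 0 (PI / 2) (minus (- cos (PI / 2) * sin (PI / 2) ^ S n) (- cos 0 * sin 0 ^ S n))).
  { apply (is_RInt_derive (V := R_CompleteNormedModule) (fun x => - cos x * sin x ^ S n)).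
    - intros x _; unfold f; eapply is_derive_eq.
      + apply is_derive_multR; [apply is_derive_oppR, is_derive_Reals, derivable_pt_lim_cos|].
        apply (is_derive_compR sin (fun t => t ^ S n)); [apply is_derive_Reals, derivable_pt_lim_sin|apply is_derive_powR].
      + cbv beta; simpl pred.
        pose proof (sin2_cos2 x) as E; unfold Rsqr in E.
        replace (- cos x * (INR (S n) * sin x ^ n * cos x)) with
          (- INR (S n) * sin x ^ n * (cos x * cos x)) by ring.
        replace (cos x * cos x) with (1 - sin x * sin x) by lra.
        rewrite (S_INR (S n)); simpl pow; ring.
    - intros x _; unfold f; eapply is_derive_cont.
      apply is_derive_minusR; apply is_derive_scalR;
      (apply (is_derive_compR sin (fun t => t ^ _)); [apply is_derive_Reals, derivable_pt_lim_sin|apply is_derive_powR]). }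
  apply (is_RInt_unique (V := R_CompleteNormedModule)) in H1.
  apply (is_RInt_unique (V := R_CompleteNormedModule)) in H2.
  rewrite H1 in H2; rewrite cos_PI2, sin_0, pow_i in H2 by lia.
  unfold minus, plus, opp in H2; simpl in H2; simpl; lra.
Qed.

Lemma wallis_decr n : wallis (S n) <= wallis n.
Proof.
  pose proof PI_RGT_0.
  apply is_RInt_le with (f := fun x => sin x ^ S n) (g := fun x => sin x ^ n) (a := 0) (b := PI / 2);
    try apply is_RInt_wallis; [lra|].
  intros x Hx; pose proof (sin_ge_0 x ltac:(lra) ltac:(lra)); pose proof (SIN_bound x).
  simpl; rewrite <- (Rmult_1_l (sin x ^ n)) at 2.
  apply Rmult_le_compat_r; [apply pow_le; auto|lra].
Qed.

(** The value 4^m / binom(2m, m) of Wallis's product of the ratios 2i / (2i - 1) for i up to m. *)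
Definition wallis_prod (m : nat) : R := 4 ^ m * INR (fact m) ^ 2 / INR (fact (2 * m)).

Lemma wallis_prod_pos m : 0 < wallis_prod m.
Proof.
  unfold wallis_prod; pose proof (INR_fact_pos m); pose proof (INR_fact_pos (2 * m)).
  apply Rdiv_lt_0_compat; auto; apply Rmult_lt_0_compat; apply pow_lt; lra.
Qed.

Lemma wallis_prod_S m :
  wallis_prod (S m) = wallis_prod m * (2 * INR m + 2) / (2 * INR m + 1).
Proof.
  unfold wallis_prod; replace (2 * S m)%nat with (S (S (2 * m))) by lia.
  rewrite !fact_simpl, !mult_INR, !S_INR, mult_INR; simpl (INR 2).
  pose proof (INR_fact_pos m); pose proof (INR_fact_pos (2 * m)); pose proof (pos_INR m).
  simpl pow; field; lra.
Qed.

Lemma wallis_values m :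
  wallis (2 * m) = PI / (2 * wallis_prod m) /\
  wallis (S (2 * m)) = wallis_prod m / (2 * INR m + 1).
Proof.
  induction m as [|m [IH1 IH2]].
  - change (2 * 0)%nat with 0%nat; rewrite wallis_0, wallis_1; unfold wallis_prod; simpl; split; field.
  - pose proof (wallis_rec (2 * m)) as R1; pose proof (wallis_rec (S (2 * m))) as R2.
    replace (2 * S m)%nat with (S (S (2 * m))) by lia.
    rewrite IH1 in R1; rewrite IH2 in R2.
    rewrite !S_INR, mult_INR in R1; rewrite !S_INR, mult_INR in R2; change (INR 2) with 2 in R1, R2.
    pose proof (pos_INR m); pose proof (wallis_prod_pos m).
    rewrite wallis_prod_S, S_INR; split.
    + apply Rmult_eq_reg_l with (2 * INR m + 1 + 1); [|lra].
      rewrite R1; field; lra.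
    + apply Rmult_eq_reg_l with (2 * INR m + 1 + 1 + 1); [|lra].
      rewrite R2; field; lra.
Qed.

(** Monotonicity W(2m+1) <= W(2m) <= W(2m-1) of the integrals: the left inequality gives the upper
    bound, the right one the lower bound. *)
Lemma wallis_bounds m : (1 <= m)%nat ->
  PI <= wallis_prod m ^ 2 / INR m <= PI * (1 + / (2 * INR m)).
Proof.
  intros Hm; destruct m as [|m]; [lia|].
  pose proof (wallis_prod_pos m) as Hq; pose proof (wallis_prod_pos (S m)) as Hp.
  pose proof (pos_INR m) as H0.
  pose proof (wallis_decr (2 * S m)) as H1; pose proof (wallis_decr (S (2 * m))) as H2.
  replace (S (S (2 * m))) with (2 * S m)%nat in H2 by lia.
  rewrite (proj1 (wallis_values (S m))), (proj2 (wallis_values (S m))) in H1.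
  rewrite (proj1 (wallis_values (S m))), (proj2 (wallis_values m)) in H2.
  rewrite wallis_prod_S in *; rewrite S_INR in *.
  set (p := wallis_prod m) in *; set (x := INR m) in *.
  set (P := p * (2 * x + 2) / (2 * x + 1)) in *.
  assert (E : p = P * (2 * x + 1) / (2 * x + 2)) by (unfold P; field; lra).
  split.
  - apply Rmult_le_reg_r with (/ (2 * P)); [apply Rinv_0_lt_compat; lra|].
    replace (PI * / (2 * P)) with (PI / (2 * P)) by reflexivity.
    eapply Rle_trans; [exact H2|right; rewrite E at 1; field; lra].
  - apply Rmult_le_reg_r with ((x + 1) / (P * (2 * (x + 1) + 1))).
    { apply Rdiv_lt_0_compat; [lra|apply Rmult_lt_0_compat; lra]. }
    replace (P ^ 2 / (x + 1) * ((x + 1) / (P * (2 * (x + 1) + 1)))) with (P / (2 * (x + 1) + 1)) by (field; lra).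
    eapply Rle_trans; [exact H1|right; field; lra].
Qed.

Lemma ln_wallis_lim : is_lim_seq (fun m => ln (wallis_prod (S m) ^ 2 / INR (S m))) (ln PI).
Proof.
  pose proof PI_RGT_0 as Hpi.
  apply is_lim_seq_le_le with (fun _ => ln PI) (fun m => ln PI + / (2 * INR (S m))).
  - intros m; destruct (wallis_bounds (S m) ltac:(lia)) as [H1 H2].
    pose proof (lt_0_INR (S m) ltac:(lia)) as Hm.
    assert (H3 : 0 < / (2 * INR (S m))) by (apply Rinv_0_lt_compat; lra).
    split.
    + apply ln_le; auto.
    + apply Rle_trans with (ln (PI * (1 + / (2 * INR (S m))))).
      * apply ln_le; lra.
      * rewrite ln_mult by lra; apply Rplus_le_compat_l.
        rewrite <- (ln_exp (/ (2 * INR (S m)))) at 2; apply ln_le; [lra|].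
        apply exp_ineq1_le.
  - apply is_lim_seq_const.
  - replace (Finite (ln PI)) with (Finite (ln PI + 0)) by (f_equal; ring).
    apply is_lim_seq_plus'; [apply is_lim_seq_const|].
    apply is_lim_seq_ext with (fun m => / 2 * / INR (S m)).
    + intros m; pose proof (lt_0_INR (S m) ltac:(lia)); field; lra.
    + replace (Finite 0) with (Finite (/ 2 * 0)) by (f_equal; ring).
      apply is_lim_seq_scal_l with (a := / 2) (lu := Finite 0).
      apply (is_lim_seq_inv _ p_infty); [|discriminate].
      apply -> (is_lim_seq_incr_1 INR); apply is_lim_seq_INR.
Qed.

(** The logarithm sits at index 1, preceded by its antiderivative and followed by its derivatives:
    the indexing expected by the Euler-Maclaurin lemmas. *)
Definition stirling_term (l : nat) (x : R) : R :=
  match l with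
  | O => x * ln x - x
  | S O => ln x
  | S (S p) => (-1) ^ p * INR (fact p) * (/ x) ^ S p
  end.

Lemma is_derive_stirling_term l x : 0 < x ->
  is_derive (stirling_term l) x (stirling_term (S l) x).
Proof.
  intros Hx; destruct l as [|[|p]]; unfold stirling_term.
  - eapply is_derive_eq.
    + apply is_derive_minusR; [apply is_derive_multR; [apply is_derive_idR|]|apply is_derive_idR].
      apply is_derive_Reals, derivable_pt_lim_ln; auto.
    + cbv beta; field; lra.
  - eapply is_derive_eq; [apply is_derive_Reals, derivable_pt_lim_ln; auto|].
    simpl; field; lra.
  - eapply is_derive_eq.
    + apply is_derive_scalR.
      apply (is_derive_compR (fun x => / x) (fun t => t ^ S p)); [|apply is_derive_powR].
      apply is_derive_extR with (fun x => 1 / x); [intros; unfold Rdiv; ring|].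
      apply is_derive_divR; [apply is_derive_constR|apply is_derive_idR|lra].
    + rewrite fact_simpl, mult_INR; unfold Rsqr; simpl pred; simpl pow; field; lra.
Qed.

(** The sequences [s - b] and [s + b] are monotone in opposite directions and squeeze a common
    limit, so [b] also gives the rate of convergence. *)
Lemma summable_increments_lim (s b : nat -> R) :
  (forall m, Rabs (s (S m) - s m) <= b m - b (S m)) -> is_lim_seq b 0 ->
  exists l : R, is_lim_seq s l /\ forall m, Rabs (s m - l) <= b m.
Proof.
  intros H Hb.
  assert (Hd : forall m, b (S m) <= b m).
  { intros m; pose proof (H m); pose proof (Rabs_pos (s (S m) - s m)); lra. }
  assert (Hb0 : forall m, 0 <= b m).
  { intros m; apply (is_lim_seq_decr_compare b 0); auto. }
  set (u := fun m => s m - b m); set (v := fun m => s m + b m).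
  assert (Hu : forall m, u m <= u (S m)).
  { intros m; pose proof (H m) as E; apply Rabs_le_between in E; unfold u; lra. }
  assert (Hv : forall m, v (S m) <= v m).
  { intros m; pose proof (H m) as E; apply Rabs_le_between in E; unfold v; lra. }
  assert (Hv0 : forall m, v m <= v 0%nat).
  { induction m; [lra|]; eapply Rle_trans; [apply Hv|auto]. }
  destruct (ex_finite_lim_seq_incr u (v 0%nat)) as [l Hl]; auto.
  { intros m; unfold u; pose proof (Hv0 m); unfold v in *; pose proof (Hb0 m); lra. }
  assert (Hs : is_lim_seq s l).
  { apply is_lim_seq_ext with (fun m => u m + b m); [intros; unfold u; ring|].
    replace (Finite l) with (Finite (l + 0)) by (f_equal; ring).
    apply is_lim_seq_plus'; auto. }
  assert (Hvl : is_lim_seq v l).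
  { replace (Finite l) with (Finite (l + 0)) by (f_equal; ring).
    apply is_lim_seq_plus'; auto. }
  exists l; split; auto; intros m.
  pose proof (is_lim_seq_incr_compare u l Hl Hu m) as H1.
  pose proof (is_lim_seq_decr_compare v l Hvl Hv m) as H2.
  unfold u, v in *; apply Rabs_le; lra.
Qed.

Lemma is_lim_seq_inv_pow L : (1 <= L)%nat -> is_lim_seq (fun m => (/ INR (S m)) ^ L) 0.
Proof.
  intros HL.
  assert (H1 : is_lim_seq (fun m => / INR (S m)) 0).
  { apply (is_lim_seq_inv _ p_infty); [|discriminate].
    apply -> (is_lim_seq_incr_1 INR); apply is_lim_seq_INR. }
  destruct L as [|L]; [lia|]; clear HL; induction L.
  - apply is_lim_seq_ext with (fun m => / INR (S m)); [intros; simpl; ring|auto].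
  - change (fun m => (/ INR (S m)) ^ S (S L)) with (fun m => / INR (S m) * (/ INR (S m)) ^ S L).
    replace (Finite 0) with (Finite (0 * 0)) by (f_equal; ring).
    apply is_lim_seq_mult'; auto.
Qed.

(** Makes errors of order [x ^ -(L+2)] telescope. With [a = 1/x] and [b = 1/(x+1)] one has
    [a - b = a * b], and [a <= 2 * b] since [x >= 1]. *)
Lemma inv_pow_increment L x : 0 < x -> 1 <= x ->
  (/ x) ^ S (S L) <= 2 * ((/ x) ^ S L - (/ (x + 1)) ^ S L).
Proof.
  intros Hx H1.
  set (a := / x); set (b := / (x + 1)).
  assert (Ha : 0 < a) by (apply Rinv_0_lt_compat; lra).
  assert (Hb : 0 < b) by (apply Rinv_0_lt_compat; lra).
  assert (Hab : a - b = a * b) by (unfold a, b; field; lra).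
  assert (H2 : a <= 2 * b).
  { unfold a, b; apply Rmult_le_reg_r with (x * (x + 1)); [nra|].
    replace (/ x * (x * (x + 1))) with (x + 1) by (field; lra).
    replace (2 * / (x + 1) * (x * (x + 1))) with (2 * x) by (field; lra). lra. }
  assert (H3 : b ^ L <= a ^ L) by (apply pow_incr; nra).
  assert (0 < a ^ L) by (apply pow_lt; auto).
  simpl pow.
  assert (b * b ^ L <= b * a ^ L) by (apply Rmult_le_compat_l; lra).
  assert (a * a ^ L - b * a ^ L = a * b * a ^ L) by (rewrite <- Hab; ring).
  assert (0 < a * a ^ L) by nra.
  nra.
Qed.

(** Built so that its increment from [x] to [x + 1] is the Euler-Maclaurin approximation, with
    [lam = 1], of [ln (x + 1)], the increment of the logarithm of the factorial. *)
Definition stirling_sum (n : nat) (x : R) : R :=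
  rsum (S n) (fun l => bernoulli_poly l 1 / INR (fact l) * stirling_term l x).

Lemma bpoly_1_1 : bernoulli_poly 1 1 = 1 / 2.
Proof.
  rewrite bpoly_sum; unfold Binomial.C, bernoulli; simpl; unfold Binomial.C; simpl; field.
Qed.

Lemma stirling_tail_lim n :
  is_lim_seq (fun m => rsum n (fun l => bernoulli_poly (S (S l)) 1 / INR (fact (S (S l))) * stirling_term (S (S l)) (INR (S m)))) 0.
Proof.
  induction n; simpl rsum; [apply is_lim_seq_const|].
  replace (Finite 0) with (Finite (0 + bernoulli_poly (S (S n)) 1 / INR (fact (S (S n))) * ((-1) ^ n * INR (fact n) * 0))) by (f_equal; ring).
  apply is_lim_seq_plus'; auto.
  apply is_lim_seq_scal_l with (lu := Finite ((-1) ^ n * INR (fact n) * 0)).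
  apply is_lim_seq_scal_l with (lu := Finite 0); apply (is_lim_seq_inv_pow (S n)); lia.
Qed.

(** In 2 v(m) - v(2m) the terms of order m and m ln m cancel, and what remains is half the logarithm
    of Wallis's quotient plus half of ln 2; its limit is 2c - c. *)
Lemma stirling_const (v : nat -> R) (c : R) :
  (forall m, v m = ln (INR (fact (S m))) - (INR (S m) * ln (INR (S m)) - INR (S m)) - 1 / 2 * ln (INR (S m))) ->
  is_lim_seq v c -> c = 1 / 2 * ln (2 * PI).
Proof.
  intros Ev Hv.
  (* Since [v m] concerns the factorial of [S m], doubling [S m] is the index [S (2 * m)]. *)
  assert (H2 : is_lim_seq (fun m => v (S (2 * m))) c).
  { apply (is_lim_seq_subseq v c (fun m => S (2 * m))); auto.
    apply eventually_subseq; intros; lia. }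
  assert (H3 : is_lim_seq (fun m => 2 * v m - v (S (2 * m))) (2 * c - c)).
  { apply is_lim_seq_minus'; auto; apply is_lim_seq_scal_l with (lu := Finite c); auto. }
  assert (H4 : is_lim_seq (fun m => 2 * v m - v (S (2 * m))) (1 / 2 * ln PI + 1 / 2 * ln 2)).
  { apply is_lim_seq_ext with (fun m => 1 / 2 * ln (wallis_prod (S m) ^ 2 / INR (S m)) + 1 / 2 * ln 2).
    - intros m; rewrite !Ev; unfold wallis_prod.
      replace (S (S (2 * m))) with (2 * S m)%nat by lia.
      pose proof (lt_0_INR (S m) ltac:(lia)) as Hm.
      pose proof (INR_fact_pos (S m)) as Hf; pose proof (INR_fact_pos (2 * S m)) as Hf2.
      assert (0 < 4 ^ S m) by (apply pow_lt; lra).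
      assert (0 < INR (fact (S m)) ^ 2) by (apply pow_lt; lra).
      assert (0 < 4 ^ S m * INR (fact (S m)) ^ 2) by (apply Rmult_lt_0_compat; auto).
      assert (0 < 4 ^ S m * INR (fact (S m)) ^ 2 / INR (fact (2 * S m))) by (apply Rdiv_lt_0_compat; auto).
      rewrite ln_div, ln_pow, ln_div, ln_mult, !ln_pow by (auto; try lra; apply pow_lt; auto).
      rewrite mult_INR, (ln_mult (INR 2)) by (simpl; lra || auto).
      replace 4 with (2 * 2) by ring; rewrite (ln_mult 2 2) by lra; change (INR 2) with 2; field.
    - replace (Finite (1 / 2 * ln PI + 1 / 2 * ln 2)) with (Rbar_plus (1 / 2 * ln PI) (1 / 2 * ln 2)) by reflexivity.
      apply is_lim_seq_plus'; [|apply is_lim_seq_const].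
      apply is_lim_seq_scal_l with (lu := Finite (ln PI)), ln_wallis_lim. }
  apply is_lim_seq_unique in H3; apply is_lim_seq_unique in H4.
  rewrite H3 in H4; injection H4 as E.
  rewrite ln_mult by (pose proof PI_RGT_0; lra); lra.
Qed.

Lemma stirling_series L : (1 <= L)%nat -> exists K, 0 <= K /\ forall M, (1 <= M)%nat ->
  Rabs (ln (INR (fact M)) - (1 / 2 * ln (2 * PI) + stirling_sum (S L) (INR M))) <= K * (/ INR M) ^ L.
Proof.
  intros HL; destruct L as [|L]; [lia|]; clear HL.
  set (n := S (S L)).
  (* The factor 2 comes from [inv_pow_increment]; the factorial is the coefficient in the derivative
     of order [S n] in [stirling_term]. *)
  set (D := 2 * (em_const n * INR (fact (S L)))).
  assert (HD : 0 < D).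
  { unfold D; pose proof (em_const_pos n); pose proof (INR_fact_pos (S L)); nra. }
  set (s := fun m => ln (INR (fact (S m))) - stirling_sum n (INR (S m))).
  set (b := fun m => D * (/ INR (S m)) ^ S L).
  destruct (summable_increments_lim s b) as [c [Hc Hb]].
  - intros m.
    pose proof (lt_0_INR (S m) ltac:(lia)) as Hm.
    assert (H1 : 1 <= INR (S m)) by (apply (le_INR 1); lia).
    (* Each increment of [s] is exactly the error of one Euler-Maclaurin cell of length 1. *)
    assert (Hs : s (S m) - s m = 1 * stirling_term 1 (INR (S m) + 1 * 1) -
       rsum (S n) (fun l => bernoulli_poly l 1 / INR (fact l) * 1 ^ l * (stirling_term l (INR (S m) + 1) - stirling_term l (INR (S m))))).
    { unfold s, stirling_sum.
      rewrite (rsum_ext (S n) (fun l => _ * 1 ^ l * _) (fun l => bernoulli_poly l 1 / INR (fact l) * stirling_term l (INR (S (S m)))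
        + (-1) * (bernoulli_poly l 1 / INR (fact l) * stirling_term l (INR (S m))))).
      2:{ intros l Hl; rewrite pow1, (S_INR (S m)); ring. }
      rewrite rsum_add, rsum_scal, (fact_simpl (S m)), mult_INR, ln_mult; [|apply lt_0_INR; lia|apply INR_fact_pos].
      replace (1 * stirling_term 1 (INR (S m) + 1 * 1)) with (ln (INR (S (S m)))).
      2:{ rewrite (S_INR (S m)), !Rmult_1_l; reflexivity. }
      ring. }
    rewrite Hs.
    eapply Rle_trans.
    + apply (euler_maclaurin_cell n stirling_term (INR (S m)) 1 1 (INR (fact (S L)) * (/ INR (S m)) ^ n));
        [unfold n; lia|lra|lra|..].
      * intros l t _ Ht; apply is_derive_stirling_term; lra.
      * intros t Ht; unfold n; unfold stirling_term.
        rewrite !Rabs_mult, pow_1_abs, Rmult_1_l.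
        rewrite (Rabs_right (INR _)) by (apply Rle_ge, pos_INR).
        apply Rmult_le_compat_l; [apply pos_INR|].
        assert (0 < / t) by (apply Rinv_0_lt_compat; lra).
        rewrite Rabs_right by (apply Rle_ge, pow_le; lra).
        apply pow_incr; split; [lra|]; apply Rinv_le_contravar; lra.
    + unfold b; rewrite pow1, (S_INR (S m)).
      pose proof (inv_pow_increment L (INR (S m)) Hm H1) as H2.
      replace (em_const n * (INR (fact (S L)) * (/ INR (S m)) ^ n) * 1) with (D / 2 * (/ INR (S m)) ^ n) by (unfold D; field).
      fold n in H2; nra.
  - replace (Finite 0) with (Finite (D * 0)) by (f_equal; ring).
    apply is_lim_seq_scal_l with (lu := Finite 0), is_lim_seq_inv_pow; lia.
  - exists D; split; [lra|]; intros M HM; destruct M as [|m]; [lia|].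
    replace (1 / 2 * ln (2 * PI)) with c.
    + pose proof (Hb m) as H; unfold s, b in H.
      match goal with |- Rabs ?x <= _ => match type of H with Rabs ?y <= _ => replace x with y by ring end end.
      exact H.
    (* Adding back the corrections that tend to 0 turns [s] into the sequence of [stirling_const]
       without changing its limit. *)
    + set (tail := fun m => rsum (S L) (fun l => bernoulli_poly (S (S l)) 1 / INR (fact (S (S l))) * stirling_term (S (S l)) (INR (S m)))).
      apply stirling_const with (fun m => s m + tail m).
      * intros i; unfold s, tail, stirling_sum, n.
        rewrite (rsum_shift (S (S L))), (rsum_shift (S L)), bpoly_0, bpoly_1_1.
        generalize (ln (INR (fact (S i)))) (INR (S i)); intros F x.
        change (INR (fact 0)) with 1; change (INR (fact 1)) with 1.
        unfold stirling_term at 1 2; field.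
      * replace (Finite c) with (Finite (c + 0)) by (f_equal; ring).
        apply is_lim_seq_plus'; auto; apply stirling_tail_lim.
Qed.

(** * Families with uniformly bounded derivatives *)

(* The derivatives exist on all of [R], but the bounds are only required on [0, 1]. *)
Fixpoint ubd {P : Type} (dom : P -> Prop) (n : nat) (f : P -> R -> CC) : Prop :=
  (exists K, forall p t, dom p -> 0 <= t <= 1 -> Cnorm (f p t) <= K) /\
  match n with
  | O => True
  | S m => exists f', (forall p t, dom p -> cder (f p) t (f' p t)) /\ ubd dom m f'
  end.

Lemma ubd_bound {P} dom n (f : P -> R -> CC) : ubd dom n f ->
  exists K, forall p t, dom p -> 0 <= t <= 1 -> Cnorm (f p t) <= K.
Proof. destruct n; intros [H _]; exact H. Qed.

Lemma ubd_weaken {P} (dom : P -> Prop) n f : ubd dom (S n) f -> ubd dom n f.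
Proof.
  revert f; induction n; intros f [Hb [f' [Hd Hf']]]; split; auto.
  exists f'; split; auto.
Qed.

Lemma ubd_const {P} (dom : P -> Prop) n (c : P -> CC) :
  (exists K, forall p, dom p -> Cnorm (c p) <= K) -> ubd dom n (fun p _ => c p).
Proof.
  revert c; induction n; intros c [K HK]; (split; [exists K; auto|]); auto.
  exists (fun _ _ => C0); split; [intros; apply cder_const|].
  apply IHn; exists 0; intros; rewrite Cnorm_C0; lra.
Qed.

Lemma ubd_add {P} (dom : P -> Prop) n f g : ubd dom n f -> ubd dom n g ->
  ubd dom n (fun p t => f p t + g p t)%C.
Proof.
  revert f g; induction n; intros f g [[K HK] Hf] [[K' HK'] Hg];
    (split; [exists (K + K'); intros; eapply Rle_trans; [apply Cnorm_add|apply Rplus_le_compat; auto]|]); auto.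
  destruct Hf as [f' [Hf Hf']]; destruct Hg as [g' [Hg Hg']].
  exists (fun p t => f' p t + g' p t)%C; split; auto.
  intros; apply cder_add; auto.
Qed.

Lemma ubd_mul {P} (dom : P -> Prop) n f g : ubd dom n f -> ubd dom n g ->
  ubd dom n (fun p t => f p t * g p t)%C.
Proof.
  revert f g; induction n; intros f g Hf Hg;
    destruct (ubd_bound _ _ _ Hf) as [K HK]; destruct (ubd_bound _ _ _ Hg) as [K' HK'];
    (split; [exists (K * K'); intros; rewrite Cnorm_mul; apply Rmult_le_compat; auto; apply Cnorm_ge0|]); auto.
  pose proof (ubd_weaken _ _ _ Hf); pose proof (ubd_weaken _ _ _ Hg).
  destruct Hf as [_ [f' [Hf Hf']]]; destruct Hg as [_ [g' [Hg Hg']]].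
  exists (fun p t => f' p t * g p t + f p t * g' p t)%C; split.
  - intros; apply cder_mul; auto.
  - apply ubd_add; apply IHn; auto.
Qed.

Lemma ubd_scal {P} (dom : P -> Prop) n c f : ubd dom n f -> ubd dom n (fun p t => c * f p t)%C.
Proof.
  intros H; apply ubd_mul; auto; apply ubd_const with (c := fun _ => c).
  exists (Cnorm c); intros; lra.
Qed.

(** The derivative of [1 / f] is [- f'] times the square of [1 / f], which is under control at one
    order less. Nonvanishing is needed on all of [R] for the derivatives to exist there, the lower
    bound only on [0, 1]. *)
Lemma ubd_inv {P} (dom : P -> Prop) n f c : 0 < c -> ubd dom n f ->
  (forall p t, dom p -> f p t <> C0) ->
  (forall p t, dom p -> 0 <= t <= 1 -> c <= Cnorm (f p t)) ->
  ubd dom n (fun p t => Cinv (f p t)).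
Proof.
  intros Hc Hf Hz Hl.
  assert (Hb : exists K, forall p t, dom p -> 0 <= t <= 1 -> Cnorm (Cinv (f p t)) <= K).
  { exists (/ c); intros; rewrite Cnorm_inv by auto; apply Rinv_le_contravar; auto. }
  induction n; split; auto.
  pose proof (ubd_weaken _ _ _ Hf) as Hw; specialize (IHn Hw).
  destruct Hf as [_ [f' [Hd Hf']]].
  exists (fun p t => (- C1) * (f' p t * (Cinv (f p t) * Cinv (f p t))))%C; split.
  - intros p t Hp; eapply cder_eq; [apply cder_inv; auto|]; cbv beta; ring.
  - apply ubd_scal, ubd_mul; auto; apply ubd_mul; auto.
Qed.

(** Unfolds the nested existentials of [ubd] into one indexed sequence of derivatives with a common
    bound, as [euler_maclaurin] requires. *)
Lemma ubd_derivatives {P} (dom : P -> Prop) n f : ubd dom n f ->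
  exists (F : nat -> P -> R -> CC) K, F 0%nat = f /\
    (forall l p t, (l < n)%nat -> dom p -> cder (F l p) t (F (S l) p t)) /\
    (forall l p t, (l <= n)%nat -> dom p -> 0 <= t <= 1 -> Cnorm (F l p t) <= K).
Proof.
  revert f; induction n; intros f Hf; destruct (ubd_bound _ _ _ Hf) as [K HK].
  - exists (fun _ => f), K; split; [auto|split]; [intros; lia|auto].
  - destruct Hf as [_ [f' [Hd Hf']]].
    destruct (IHn f' Hf') as (F & K' & E & HF & HFK).
    exists (fun l => match l with O => f | S m => F m end), (Rmax K K'); split; [auto|split].
    + intros [|l] p t Hl Hp; [rewrite E; auto|apply HF; auto; lia].
    + intros [|l] p t Hl Hp Ht.
      * eapply Rle_trans; [apply HK; auto|apply Rmax_l].
      * eapply Rle_trans; [apply HFK; auto; lia|apply Rmax_r].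
Qed.

(* [A 1] is a smooth extension to [R] of the principal [- Clog (V p t)], [0 <= t <= 1]. *)
Lemma log_primitive {P} (dom : P -> Prop) n (V V' : P -> R -> CC) c : 0 < c ->
  ubd dom n V -> ubd dom n V' ->
  (forall p t, dom p -> cder (V p) t (V' p t)) ->
  (forall p t, dom p -> V p t <> C0) ->
  (forall p t, dom p -> 0 <= t <= 1 -> c <= Cnorm (V p t)) ->
  (forall p t, dom p -> 0 <= t <= 1 -> 0 < Cre (V p t)) ->
  (1 <= n)%nat ->
  exists (A : nat -> P -> R -> CC) K,
    (forall p, dom p -> A 0%nat p 0 = C0) /\
    (forall p t, dom p -> 0 <= t <= 1 -> A 1%nat p t = (- Clog (V p t))%C) /\
    (forall p t, dom p -> A 2%nat p t = (- (V' p t / V p t))%C) /\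
    (forall l p t, (l <= S n)%nat -> dom p -> cder (A l p) t (A (S l) p t)) /\
    (forall l p t, (l <= n)%nat -> dom p -> 0 <= t <= 1 -> Cnorm (A (S (S l)) p t) <= K).
Proof.
  intros Hc HV HV' Hd Hz Hl Hre Hn.
  assert (HU : ubd dom n (fun p t => (- C1) * (V' p t * Cinv (V p t)))%C).
  { apply ubd_scal, ubd_mul; auto; apply ubd_inv with c; auto. }
  destruct (ubd_derivatives _ _ _ HU) as (F & K & E & HF & HK).
  (* Integrating the logarithmic derivative defines a logarithm on all of [R], also where [V] may
     leave the half-plane; on [0, 1] it agrees with [- Clog] because derivatives and initial values
     do. *)
  set (Lam := fun p t => (- Clog (V p 0) + cint (F 0%nat p) t)%C).
  assert (HLam : forall p t, dom p -> cder (Lam p) t (F 0%nat p t)).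
  { intros p t Hp; unfold Lam; eapply cder_eq.
    - apply cder_add; [apply cder_const|apply cder_cint].
      intros s; exists (F 1%nat p s); apply HF; auto.
    - ring. }
  exists (fun l => match l with O => fun p => cint (Lam p) | S O => Lam | S (S m) => F m end), K.
  split; [|split; [|split; [|split]]].
  - intros; apply cint_0.
  - intros p t Hp Ht.
    assert (H : (Lam p t + Clog (V p t))%C = (Lam p 0 + Clog (V p 0))%C).
    { apply (cder_zero_const (fun t => Lam p t + Clog (V p t))%C); [lra|].
      intros s Hs; eapply cder_eq.
      - apply cder_add; [apply HLam; auto|apply cder_Clog; [apply Hd; auto|apply Hre; auto; lra]].
      - rewrite E; field; auto. }
    unfold Lam at 2 in H; rewrite cint_0 in H.
    replace (Lam p t) with ((Lam p t + Clog (V p t)) - Clog (V p t))%C by ring.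
    rewrite H; ring.
  - intros p t Hp; rewrite E; field; auto.
  - intros [|[|l]] p t Hl' Hp.
    + apply cder_cint; intros s; exists (F 0%nat p s); auto.
    + apply HLam; auto.
    + apply HF; auto; lia.
  - intros; apply HK; auto.
Qed.

(** * Integrals depending on a parameter *)

(** Joint continuity, under which a parameter integral may be differentiated under the integral
    sign. *)
Definition ccont2 (F : R -> R -> CC) : Prop := forall t x,
  continuity_2d_pt (fun t x => Cre (F t x)) t x /\ continuity_2d_pt (fun t x => Cim (F t x)) t x.

Lemma ccont2_mul F G : ccont2 F -> ccont2 G -> ccont2 (fun t x => F t x * G t x)%C.
Proof.
  intros HF HG t x; destruct (HF t x), (HG t x); split; simpl.
  - apply continuity_2d_pt_minus; apply continuity_2d_pt_mult; auto.
  - apply continuity_2d_pt_plus; apply continuity_2d_pt_mult; auto.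
Qed.

Lemma ccont2_const c : ccont2 (fun _ _ => c).
Proof. intros t x; split; simpl; apply continuity_2d_pt_const. Qed.

Lemma ccont2_RtoC f : (forall t x, continuity_2d_pt f t x) -> ccont2 (fun t x => RtoC (f t x)).
Proof. intros H t x; split; simpl; [apply H|apply continuity_2d_pt_const]. Qed.

Lemma ccont2_Cexp F : ccont2 F -> ccont2 (fun t x => Cexp (F t x)).
Proof.
  intros HF t x; destruct (HF t x) as [H1 H2]; split; simpl;
    apply continuity_2d_pt_mult.
  - apply (continuity_1d_2d_pt_comp exp); auto.
    apply derivable_continuous_pt, derivable_pt_exp.
  - apply (continuity_1d_2d_pt_comp cos); auto; apply continuity_cos.
  - apply (continuity_1d_2d_pt_comp exp); auto.
    apply derivable_continuous_pt, derivable_pt_exp.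
  - apply (continuity_1d_2d_pt_comp sin); auto; apply continuity_sin.
Qed.

Lemma is_derive_RInt_unit (f f2 : R -> R -> R) t :
  (forall t x, is_derive (fun u => f u x) t (f2 t x)) ->
  (forall t x, continuity_2d_pt f2 t x) ->
  (forall t x, continuous (f t) x) ->
  is_derive (fun t => RInt (f t) 0 1) t (RInt (f2 t) 0 1).
Proof.
  intros Hd Hc Hx.
  replace (RInt (f2 t) 0 1) with (RInt (fun x => Derive (fun u => f u x) t) 0 1).
  2:{ apply RInt_ext; intros x _; apply is_derive_unique; auto. }
  apply (is_derive_RInt_param f 0 1 t).
  - apply filter_forall; intros y x _; exists (f2 y x); auto.
  - intros x _; apply continuity_2d_pt_ext with f2; auto.
    intros; symmetry; apply is_derive_unique; auto.
  - apply filter_forall; intros y.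
    apply (ex_RInt_continuous (V := R_CompleteNormedModule)); auto.
Qed.

Lemma cder_cint_param (F F2 : R -> R -> CC) t :
  (forall t x, cder (fun u => F u x) t (F2 t x)) -> ccont2 F2 ->
  (forall t x, exists l, cder (F t) x l) ->
  cder (fun t => cint (F t) 1) t (cint (F2 t) 1).
Proof.
  intros Hd Hc Hx; split; simpl.
  - apply (is_derive_RInt_unit (fun t x => Cre (F t x)) (fun t x => Cre (F2 t x))).
    + intros; apply Hd.
    + intros; apply Hc.
    + intros s x; destruct (Hx s x) as [l Hl]; apply (cder_continuity _ _ _ Hl).
  - apply (is_derive_RInt_unit (fun t x => Cim (F t x)) (fun t x => Cim (F2 t x))).
    + intros; apply Hd.
    + intros; apply Hc.
    + intros s x; destruct (Hx s x) as [l Hl]; apply (cder_continuity _ _ _ Hl).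
Qed.

Lemma cint_FTC F f x : 0 <= x -> (forall t, cder F t (f t)) -> (forall t, exists l, cder f t l) ->
  cint f x = (F x - F 0)%C.
Proof.
  intros Hx HF Hf.
  assert (H : (cint f x - F x)%C = (cint f 0 - F 0)%C).
  { apply (cder_zero_const (fun x => cint f x - F x)%C); auto.
    intros t _; eapply cder_eq; [apply cder_sub; [apply cder_cint; auto|apply HF]|ring]. }
  rewrite cint_0 in H; replace (cint f x) with ((cint f x - F x) + F x)%C by ring.
  rewrite H; ring.
Qed.

Lemma cint_bound f x K : 0 <= x -> (forall t, exists l, cder f t l) ->
  (forall t, 0 <= t <= x -> Cnorm (f t) <= K) -> Cnorm (cint f x) <= 2 * (K * x).
Proof.
  intros Hx Hf HK.
  pose proof (cder_dominated (cint f) f (fun t => K * t) (fun _ => K) 0 x Hx) as H.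
  rewrite cint_0 in H; replace (cint f x - C0)%C with (cint f x) in H by ring.
  rewrite Rmult_0_r, Rminus_0_r in H; apply H; auto.
  - intros t _; apply cder_cint; auto.
  - intros t _; eapply is_derive_eq; [apply is_derive_scalR, is_derive_idR|ring].
Qed.

Lemma cint_scal c f x : 0 <= x -> (forall t, exists l, cder f t l) ->
  cint (fun t => c * f t)%C x = (c * cint f x)%C.
Proof.
  intros Hx Hf; rewrite (cint_FTC (fun x => c * cint f x)%C (fun t => c * f t)%C); auto.
  - rewrite cint_0; ring.
  - intros t; apply cder_scal, cder_cint; auto.
  - intros t; destruct (Hf t) as [l Hl]; exists (c * l)%C; apply cder_scal; auto.
Qed.

(** * The quotient of [exp (t z) - 1] by [t z] as an integral smooth in [t] *)

Lemma cder_Cexp_scal z t : cder (fun t => Cexp (RtoC t * z)%C) t (Cexp (RtoC t * z) * z)%C.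
Proof.
  apply cder_Cexp; eapply cder_eq; [apply cder_mul; [apply cder_id|apply cder_const]|]; cbv beta; ring.
Qed.

(* [phi 0 z t = (exp (t z) - 1) / (t z)], in a form that is smooth at [t = 0]. *)
Definition phi (n : nat) (z : CC) (t : R) : CC :=
  cint (fun x => RtoC (x ^ n) * Cexp (RtoC x * (RtoC t * z)))%C 1.

Lemma phi_integrand_cder n z t x :
  exists l, cder (fun x => RtoC (x ^ n) * Cexp (RtoC x * (RtoC t * z)))%C x l.
Proof.
  eexists; apply cder_mul; [apply cder_RtoC, is_derive_powR|apply cder_Cexp_scal].
Qed.

(** Differentiating under the integral brings down [x * z], so the family [phi] is closed under
    differentiation and never divides by [t]. *)
Lemma cder_phi n z t : cder (phi n z) t (z * phi (S n) z t)%C.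
Proof.
  unfold phi; rewrite <- cint_scal; [|lra|intros; apply phi_integrand_cder].
  apply (cder_cint_param (fun t x => RtoC (x ^ n) * Cexp (RtoC x * (RtoC t * z)))%C
    (fun t x => z * (RtoC (x ^ S n) * Cexp (RtoC x * (RtoC t * z))))%C).
  - intros s x; eapply cder_eq.
    + apply cder_scal, cder_Cexp, cder_scal, cder_mul; [apply cder_id|apply cder_const].
    + simpl pow; rewrite RtoC_mul; ring.
  - apply ccont2_mul; [apply ccont2_const|apply ccont2_mul].
    + apply (ccont2_RtoC (fun _ x => x ^ S n)); intros s x.
      apply (continuity_1d_2d_pt_comp (fun x => x ^ S n) (fun _ x => x)); [|apply continuity_2d_pt_id2].
      apply derivable_continuous_pt, derivable_pt_pow.
    + apply ccont2_Cexp, ccont2_mul; [apply (ccont2_RtoC (fun _ x => x)); intros; apply continuity_2d_pt_id2|].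
      apply ccont2_mul; [|apply ccont2_const].
      apply (ccont2_RtoC (fun t _ => t)); intros; apply continuity_2d_pt_id1.
  - intros; apply phi_integrand_cder.
Qed.

Lemma phi_0 z t : (RtoC t * z * phi 0 z t)%C = (Cexp (RtoC t * z) - C1)%C.
Proof.
  unfold phi; rewrite <- cint_scal; [|lra|intros; apply phi_integrand_cder].
  rewrite (cint_FTC (fun x => Cexp (RtoC x * (RtoC t * z)))%C).
  - f_equal; [f_equal; change (RtoC 1) with C1; ring|].
    change (RtoC 0) with C0; rewrite <- Cexp_0; do 2 f_equal; ring.
  - lra.
  - intros x; eapply cder_eq; [apply cder_Cexp_scal|].
    simpl pow; change (RtoC 1) with C1; ring.
  - intros x; destruct (phi_integrand_cder 0 z t x) as [l Hl].
    eexists; apply cder_scal; exact Hl.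
Qed.

Lemma phi_at_0 n z : phi n z 0 = RtoC (/ INR (S n)).
Proof.
  unfold phi; rewrite (cint_FTC (fun x => RtoC (/ INR (S n) * x ^ S n))).
  - rewrite pow_i, pow1, Rmult_0_r, Rmult_1_r by lia; change (RtoC 0) with C0; ring.
  - lra.
  - intros x; eapply cder_eq; [apply cder_RtoC, is_derive_scalR, is_derive_powR|].
    replace (RtoC x * (RtoC 0 * z))%C with C0 by (change (RtoC 0) with C0; ring).
    rewrite Cexp_0; simpl pred.
    replace (/ INR (S n) * (INR (S n) * x ^ n)) with (x ^ n); [ring|].
    field; apply not_0_INR; lia.
  - intros x; apply phi_integrand_cder.
Qed.

Lemma Cnorm_exp_le1 t z : 0 <= t -> Cre z <= 0 -> Cnorm (Cexp (RtoC t * z)%C) <= 1.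
Proof.
  intros Ht Hz; rewrite Cnorm_exp, Cre_RtoC_mul, <- exp_0.
  destruct (Req_dec (t * Cre z) 0) as [E|E]; [rewrite E; lra|].
  left; apply exp_increasing; nra.
Qed.

Lemma phi_bound n z t : 0 <= t -> Cre z <= 0 -> Cnorm (phi n z t) <= 2.
Proof.
  intros Ht Hz; unfold phi; replace 2 with (2 * (1 * 1)) by ring.
  apply cint_bound; [lra|intros; apply phi_integrand_cder|].
  intros x Hx; rewrite Cnorm_mul, Cnorm_RtoC.
  replace (RtoC x * (RtoC t * z))%C with (RtoC (x * t) * z)%C by (rewrite RtoC_mul; ring).
  rewrite <- (Rmult_1_r 1); apply Rmult_le_compat; try apply Cnorm_ge0; try apply Rabs_pos.
  - rewrite Rabs_right by (apply Rle_ge, pow_le; lra).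
    rewrite <- (pow1 n); apply pow_incr; lra.
  - apply Cnorm_exp_le1; auto; nra.
Qed.

(** * The dilogarithm *)

Definition Ccv (u : nat -> CC) (l : CC) : Prop := is_lim_seq (fun m => Cnorm (u m - l)%C) 0.

Lemma is_lim_seq_squeeze0 (u v : nat -> R) :
  (forall m, 0 <= u m <= v m) -> is_lim_seq v 0 -> is_lim_seq u 0.
Proof.
  intros H Hv; apply is_lim_seq_le_le with (fun _ => 0) v; auto; apply is_lim_seq_const.
Qed.

Lemma Ccv_add u v a b : Ccv u a -> Ccv v b -> Ccv (fun m => u m + v m)%C (a + b)%C.
Proof.
  intros Hu Hv.
  apply is_lim_seq_squeeze0 with (fun m => Cnorm (u m - a)%C + Cnorm (v m - b)%C).
  - intros m; split; [apply Cnorm_ge0|].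
    replace (u m + v m - (a + b))%C with ((u m - a) + (v m - b))%C by ring; apply Cnorm_add.
  - replace (Finite 0) with (Finite (0 + 0)) by (f_equal; ring); apply is_lim_seq_plus'; auto.
Qed.

Lemma Ccv_scal c u a : Ccv u a -> Ccv (fun m => c * u m)%C (c * a)%C.
Proof.
  intros Hu; apply is_lim_seq_ext with (fun m => Cnorm c * Cnorm (u m - a)%C).
  - intros m; rewrite <- Cnorm_mul; f_equal; ring.
  - replace (Finite 0) with (Finite (Cnorm c * 0)) by (f_equal; ring).
    apply is_lim_seq_scal_l with (lu := Finite 0); exact Hu.
Qed.

Lemma Ccv_const c : Ccv (fun _ => c) c.
Proof.
  apply is_lim_seq_ext with (fun _ => 0); [|apply is_lim_seq_const].
  intros m; replace (c - c)%C with C0 by ring; symmetry; apply Cnorm_C0.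
Qed.

Lemma Ccv_ext u v l : (forall m, u m = v m) -> Ccv u l -> Ccv v l.
Proof. intros E; apply is_lim_seq_ext; intros; rewrite E; auto. Qed.

Lemma Ccv_uniq u a b : Ccv u a -> Ccv u b -> a = b.
Proof.
  intros Ha Hb.
  assert (H : is_lim_seq (fun _ => Cnorm (a - b)%C) 0).
  { apply is_lim_seq_squeeze0 with (fun m => Cnorm (u m - b)%C + Cnorm (u m - a)%C).
    - intros m; split; [apply Cnorm_ge0|].
      replace (a - b)%C with ((u m - b) - (u m - a))%C by ring; apply Cnorm_sub.
    - replace (Finite 0) with (Finite (0 + 0)) by (f_equal; ring); apply is_lim_seq_plus'; auto. }
  apply is_lim_seq_unique in H; rewrite Lim_seq_const in H; injection H as H.
  apply Cnorm_eq0 in H; replace a with ((a - b) + b)%C by ring; rewrite H; ring.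
Qed.

Lemma Ccv_csum n (u : nat -> nat -> CC) l : (forall i, Ccv (u i) (l i)) ->
  Ccv (fun m => csum n (fun i => u i m)) (csum n l).
Proof. intros H; induction n; simpl; [apply Ccv_const|apply Ccv_add; auto]. Qed.

Lemma Ccv_Re_Im u a : is_lim_seq (fun m => Cre (u m)) (Cre a) ->
  is_lim_seq (fun m => Cim (u m)) (Cim a) -> Ccv u a.
Proof.
  intros H1 H2.
  apply is_lim_seq_squeeze0 with (fun m => Rabs (Cre (u m) - Cre a) + Rabs (Cim (u m) - Cim a)).
  - intros m; split; [apply Cnorm_ge0|apply Cnorm_le_re_im].
  - replace (Finite 0) with (Finite (Rabs (Cre a - Cre a) + Rabs (Cim a - Cim a))).
    2:{ f_equal; rewrite !Rminus_diag, Rabs_R0; ring. }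
    apply is_lim_seq_plus'.
    + apply (is_lim_seq_abs _ (Finite (Cre a - Cre a))), is_lim_seq_minus'; auto; apply is_lim_seq_const.
    + apply (is_lim_seq_abs _ (Finite (Cim a - Cim a))), is_lim_seq_minus'; auto; apply is_lim_seq_const.
Qed.

Lemma Li2_partial_csum w m :
  Li2_partial w m = csum m (fun i => (w ^ S i / RtoC (INR (S i) ^ 2)%R)%C).
Proof. apply Csum_range_csum. Qed.

Lemma lim_seq_spec u (l : R) : is_lim_seq u l -> is_lim_seq u (lim_seq u).
Proof.
  intros H; apply is_lim_seq_Reals.
  exact (epsilon_spec inhR (fun l => Un_cv u l) (ex_intro _ l (proj1 (is_lim_seq_Reals u l) H))).
Qed.

Lemma is_lim_seq_const_div c : is_lim_seq (fun m => c / INR (S m)) 0.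
Proof.
  replace (Finite 0) with (Finite (c * 0)) by (f_equal; ring).
  apply is_lim_seq_scal_l with (lu := Finite 0).
  apply (is_lim_seq_inv _ p_infty); [|discriminate].
  apply -> (is_lim_seq_incr_1 INR); apply is_lim_seq_INR.
Qed.

(** The increments are bounded by the telescoping 2/(m+1) - 2/(m+2) on the whole closed disc, as
    needed for the values at roots of unity. Convergence is what gives the chosen limits in [Li2]
    their meaning. *)
Lemma Li2_cv w : Cnorm w <= 1 -> Ccv (Li2_partial w) (Li2 w).
Proof.
  intros Hw.
  assert (Hi : forall m, Cnorm (Li2_partial w (S m) - Li2_partial w m)%C <= 2 / INR (S m) - 2 / INR (S (S m))).
  { intros m; rewrite !Li2_partial_csum; cbn [csum].
    match goal with |- Cnorm (?a + ?b - ?a)%C <= _ => replace (a + b - a)%C with b by ring end.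
    pose proof (lt_0_INR (S m) ltac:(lia)) as Hm.
    unfold Cdiv; rewrite Cnorm_mul, <- RtoC_inv, Cnorm_RtoC, (S_INR (S m)).
    set (x := INR (S m)) in *.
    assert (Hx : 1 <= x) by (apply (le_INR 1); lia).
    rewrite Cnorm_pow.
    assert (H1 : Cnorm w ^ S m <= 1) by (rewrite <- (pow1 (S m)); apply pow_incr; pose proof (Cnorm_ge0 w); lra).
    assert (H0 : 0 < / x ^ 2) by (apply Rinv_0_lt_compat, pow_lt; auto).
    rewrite Rabs_right by lra.
    apply Rle_trans with (1 * / x ^ 2); [apply Rmult_le_compat_r; lra|].
    replace (2 / x - 2 / (x + 1)) with (2 * x / (x + 1) * / x ^ 2) by (field; lra).
    apply Rmult_le_compat_r; [lra|].
    apply Rmult_le_reg_r with (x + 1); [lra|]; unfold Rdiv; rewrite Rmult_assoc, Rinv_l; lra. }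
  apply Ccv_Re_Im; simpl.
  - destruct (summable_increments_lim (fun m => Cre (Li2_partial w m)) (fun m => 2 / INR (S m))) as [l [Hl _]].
    + intros m; eapply Rle_trans; [|apply Hi].
      apply (Cre_le_norm (Li2_partial w (S m) - Li2_partial w m)%C).
    + apply is_lim_seq_const_div.
    + apply (lim_seq_spec _ l); auto.
  - destruct (summable_increments_lim (fun m => Cim (Li2_partial w m)) (fun m => 2 / INR (S m))) as [l [Hl _]].
    + intros m; eapply Rle_trans; [|apply Hi].
      apply (Cim_le_norm (Li2_partial w (S m) - Li2_partial w m)%C).
    + apply is_lim_seq_const_div.
    + apply (lim_seq_spec _ l); auto.
Qed.

Lemma cder_pow f x a n : cder f x a ->
  cder (fun t => f t ^ S n)%C x (RtoC (INR (S n)) * f x ^ n * a)%C.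
Proof.
  intros Hf; induction n.
  - apply cder_ext with f; [intros; simpl; ring|]; eapply cder_eq; [exact Hf|].
    simpl; change (RtoC 1) with C1; ring.
  - change (fun t => f t ^ S (S n))%C with (fun t => f t * f t ^ S n)%C.
    eapply cder_eq; [apply cder_mul; [exact Hf|exact IHn]|].
    rewrite (S_INR (S n)), RtoC_add; change (RtoC 1) with C1; cbn [Cpow]; ring.
Qed.

Lemma geometric_sum w m : ((C1 - w) * csum m (Cpow w))%C = (C1 - w ^ m)%C.
Proof.
  induction m; simpl; [ring|].
  transitivity ((C1 - w) * csum m (Cpow w) + (C1 - w) * w ^ m)%C; [ring|].
  rewrite IHm; ring.
Qed.

Lemma geometric_sum_div w m : (C1 - w)%C <> C0 ->
  csum m (Cpow w) = (Cinv (C1 - w) * (C1 - w ^ m))%C.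
Proof. intros H; rewrite <- geometric_sum; field; auto. Qed.

Lemma Cre_1_sub_pos w : Cnorm w < 1 -> 0 < Cre (C1 - w)%C.
Proof.
  intros H; pose proof (Cre_le_norm w) as H1; apply Rabs_le_between in H1; simpl; lra.
Qed.

Lemma INR_S_neq0 n : RtoC (INR (S n)) <> C0.
Proof. apply RtoC_neq0, not_0_INR; lia. Qed.

(** Along [s * w] the difference between [- Clog] and the partial sum has derivative
    [w (s w)^m / (1 - s w)], the geometric remainder, which is bounded over [0, 1]. *)
Lemma Clog_series w : Cnorm w < 1 ->
  Ccv (fun m => csum m (fun i => w ^ S i / RtoC (INR (S i)))%C) (- Clog (C1 - w))%C.
Proof.
  intros Hw; pose proof (Cnorm_ge0 w) as Hw0.
  assert (Hs : forall s, 0 <= s <= 1 -> Cnorm (RtoC s * w)%C <= Cnorm w).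
  { intros s Hs; rewrite Cnorm_mul, Cnorm_RtoC, Rabs_right by lra; nra. }
  apply is_lim_seq_squeeze0 with (fun m => 2 * / (1 - Cnorm w) * Cnorm w * Cnorm w ^ m).
  2:{ replace (Finite 0) with (Finite (2 * / (1 - Cnorm w) * Cnorm w * 0)) by (f_equal; ring).
      apply is_lim_seq_scal_l with (lu := Finite 0), is_lim_seq_geom.
      rewrite Rabs_right; lra. }
  intros m; split; [apply Cnorm_ge0|].
  set (f := fun s => (- Clog (C1 - RtoC s * w) - csum m (fun i => (RtoC s * w) ^ S i / RtoC (INR (S i))))%C).
  assert (Hd : forall s, 0 <= s <= 1 -> cder f s (w * (RtoC s * w) ^ m * Cinv (C1 - RtoC s * w))%C).
  { intros s Hs'; pose proof (Hs s Hs').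
    assert (Hp : 0 < Cre (C1 - RtoC s * w)%C) by (apply Cre_1_sub_pos; lra).
    assert (Hl : cder (fun s => RtoC s * w)%C s w).
    { eapply cder_eq; [apply cder_mul; [apply cder_id|apply cder_const]|]; cbv beta; ring. }
    unfold f; eapply cder_eq.
    - apply cder_sub.
      + apply cder_opp, (cder_Clog (fun s => C1 - RtoC s * w)%C); [|exact Hp].
        apply cder_sub; [apply cder_const|exact Hl].
      + apply (cder_csum m (fun i s => (RtoC s * w) ^ S i / RtoC (INR (S i)))%C (fun i s => w * (RtoC s * w) ^ i)%C).
        intros i _; apply cder_ext with (fun s => Cinv (RtoC (INR (S i))) * (RtoC s * w) ^ S i)%C.
        { intros; unfold Cdiv; ring. }
        eapply cder_eq; [apply cder_scal, cder_pow; exact Hl|].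
        cbv beta; field; apply INR_S_neq0.
    - rewrite csum_scal.
      pose proof (Cre_pos_neq0 _ Hp) as Hne.
      rewrite (geometric_sum_div (RtoC s * w)%C m Hne); field; auto. }
  pose proof (cder_dominated f _ (fun t => (/ (1 - Cnorm w) * Cnorm w * Cnorm w ^ m) * t)
    (fun _ => / (1 - Cnorm w) * Cnorm w * Cnorm w ^ m) 0 1 Rle_0_1 Hd) as H.
  assert (E0 : f 0 = C0).
  { unfold f; change (RtoC 0) with C0.
    replace (C1 - C0 * w)%C with C1 by ring; rewrite Clog_C1.
    rewrite (csum_ext m _ (fun _ => C0)).
    - rewrite csum_const; ring.
    - intros i _; simpl; unfold Cdiv; ring. }
  rewrite E0 in H.
  replace (Cnorm _) with (Cnorm (f 1 - C0)%C).
  2:{ rewrite <- Cnorm_opp; f_equal; unfold f; change (RtoC 1) with C1.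
      replace (C1 * w)%C with w by ring; ring. }
  eapply Rle_trans; [apply H|right; ring].
  - intros t _; eapply is_derive_eq; [apply is_derive_scalR, is_derive_idR|ring].
  - intros t Ht; pose proof (Hs t Ht) as H1.
    assert (Hp : 0 < Cre (C1 - RtoC t * w)%C) by (apply Cre_1_sub_pos; lra).
    rewrite !Cnorm_mul, Cnorm_inv, Cnorm_pow by (apply Cre_pos_neq0; auto).
    assert (H2 : 1 - Cnorm w <= Cnorm (C1 - RtoC t * w)%C).
    { pose proof (Cnorm_sub_ge C1 (RtoC t * w)%C); rewrite Cnorm_C1 in *; lra. }
    replace (/ (1 - Cnorm w) * Cnorm w * Cnorm w ^ m) with (Cnorm w * Cnorm w ^ m * / (1 - Cnorm w)) by ring.
    pose proof (pow_le (Cnorm w) m Hw0); pose proof (pow_le (Cnorm (RtoC t * w)%C) m (Cnorm_ge0 _)).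
    apply Rmult_le_compat.
    + apply Rmult_le_pos; auto.
    + apply Rlt_le, Rinv_0_lt_compat; lra.
    + apply Rmult_le_compat_l; auto; apply pow_incr; split; auto; apply Cnorm_ge0.
    + apply Rinv_le_contravar; lra.
Qed.

(** From [exp (a t) >= 1 + a t]. It controls [t / (1 - w)] down to [t = 0], where the modulus of [w]
    tends to 1. *)
Lemma exp_ratio_bound a t : 0 < a -> 0 < t <= 1 -> t / (1 - exp (- (a * t))) <= (1 + a) / a.
Proof.
  intros Ha Ht; assert (Hat : 0 < a * t) by (apply Rmult_lt_0_compat; lra).
  pose proof (exp_ineq1 (a * t) ltac:(lra)) as He.
  assert (He' : exp (- (a * t)) <= / (1 + a * t)).
  { rewrite exp_Ropp; apply Rinv_le_contravar; lra. }
  assert (H1 : a * t / (1 + a * t) <= 1 - exp (- (a * t))).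
  { replace (a * t / (1 + a * t)) with (1 - / (1 + a * t)) by (field; lra); lra. }
  assert (H0 : 0 < a * t / (1 + a * t)) by (apply Rdiv_lt_0_compat; lra).
  apply Rle_trans with (t / (a * t / (1 + a * t))).
  - apply Rmult_le_compat_l; [lra|]; apply Rinv_le_contravar; lra.
  - replace (t / (a * t / (1 + a * t))) with ((1 + a * t) / a) by (field; lra).
    apply Rmult_le_compat_r; [apply Rlt_le, Rinv_0_lt_compat; auto|nra].
Qed.

Lemma Cnorm_exp_path om z t : Cnorm om = 1 ->
  Cnorm (om * Cexp (RtoC t * z))%C = exp (t * Cre z).
Proof. intros H; rewrite Cnorm_mul, H, Cnorm_exp, Cre_RtoC_mul; ring. Qed.

Lemma cder_exp_path om z t :
  cder (fun t => om * Cexp (RtoC t * z))%C t (om * Cexp (RtoC t * z) * z)%C.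
Proof. eapply cder_eq; [apply cder_scal, cder_Cexp_scal|ring]. Qed.

(* The combination [J] below is smooth up to [t = 0] even when [om = 1]: the logarithmic
   singularities of [Clog (1 - om e^(tz))] (encoded by [kap]) cancel in it. *)
Lemma Li2_primitive om z (kap : R) (A0 A1 A2 : R -> CC) :
  Cnorm om = 1 -> Cre z < 0 -> (kap = 0 \/ kap = 1) -> A0 0 = C0 ->
  (forall t, 0 <= t <= 1 -> cder A0 t (A1 t)) ->
  (forall t, 0 <= t <= 1 -> cder A1 t (A2 t)) ->
  (forall t, 0 < t <= 1 -> A2 t =
     (z * (om * Cexp (RtoC t * z)) / (C1 - om * Cexp (RtoC t * z)) + RtoC (kap / t)%R)%C) ->
  A1 1 = (- Clog (C1 - om * Cexp z))%C ->
  (z * A0 1 + RtoC kap * z)%C = (Li2 (om * Cexp z) - Li2 om)%C.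
Proof.
  intros Hom Hz Hkap HA0 H01 H12 HA2 HA1.
  set (w := fun t => (om * Cexp (RtoC t * z))%C).
  set (S1 := fun m t => csum m (fun i => w t ^ S i / RtoC (INR (S i)))%C).
  set (S2 := fun m t => csum m (fun i => w t ^ S i / RtoC (INR (S i) ^ 2)%R)%C).
  (* The last two terms make the logarithms cancel after differentiation: for [t > 0] the derivative
     of [J m] is [- z^2 t w^(m+1) / (1 - w)]. *)
  set (J := fun m t => (z * A0 t + RtoC kap * z * RtoC t - S2 m t - z * RtoC t * A1 t + z * RtoC t * S1 m t)%C).
  set (a := - Cre z).
  assert (Ha : 0 < a) by (unfold a; lra).
  assert (Hw : forall t, cder w t (w t * z)%C) by (intros; apply cder_exp_path).
  assert (HS1 : forall m t, cder (S1 m) t (z * csum m (fun i => w t ^ S i))%C).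
  { intros m t; unfold S1; eapply cder_eq.
    - apply (cder_csum m (fun i t => w t ^ S i / RtoC (INR (S i)))%C (fun i t => z * w t ^ S i)%C).
      intros i _; apply cder_ext with (fun s => Cinv (RtoC (INR (S i))) * w s ^ S i)%C.
      { intros; unfold Cdiv; ring. }
      eapply cder_eq; [apply cder_scal, cder_pow; apply Hw|].
      cbn [Cpow]; field; apply INR_S_neq0.
    - apply csum_scal. }
  assert (HS2 : forall m t, cder (S2 m) t (z * S1 m t)%C).
  { intros m t; unfold S1, S2; rewrite <- csum_scal.
    apply (cder_csum m (fun i t => w t ^ S i / RtoC (INR (S i) ^ 2)%R)%C (fun i t => z * (w t ^ S i / RtoC (INR (S i))))%C).
    intros i _; apply cder_ext with (fun s => Cinv (RtoC (INR (S i) ^ 2)) * w s ^ S i)%C.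
    { intros; unfold Cdiv; ring. }
    eapply cder_eq; [apply cder_scal, cder_pow; apply Hw|].
    cbn [Cpow]; rewrite RtoC_pow; cbn [Cpow]; field; apply INR_S_neq0. }
  assert (HJ : forall m t, 0 <= t <= 1 -> cder (J m) t
    (RtoC kap * z - z * RtoC t * A2 t + z * RtoC t * (z * csum m (fun i => w t ^ S i)))%C).
  { intros m t Ht; unfold J; eapply cder_eq.
    - apply cder_add; [apply cder_sub; [apply cder_sub; [apply cder_add|]|]|].
      + apply cder_scal, H01; auto.
      + apply cder_scal, cder_id.
      + apply HS2.
      + apply cder_mul; [apply cder_scal, cder_id|apply H12; auto].
      + apply cder_mul; [apply cder_scal, cder_id|apply HS1].
    - cbv beta; ring. }
  assert (Hza : a <= Cnorm z).
  { pose proof (Cre_le_norm z) as H; apply Rabs_le_between in H; unfold a; lra. }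
  set (c := Cnorm z * Cnorm z * ((1 + a) / a)).
  assert (Hc : Cnorm z <= c).
  { unfold c; apply Rle_trans with (Cnorm z * a * ((1 + a) / a)).
    - replace (Cnorm z * a * ((1 + a) / a)) with (Cnorm z * (1 + a)) by (field; lra); nra.
    - apply Rmult_le_compat_r; [apply Rdiv_le_0_compat; lra|nra]. }
  assert (Hbound : forall m t, 0 <= t <= 1 -> Cnorm
    (RtoC kap * z - z * RtoC t * A2 t + z * RtoC t * (z * csum m (fun i => w t ^ S i)))%C
     <= c * exp (- (a * INR (S m)) * t)).
  { intros m t Ht; destruct (Req_dec t 0) as [->|Ht0].
    - change (RtoC 0) with C0.
      rewrite Rmult_0_r, exp_0, Rmult_1_r.
      replace (_ + _)%C with (RtoC kap * z)%C by ring.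
      rewrite Cnorm_mul, Cnorm_RtoC.
      destruct Hkap as [-> | ->]; rewrite ?Rabs_R0, ?Rabs_R1; pose proof (Cnorm_ge0 z); lra.
    - rewrite HA2 by lra; fold (w t).
      assert (Hn : Cnorm (w t) = exp (- (a * t))).
      { unfold w; rewrite Cnorm_exp_path by auto; f_equal; unfold a; ring. }
      assert (Hlt : exp (- (a * t)) < 1).
      { rewrite <- exp_0; apply exp_increasing; nra. }
      assert (Hp : 1 - exp (- (a * t)) <= Cnorm (C1 - w t)%C).
      { pose proof (Cnorm_sub_ge C1 (w t)); rewrite Cnorm_C1, Hn in *; lra. }
      assert (Hne : (C1 - w t)%C <> C0).
      { intros E; rewrite E, Cnorm_C0 in Hp; lra. }
      assert (Ht' : RtoC t <> C0) by (apply RtoC_neq0; auto).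
      replace (_ + _)%C with (- (z * z * (RtoC t * Cinv (C1 - w t)) * w t ^ S m))%C.
      2:{ rewrite (csum_ext m (fun i => w t ^ S i)%C (fun i => w t * w t ^ i)%C) by auto.
          rewrite csum_scal, RtoC_div.
          rewrite (geometric_sum_div (w t) m Hne); cbn [Cpow]; field; auto. }
      rewrite Cnorm_opp, !Cnorm_mul, Cnorm_inv, Cnorm_RtoC, Cnorm_pow, Rabs_right by (auto; lra).
      replace (exp (- (a * INR (S m)) * t)) with (Cnorm (w t) ^ S m).
      2:{ rewrite Hn, <- Rpower_pow by apply exp_pos; unfold Rpower; rewrite ln_exp; f_equal; ring. }
      apply Rmult_le_compat_r; [apply pow_le, Cnorm_ge0|].
      unfold c; apply Rmult_le_compat_l; [apply Rmult_le_pos; apply Cnorm_ge0|].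
      apply Rle_trans with (t / (1 - exp (- (a * t)))); [|apply exp_ratio_bound; lra].
      apply Rmult_le_compat_l; [lra|]; apply Rinv_le_contravar; lra. }
  (* The majorant [c * exp (- a (m+1) t)] has an integral of order 1/m, although at [t = 0] it does
     not decay with [m]. *)
  assert (HJ0 : Ccv (fun m => J m 1 - J m 0)%C C0).
  { apply is_lim_seq_squeeze0 with (fun m => 2 * c / a / INR (S m)); [|apply is_lim_seq_const_div].
    intros m; split; [apply Cnorm_ge0|].
    replace (J m 1 - J m 0 - C0)%C with (J m 1 - J m 0)%C by ring.
    pose proof (lt_0_INR (S m) ltac:(lia)) as Hm.
    set (b := a * INR (S m)) in *.
    assert (Hb : 0 < b) by (apply Rmult_lt_0_compat; auto).
    eapply Rle_trans.
    - apply (cder_dominated (J m) _ (fun t => - (c / b) * exp (- b * t)) (fun t => c * exp (- b * t)) 0 1 Rle_0_1 (HJ m)).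
      + intros t _; eapply is_derive_eq.
        * apply is_derive_scalR, (is_derive_compR (fun t => - b * t) exp);
            [apply is_derive_scalR, is_derive_idR|apply is_derive_Reals, derivable_pt_lim_exp].
        * cbv beta; field; lra.
      + intros t Ht; apply Hbound; auto.
    - rewrite Rmult_0_r, exp_0; pose proof (exp_pos (- b * 1)).
      assert (0 < c) by lra.
      assert (0 <= c / b * exp (- b * 1)) by (apply Rmult_le_pos; [apply Rdiv_le_0_compat; lra|lra]).
      apply Rle_trans with (2 * (c / b)); [lra|right; unfold b; field; lra]. }
  assert (Hw1 : w 1 = (om * Cexp z)%C).
  { unfold w; change (RtoC 1) with C1; do 2 f_equal; ring. }
  assert (Hw0 : w 0 = om).
  { unfold w; change (RtoC 0) with C0; replace (C0 * z)%C with C0 by ring; rewrite Cexp_0; ring. }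
  assert (Hn1 : Cnorm (om * Cexp z)%C < 1).
  { rewrite Cnorm_mul, Hom, Cnorm_exp, Rmult_1_l, <- exp_0; apply exp_increasing; auto. }
  set (X := (z * A0 1 + RtoC kap * z)%C).
  (* The same limit taken termwise: at [t = 1] the series converges to [A1 1] and cancels it, at
     [t = 0] only the partial sum of [Li2 om] is left. *)
  assert (HJ1 : Ccv (fun m => J m 1 - J m 0)%C
    (X + (- C1) * Li2 (om * Cexp z) + (- z) * A1 1 + z * A1 1 + Li2 om)%C).
  { apply Ccv_ext with (fun m => X + (- C1) * Li2_partial (om * Cexp z) m + (- z) * A1 1
      + z * S1 m 1 + Li2_partial om m)%C.
    - intros m; unfold J, X; rewrite HA0, !Li2_partial_csum; unfold S2; rewrite Hw0, Hw1.
      change (RtoC 1) with C1; change (RtoC 0) with C0; ring.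
    - apply Ccv_add; [apply Ccv_add; [apply Ccv_add; [apply Ccv_add|]|]|].
      + apply Ccv_const.
      + apply Ccv_scal, Li2_cv; lra.
      + apply Ccv_const.
      + rewrite HA1; apply Ccv_scal; unfold S1; rewrite Hw1; apply Clog_series; auto.
      + apply Li2_cv; lra. }
  pose proof (Ccv_uniq _ _ _ HJ0 HJ1) as E.
  replace X with ((X + - C1 * Li2 (om * Cexp z) + - z * A1 1 + z * A1 1 + Li2 om) + (Li2 (om * Cexp z) - Li2 om))%C by ring.
  rewrite <- E; ring.
Qed.

(** * Roots of unity *)

Lemma pow_eq_1 x k : 0 <= x -> (1 <= k)%nat -> x ^ k = 1 -> x = 1.
Proof.
  intros Hx Hk E.
  destruct (Rtotal_order x 1) as [H|[H|H]]; auto; exfalso.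
  - assert (x ^ k < 1 ^ k); [|rewrite pow1 in *; lra].
    destruct k; [lia|]; simpl.
    assert (x ^ k <= 1) by (rewrite <- (pow1 k); apply pow_incr; lra).
    rewrite pow1; nra.
  - pose proof (Rlt_pow_R1 x k H ltac:(lia)); lra.
Qed.

Lemma Cnorm_unity k om : (1 <= k)%nat -> (om ^ k)%C = C1 -> Cnorm om = 1.
Proof.
  intros Hk E; apply pow_eq_1 with k; auto; [apply Cnorm_ge0|].
  rewrite <- Cnorm_pow, E; apply Cnorm_C1.
Qed.

Lemma sum_unity k om : (om ^ k)%C = C1 -> om <> C1 -> csum k (Cpow om) = C0.
Proof.
  intros E Hne.
  assert (Hd : (C1 - om)%C <> C0).
  { intros H; apply Hne; replace om with (C1 - (C1 - om))%C by ring; rewrite H; ring. }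
  rewrite geometric_sum_div, E by auto; ring.
Qed.

Lemma Cnorm_1_sub_pow om i : Cnorm om = 1 -> Cnorm (C1 - om ^ i)%C <= INR i * Cnorm (C1 - om)%C.
Proof.
  intros H; induction i.
  - simpl; replace (C1 - C1)%C with C0 by ring; rewrite Cnorm_C0; lra.
  - cbn [Cpow]; rewrite S_INR.
    replace (C1 - om * om ^ i)%C with ((C1 - om) + om * (C1 - om ^ i))%C by ring.
    eapply Rle_trans; [apply Cnorm_add|]; rewrite Cnorm_mul, H; lra.
Qed.

(** The powers of [om] sum to 0, so [k] is the sum of the [1 - om ^ i], each of modulus at most [k]
    times that of [1 - om]. The bound is the same for all nontrivial roots. *)
Lemma Cnorm_1_sub_unity k om : (1 <= k)%nat -> (om ^ k)%C = C1 -> om <> C1 ->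
  / INR k <= Cnorm (C1 - om)%C.
Proof.
  intros Hk E Hne; pose proof (Cnorm_unity k om Hk E) as Hn.
  pose proof (lt_0_INR k ltac:(lia)) as Hk0.
  assert (H : Cnorm (csum k (fun i => C1 - om ^ i)%C) <= rsum k (fun _ => INR k * Cnorm (C1 - om)%C)).
  { apply Cnorm_csum_le; intros i Hi; eapply Rle_trans; [apply Cnorm_1_sub_pow; auto|].
    apply Rmult_le_compat_r; [apply Cnorm_ge0|apply le_INR; lia]. }
  rewrite csum_sub, csum_const, (sum_unity k om), rsum_const in H by auto.
  replace (RtoC (INR k) * C1 - C0)%C with (RtoC (INR k)) in H by ring.
  rewrite Cnorm_RtoC, Rabs_right in H by lra.
  apply Rmult_le_reg_l with (INR k); auto; rewrite Rinv_r by lra.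
  apply Rmult_le_reg_l with (INR k); auto; lra.
Qed.

(** Orthogonality keeps only the exponents [k * n], with weight [k / (k n)^2 = (1 / k) / n^2]. *)
Lemma Li2_distribution k rho w : primitive_root k rho -> Cnorm w <= 1 ->
  csum k (fun i => Li2 (Cpow_neg rho i * w)%C) = (RtoC (/ INR k) * Li2 (w ^ k)%C)%C.
Proof.
  intros [Hk [Hrk Hrp]] Hw.
  assert (Hk0 : 0 < INR k) by (apply lt_0_INR; lia).
  assert (Hr : Cnorm rho = 1) by (apply Cnorm_unity with k; auto).
  assert (Hr0 : rho <> C0) by (intros E; rewrite E, Cnorm_C0 in Hr; lra).
  assert (Hinv : forall i, Cnorm (Cpow_neg rho i) = 1).
  { intros i; unfold Cpow_neg; rewrite Cnorm_inv, Cnorm_pow, Hr, pow1 by (apply Cpow_neq0; auto); field. }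
  (* The exponent is [k * (m + 1) - i], divisible by [k] exactly when [i = 0]. *)
  assert (Hsum : forall m i, (i < k)%nat ->
    csum k (fun j => Cpow_neg rho j ^ S (k * m + (k - S i)))%C =
      if Nat.eqb i 0 then RtoC (INR k) else C0).
  { intros m i Hi; set (n := S (k * m + (k - S i))).
    assert (Hzeta : forall j, (Cpow_neg rho j ^ n)%C = (Cinv (rho ^ n) ^ j)%C).
    { intros j; unfold Cpow_neg; rewrite !Cpow_inv by (apply Cpow_neq0; auto).
      rewrite <- !Cpow_mul_r, Nat.mul_comm; reflexivity. }
    rewrite (csum_ext k _ (fun j => Cinv (rho ^ n) ^ j)%C) by auto.
    assert (Hrn : (rho ^ n)%C = (rho ^ (k - i))%C).
    { replace n with (k * m + (k - i))%nat by (unfold n; lia).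
      rewrite Cpow_add, Cpow_mul_r, Hrk, Cpow_C1; ring. }
    rewrite Hrn; destruct (Nat.eqb_spec i 0) as [->|Hi0].
    - rewrite Nat.sub_0_r, Hrk.
      rewrite (csum_ext k _ (fun _ => C1)).
      + rewrite csum_const; ring.
      + intros j _; replace (Cinv C1) with C1 by (field; apply C1_neq_C0); apply Cpow_C1.
    - apply sum_unity.
      + rewrite Cpow_inv, <- Cpow_mul_r, Nat.mul_comm, Cpow_mul_r, Hrk, Cpow_C1 by (apply Cpow_neq0; auto).
        field; apply C1_neq_C0.
      + intros E; apply (Hrp (k - i)%nat); [lia|].
        replace (rho ^ (k - i))%C with (rho ^ (k - i) * Cinv (rho ^ (k - i)))%C by (rewrite E; ring).
        field; apply Cpow_neq0; auto. }
  (* Truncating at multiples of [k] makes the relation exact for partial sums; the limit is then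
     taken along the subsequence [k * M]. *)
  assert (Hpart : forall M, csum k (fun j => Li2_partial (Cpow_neg rho j * w)%C (k * M)) =
    (RtoC (/ INR k) * Li2_partial (w ^ k)%C M)%C).
  { intros M.
    rewrite (csum_ext k _ (fun j => csum (k * M) (fun i => Cpow_neg rho j ^ S i * (w ^ S i / RtoC (INR (S i) ^ 2)%R))%C)).
    2:{ intros j _; rewrite Li2_partial_csum; apply csum_ext; intros i _.
        rewrite Cpow_mul_l; unfold Cdiv; ring. }
    rewrite csum_swap, csum_blocks, Li2_partial_csum, <- csum_scal.
    apply csum_ext; intros m _.
    rewrite (csum_ext k _ (fun i => (if Nat.eqb i 0 then RtoC (INR k) else C0) *
      (w ^ S (k * m + (k - S i)) / RtoC (INR (S (k * m + (k - S i))) ^ 2)%R))%C).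
    2:{ intros i Hi; rewrite <- Hsum with (m := m) by auto.
        rewrite (csum_ext k (fun j => _ * (_ / _))%C (fun j => (w ^ S (k * m + (k - S i)) / RtoC (INR (S (k * m + (k - S i))) ^ 2)%R)
          * Cpow_neg rho j ^ S (k * m + (k - S i)))%C) by (intros; ring).
        rewrite csum_scal; ring. }
    assert (Ek : k = S (pred k)) by lia; rewrite Ek at 1; rewrite csum_shift.
    rewrite (csum_ext (pred k) _ (fun _ => C0)) by (intros; simpl; ring).
    rewrite csum_const; simpl Nat.eqb; cbv iota.
    replace (S (k * m + (k - 1))) with (k * S m)%nat by lia.
    rewrite Cpow_mul_r, mult_INR, RtoC_inv, !RtoC_pow, RtoC_mul; cbn [Cpow].
    field; split; [apply INR_S_neq0|apply RtoC_neq0; lra]. }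
  apply (Ccv_uniq (fun M => csum k (fun j => Li2_partial (Cpow_neg rho j * w)%C (k * M)))).
  - apply Ccv_csum; intros j.
    apply (is_lim_seq_subseq (fun m => Cnorm (Li2_partial (Cpow_neg rho j * w)%C m - Li2 (Cpow_neg rho j * w)%C)%C) 0 (fun M => k * M)%nat).
    + apply eventually_subseq; intros; nia.
    + apply Li2_cv; rewrite Cnorm_mul, Hinv; lra.
  - apply Ccv_ext with (fun M => RtoC (/ INR k) * Li2_partial (w ^ k)%C M)%C; [intros; symmetry; auto|].
    apply Ccv_scal, Li2_cv; rewrite Cnorm_pow.
    rewrite <- (pow1 k); apply pow_incr; pose proof (Cnorm_ge0 w); lra.
Qed.

(** * Expansion along one residue class *)

(** Index [l] is the Euler-Maclaurin term of order [l + 2]: the integral and the B_1 term are kept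
    apart, and the factor [M] in front has absorbed one power of [1 / M]. *)
Definition em_coef (lam : R) (M l : nat) : R :=
  bernoulli_poly (S (S l)) lam / INR (fact (S (S l))) * (/ INR M) ^ S l.

Lemma bpoly_1 x : bernoulli_poly 1 x = x - 1 / 2.
Proof. rewrite bpoly_sum; unfold Binomial.C, bernoulli; simpl; unfold Binomial.C; simpl; field. Qed.

Lemma em_coef_bound lam M l : 0 <= lam <= 1 ->
  Rabs (em_coef lam M l) <= bpoly_bound (S (S l)) / INR (fact (S (S l))) * (/ INR M) ^ S l.
Proof.
  intros Hlam; unfold em_coef, Rdiv; rewrite !Rabs_mult.
  pose proof (INR_fact_pos (S (S l))) as Hf.
  assert (HM : 0 <= (/ INR M) ^ S l).
  { apply pow_le; destruct M; [simpl; rewrite Rinv_0; lra|].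
    apply Rlt_le, Rinv_0_lt_compat, lt_0_INR; lia. }
  rewrite (Rabs_right ((/ _) ^ _)) by lra.
  apply Rmult_le_compat_r; auto.
  rewrite (Rabs_right (/ _)) by (apply Rle_ge, Rlt_le, Rinv_0_lt_compat; auto).
  apply Rmult_le_compat_r; [apply Rlt_le, Rinv_0_lt_compat; auto|apply bpoly_le_bound; auto].
Qed.

(** Feeds the derivatives from [log_primitive] to [euler_maclaurin]. One constant serves all
    parameters, and the family [A] is exposed so that it can be identified with polylogarithms. *)
Lemma log_sum_expansion {P} (dom : P -> Prop) L (V V' : P -> R -> CC) c : 0 < c ->
  ubd dom (S (S L)) V -> ubd dom (S (S L)) V' ->
  (forall p t, dom p -> cder (V p) t (V' p t)) ->
  (forall p t, dom p -> V p t <> C0) ->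
  (forall p t, dom p -> 0 <= t <= 1 -> c <= Cnorm (V p t)) ->
  (forall p t, dom p -> 0 <= t <= 1 -> 0 < Cre (V p t)) ->
  exists (A : nat -> P -> R -> CC) K, 0 <= K /\ forall p, dom p ->
    A 0%nat p 0 = C0 /\
    (forall t, 0 <= t <= 1 -> A 1%nat p t = (- Clog (V p t))%C) /\
    (forall t, A 2%nat p t = (- (V' p t / V p t))%C) /\
    (forall l t, (l <= S (S L))%nat -> cder (A l p) t (A (S l) p t)) /\
    forall lam M, 0 <= lam <= 1 -> (1 <= M)%nat ->
    Cnorm (csum M (fun m => - Clog (V p ((INR m + lam) / INR M)%R))
       - (RtoC (INR M) * A 0%nat p 1 + RtoC (bernoulli_poly 1 lam) * (A 1%nat p 1 - A 1%nat p 0)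
          + csum L (fun l => RtoC (em_coef lam M l) * (A (S (S l)) p 1 - A (S (S l)) p 0))))%C
    <= K * (/ INR M) ^ S L.
Proof.
  intros Hc HV HV' Hd Hz Hl Hre.
  destruct (log_primitive dom (S (S L)) V V' c) as (A & K & H0 & H1 & H2 & HA & HK); auto; [lia|].
  (* The sign of [K] is not known, since [dom] may be empty. *)
  set (K1 := Rmax K 0).
  assert (HK1 : 0 <= K1) by apply Rmax_r.
  assert (HKK : K <= K1) by apply Rmax_l.
  set (beta := bpoly_bound (S (S L)) / INR (fact (S (S L)))).
  assert (Hbeta : 0 <= beta) by (apply Rdiv_le_0_compat; [apply bpoly_bound_ge0|apply INR_fact_pos]).
  set (n := S (S L)).
  pose proof (em_const_pos n) as Hem.
  exists A, (2 * (em_const n * K1) + beta * (2 * K1)); split; [nra|].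
  intros p Hp; split; [auto|split; [auto|split; [auto|split; [intros; apply HA; auto; lia|]]]].
  intros lam M Hlam HM.
  assert (HM0 : 0 < INR M) by (apply lt_0_INR; lia).
  set (h := / INR M); assert (Hh : 0 < h) by (apply Rinv_0_lt_compat; auto).
  assert (Hmh : INR M * h = 1) by (unfold h; field; lra).
  pose proof (euler_maclaurin n M (fun l => A l p) lam K1 ltac:(unfold n; lia) HM Hlam) as E.
  assert (E' := E ltac:(intros; apply HA; auto; unfold n in *; lia)
    ltac:(intros; eapply Rle_trans; [apply (HK (S L)); auto|]; auto)); clear E.
  rewrite (csum_ext M _ (fun m => - Clog (V p ((INR m + lam) / INR M)%R))%C) in E'.
  2:{ intros m Hm; apply H1; auto.
      pose proof (pos_INR m).
      assert (INR m + 1 <= INR M) by (rewrite <- S_INR; apply le_INR; lia).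
      split; [apply Rdiv_le_0_compat; lra|].
      apply Rmult_le_reg_r with (INR M); auto; unfold Rdiv; rewrite Rmult_assoc, Rinv_l; lra. }
  set (S0 := csum M _) in *.
  rewrite csum_shift in E'; change (csum n) with (csum (S (S L))) in E'.
  rewrite csum_shift in E'; fold h in E'.
  set (T := csum L (fun l => RtoC (em_coef lam M l) * (A (S (S l)) p 1 - A (S (S l)) p 0))%C).
  (* The formula of order [S (S L)] has one term too many; it is already of size [h ^ S L] and joins
     the error. *)
  set (e := (RtoC (em_coef lam M L) * (A (S (S L)) p 1 - A (S (S L)) p 0))%C).
  assert (ET : csum (S L) (fun i => RtoC (bernoulli_poly (S (S i)) lam / INR (fact (S (S i))) * (INR M * h ^ S (S i)))
     * (A (S (S i)) p 1 - A (S (S i)) p 0))%C = (T + e)%C).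
  { change (T + e)%C with (csum (S L) (fun l => RtoC (em_coef lam M l) * (A (S (S l)) p 1 - A (S (S l)) p 0))%C).
    apply csum_ext; intros i _; unfold em_coef; fold h; do 2 f_equal.
    replace (INR M * h ^ S (S i)) with (INR M * h * h ^ S i) by (simpl; ring).
    rewrite Hmh; ring. }
  rewrite ET, H0, bpoly_0 in E' by auto.
  match goal with |- Cnorm ?x <= _ => match type of E' with Cnorm ?y <= _ =>
    replace x with (y + e)%C end end.
  - eapply Rle_trans; [apply Cnorm_add|].
    rewrite Rmult_plus_distr_r; apply Rplus_le_compat.
    + eapply Rle_trans; [exact E'|right].
      unfold n; replace (INR M * h ^ S (S L)) with (INR M * h * h ^ S L) by (simpl; ring).
      rewrite Hmh; ring.
    + unfold e; rewrite Cnorm_mul, Cnorm_RtoC.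
      replace (beta * (2 * K1) * h ^ S L) with (beta * h ^ S L * (2 * K1)) by ring.
      apply Rmult_le_compat; try apply Rabs_pos; try apply Cnorm_ge0.
      * apply em_coef_bound; auto.
      * eapply Rle_trans; [apply Cnorm_sub|].
        pose proof (HK L p 1 ltac:(lia) Hp ltac:(lra)); pose proof (HK L p 0 ltac:(lia) Hp ltac:(lra)); lra.
  - simpl (fact 0); simpl (fact 1); simpl (INR 1).
    replace (1 / 1 * (INR M * h ^ 0)) with (INR M) by (simpl; field).
    replace (bernoulli_poly 1 lam / 1 * (INR M * h ^ 1)) with (bernoulli_poly 1 lam * (INR M * h)) by (simpl; field).
    rewrite Hmh, Rmult_1_r; unfold T; ring.
Qed.

(** * Nonzero residues: the logarithm is smooth up to [t = 0] *)

Definition regular_dom (k : nat) (delta B : R) (p : CC * CC) : Prop :=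
  (fst p ^ k)%C = C1 /\ fst p <> C1 /\ Cre (snd p) <= - delta /\ Cnorm (snd p) <= B.

Lemma ubd_exp {P} (dom : P -> Prop) (om z : P -> CC) B n :
  (forall p, dom p -> Cnorm (om p) = 1 /\ Cre (z p) <= 0 /\ Cnorm (z p) <= B) ->
  ubd dom n (fun p t => om p * Cexp (RtoC t * z p))%C.
Proof.
  intros H.
  assert (Hb : exists K, forall p t, dom p -> 0 <= t <= 1 -> Cnorm (om p * Cexp (RtoC t * z p))%C <= K).
  { exists 1; intros p t Hp Ht; destruct (H p Hp) as (E & Hz & _).
    rewrite Cnorm_mul, E, Rmult_1_l; apply Cnorm_exp_le1; lra. }
  induction n; split; auto.
  exists (fun p t => om p * Cexp (RtoC t * z p) * z p)%C; split.
  - intros; apply cder_exp_path.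
  - apply ubd_mul; auto; apply ubd_const; exists B; intros; apply H; auto.
Qed.

Lemma exp_neg_lt_1 x : 0 < x -> exp (- x) < 1.
Proof. intros H; rewrite <- exp_0; apply exp_increasing; lra. Qed.

Lemma Cre_1_sub_unit_pos om : Cnorm om = 1 -> om <> C1 -> 0 < Cre (C1 - om)%C.
Proof.
  intros Hn Hne; pose proof (Cnorm_sqr om) as E; rewrite Hn in E.
  destruct (Rlt_dec 0 (Cre (C1 - om)%C)) as [H|H]; auto.
  exfalso; apply Hne; simpl in H; apply CC_eq; simpl; nra.
Qed.

(** Modulus 1 forces [t = 0], where the value is [om]. Negative [t] is included because derivatives
    in [ubd] must exist on all of [R]. *)
Lemma exp_path_neq_1 om z t : Cnorm om = 1 -> om <> C1 -> Cre z < 0 ->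
  (C1 - om * Cexp (RtoC t * z))%C <> C0.
Proof.
  intros Hn Hne Hz E.
  assert (E' : (om * Cexp (RtoC t * z))%C = C1).
  { replace (om * Cexp (RtoC t * z))%C with (C1 - (C1 - om * Cexp (RtoC t * z)))%C by ring; rewrite E; ring. }
  pose proof (Cnorm_exp_path om z t Hn) as H; rewrite E', Cnorm_C1, <- exp_0 in H.
  apply exp_inv in H; assert (Ht : t = 0) by nra; subst t.
  apply Hne; rewrite <- E'; change (RtoC 0) with C0.
  replace (C0 * z)%C with C0 by ring; rewrite Cexp_0; ring.
Qed.

Lemma Cre_exp_path_pos om z t : Cnorm om = 1 -> om <> C1 \/ 0 < t -> Cre z < 0 -> 0 <= t ->
  0 < Cre (C1 - om * Cexp (RtoC t * z))%C.
Proof.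
  intros Hn Hne Hz Ht; destruct (Req_dec t 0) as [->|Ht0].
  - destruct Hne as [Hne|]; [|lra].
    change (RtoC 0) with C0; replace (C0 * z)%C with C0 by ring; rewrite Cexp_0.
    replace (om * C1)%C with om by ring; apply Cre_1_sub_unit_pos; auto.
  - apply Cre_1_sub_pos; rewrite Cnorm_exp_path by auto.
    rewrite <- exp_0; apply exp_increasing; nra.
Qed.

(* Near [t = 0] the distance of [om] to 1 dominates, away from [0] the decay of [exp (t z)] does. *)
Lemma regular_lower_bound k delta B : (1 <= k)%nat -> 0 < delta -> 0 < B ->
  exists c, 0 < c /\ forall p t, regular_dom k delta B p -> 0 <= t <= 1 ->
    c <= Cnorm (C1 - fst p * Cexp (RtoC t * snd p))%C.
Proof.
  intros Hk Hd HB.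
  assert (Hk0 : 0 < INR k) by (apply lt_0_INR; lia).
  (* For [t <= t0] the exponential moves by at most [2 * B * t0 = 1 / (2 k)], half of the gap
     [1 / k] between [om] and 1. *)
  set (t0 := / (4 * INR k * B)).
  assert (Ht0 : 0 < t0) by (apply Rinv_0_lt_compat; nra).
  assert (Hdt : 0 < delta * t0) by nra.
  pose proof (exp_neg_lt_1 _ Hdt) as He.
  exists (Rmin (/ (2 * INR k)) (1 - exp (- (delta * t0)))); split.
  { apply Rmin_pos; [apply Rinv_0_lt_compat; lra|lra]. }
  intros [om z] t (E & Hne & Hz & HzB) Ht; simpl in *.
  pose proof (Cnorm_unity k om Hk E) as Hn.
  destruct (Rle_dec t t0) as [Hle|Hgt].
  - eapply Rle_trans; [apply Rmin_l|].
    pose proof (Cnorm_1_sub_unity k om Hk E Hne) as H1.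
    assert (H2 : Cnorm (Cexp (RtoC t * z) - Cexp (RtoC 0 * z))%C <= 2 * (B * t - B * 0)).
    { apply (cder_dominated (fun t => Cexp (RtoC t * z)%C) (fun t => Cexp (RtoC t * z) * z)%C (fun t => B * t) (fun _ => B)); [lra|..].
      - intros; apply cder_Cexp_scal.
      - intros; eapply is_derive_eq; [apply is_derive_scalR, is_derive_idR|ring].
      - intros s Hs; rewrite Cnorm_mul, <- (Rmult_1_l B).
        apply Rmult_le_compat; auto; try apply Cnorm_ge0; apply Cnorm_exp_le1; lra. }
    change (RtoC 0) with C0 in H2; replace (C0 * z)%C with C0 in H2 by ring; rewrite Cexp_0 in H2.
    replace (C1 - om * Cexp (RtoC t * z))%C with ((C1 - om) - om * (Cexp (RtoC t * z) - C1))%C by ring.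
    eapply Rle_trans; [|apply Cnorm_sub_ge].
    rewrite (Cnorm_mul om), Hn, Rmult_1_l.
    assert (B * t <= B * t0) by (apply Rmult_le_compat_l; lra).
    assert (B * t0 = / (4 * INR k)) by (unfold t0; field; lra).
    replace (/ (2 * INR k)) with (/ INR k - 2 * / (4 * INR k)) by (field; lra). lra.
  - eapply Rle_trans; [apply Rmin_r|].
    eapply Rle_trans; [|apply Cnorm_sub_ge]; rewrite Cnorm_C1, Cnorm_exp_path by auto.
    assert (exp (t * Cre z) <= exp (- (delta * t0))); [|lra].
    left; apply exp_increasing; nra.
Qed.

(** With the pair [(om, z)] as parameter, one constant covers every nontrivial [k]-th root of unity,
    hence every residue and every [rho]. It remains to name the abstract derivatives [A]. *)
Lemma regular_expansion k L delta B : (1 <= k)%nat -> 0 < delta -> 0 < B ->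
  exists K, 0 <= K /\ forall om z lam M, regular_dom k delta B (om, z) -> 0 <= lam <= 1 -> (1 <= M)%nat ->
    Cnorm (csum M (fun m => - Clog (C1 - om * Cexp (RtoC ((INR m + lam) / INR M)%R * z)))
      - (RtoC (INR M) * ((Li2 (om * Cexp z) - Li2 om) / z)
         + RtoC (bernoulli_poly 1 lam) * (Clog (C1 - om) - Clog (C1 - om * Cexp z))
         + csum L (fun l => RtoC (em_coef lam M l) * (z ^ S l * (Li_neg l (om * Cexp z) - Li_neg l om)))))%C
    <= K * (/ INR M) ^ S L.
Proof.
  intros Hk Hd HB.
  destruct (regular_lower_bound k delta B Hk Hd HB) as (c & Hc & Hcl).
  set (dom := regular_dom k delta B).
  assert (Hdom : forall p, dom p -> Cnorm (fst p) = 1 /\ Cre (snd p) <= 0 /\ Cnorm (snd p) <= B).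
  { intros [om z] (E & _ & Hz & HzB); simpl in *; repeat split; auto; [apply Cnorm_unity with k; auto|lra]. }
  set (V := fun (p : CC * CC) t => (C1 + (- C1) * (fst p * Cexp (RtoC t * snd p)))%C).
  set (V' := fun (p : CC * CC) t => ((- C1) * (fst p * Cexp (RtoC t * snd p) * snd p))%C).
  assert (HVe : forall p t, V p t = (C1 - fst p * Cexp (RtoC t * snd p))%C) by (intros; unfold V; ring).
  destruct (log_sum_expansion dom L V V' c) as (A & K & HK0 & H); auto.
  - apply ubd_add; [apply ubd_const; exists 1; intros; rewrite Cnorm_C1; lra|].
    apply ubd_scal, ubd_exp with B; auto.
  - apply ubd_scal, ubd_mul; [apply ubd_exp with B; auto|].
    apply ubd_const; exists B; intros; apply Hdom; auto.
  - intros p t Hp; unfold V, V'; eapply cder_eq.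
    + apply cder_add; [apply cder_const|apply cder_scal, cder_exp_path].
    + ring.
  - intros p t Hp; rewrite HVe; destruct (Hdom p Hp) as (Hn & _); destruct Hp as (_ & Hne & Hz & _).
    apply exp_path_neq_1; auto; lra.
  - intros p t Hp Ht; rewrite HVe; apply Hcl; auto.
  - intros p t Hp Ht; rewrite HVe; destruct (Hdom p Hp) as (Hn & _); destruct Hp as (_ & Hne & Hz & _).
    apply Cre_exp_path_pos; auto; lra.
  - exists K; split; auto; intros om z lam M Hp Hlam HM.
    destruct (H (om, z) Hp) as (H0 & H1 & H2 & H3 & H4); clear H.
    destruct (Hdom _ Hp) as (Hn & _); destruct Hp as (Hom & Hne & Hz & HzB); simpl in *.
    assert (Hz0 : z <> C0) by (intros E; rewrite E in Hz; simpl in Hz; lra).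
    assert (Hw1 : forall t, (om * Cexp (RtoC t * z))%C <> C1).
    { intros t E; apply (exp_path_neq_1 om z t Hn Hne ltac:(lra)); rewrite E; ring. }
    (* The second member of the family is [z * w / (1 - w)], that is [z] times Li_0; the others
       follow by uniqueness of derivatives. *)
    assert (HA : forall l t, (l < S L)%nat -> A (S (S l)) (om, z) t = (z ^ S l * Li_neg l (om * Cexp (RtoC t * z)))%C).
    { induction l; intros t Hl.
      - rewrite H2, HVe; unfold V'; simpl fst; simpl snd; simpl Li_neg; simpl Cpow.
        pose proof (exp_path_neq_1 om z t Hn Hne ltac:(lra)); field; auto.
      - eapply cder_uniq; [apply H3; lia|].
        apply cder_ext with (fun t => z ^ S l * Li_neg l (om * Cexp (RtoC t * z)))%C.
        { intros s; symmetry; apply IHl; lia. }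
        eapply cder_eq; [apply cder_scal, (cder_Li_neg l (fun t => om * Cexp (RtoC t * z))%C t z); [apply cder_exp_path|auto]|].
        cbn [Cpow]; ring. }
    assert (Ew : forall x : CC, (RtoC 1 * x)%C = x /\ (RtoC 0 * x)%C = C0).
    { intros x; change (RtoC 1) with C1; change (RtoC 0) with C0; split; ring. }
    (* No singularity at [t = 0] here, hence [kap = 0]. *)
    assert (HLi : (z * A 0%nat (om, z) 1 + RtoC 0 * z)%C = (Li2 (om * Cexp z) - Li2 om)%C).
    { apply Li2_primitive with (A 1%nat (om, z)) (A 2%nat (om, z)); auto; [lra|..].
      - intros t _; apply H3; lia.
      - intros t _; apply H3; lia.
      - intros t _; rewrite H2, HVe; unfold V'; simpl fst; simpl snd.
        unfold Rdiv; rewrite Rmult_0_l; change (RtoC 0) with C0.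
        pose proof (exp_path_neq_1 om z t Hn Hne ltac:(lra)); field; auto.
      - rewrite H1, HVe by lra; simpl fst; simpl snd; rewrite (proj1 (Ew z)); reflexivity. }
    specialize (H4 lam M Hlam HM).
    rewrite (csum_ext M _ (fun m => - Clog (C1 - om * Cexp (RtoC ((INR m + lam) / INR M)%R * z)))%C) in H4
      by (intros; rewrite HVe; reflexivity).
    rewrite !H1, !HVe in H4 by lra; simpl fst in H4; simpl snd in H4.
    rewrite (proj1 (Ew z)), (proj2 (Ew z)), Cexp_0 in H4.
    rewrite (csum_ext L (fun l => _ * (A _ _ _ - A _ _ _))%C
      (fun l => RtoC (em_coef lam M l) * (z ^ S l * (Li_neg l (om * Cexp z) - Li_neg l om)))%C) in H4.
    2:{ intros l Hl; rewrite !HA by lia; rewrite (proj1 (Ew z)), (proj2 (Ew z)), Cexp_0.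
        replace (om * C1)%C with om by ring; ring. }
    rewrite <- HLi, (proj2 (Ew z)).
    replace ((z * A 0%nat (om, z) 1 + C0) / z)%C with (A 0%nat (om, z) 1) by (field; auto).
    replace (om * C1)%C with om in H4 by ring.
    replace (Clog (C1 - om) - Clog (C1 - om * Cexp z))%C
      with (- Clog (C1 - om * Cexp z) - - Clog (C1 - om))%C by ring.
    exact H4.
Qed.

(** * The residue 0: removal of the logarithmic singularity at [t = 0] *)

Definition singular_dom (delta B : R) (z : CC) : Prop := Cre z <= - delta /\ Cnorm z <= B.

Lemma singular_V_mul z t : (RtoC t * (- z * phi 0 z t))%C = (C1 - Cexp (RtoC t * z))%C.
Proof.
  replace (RtoC t * (- z * phi 0 z t))%C with (- (RtoC t * z * phi 0 z t))%C by ring.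
  rewrite phi_0; ring.
Qed.

Lemma singular_V_neq0 z t : Cre z < 0 -> (- z * phi 0 z t)%C <> C0.
Proof.
  intros Hz E.
  assert (Hz0 : z <> C0) by (intros E'; rewrite E' in Hz; simpl in Hz; lra).
  destruct (Req_dec t 0) as [->|Ht].
  - rewrite phi_at_0 in E; simpl INR in E; rewrite Rinv_1 in E; change (RtoC 1) with C1 in E.
    apply Hz0; replace z with (- (- z * C1))%C by ring; rewrite E; ring.
  - pose proof (singular_V_mul z t) as H; rewrite E in H.
    assert (E' : Cexp (RtoC t * z)%C = C1).
    { replace (Cexp (RtoC t * z)%C) with (C1 - (C1 - Cexp (RtoC t * z)))%C by ring; rewrite <- H; ring. }
    pose proof (Cnorm_exp (RtoC t * z)%C) as Hn; rewrite E', Cnorm_C1, Cre_RtoC_mul, <- exp_0 in Hn.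
    apply exp_inv in Hn; nra.
Qed.

Lemma singular_V_pos z t : 0 < t -> (- z * phi 0 z t)%C = (RtoC (/ t) * (C1 - Cexp (RtoC t * z)))%C.
Proof.
  intros Ht; rewrite <- singular_V_mul, RtoC_inv; field; apply RtoC_neq0; lra.
Qed.

Lemma singular_V_at_0 z : (- z * phi 0 z 0)%C = (- z)%C.
Proof. rewrite phi_at_0; simpl INR; rewrite Rinv_1; change (RtoC 1) with C1; ring. Qed.

Lemma Cre_1_sub_exp_pos z t : Cre z < 0 -> 0 < t -> 0 < Cre (C1 - Cexp (RtoC t * z))%C.
Proof.
  intros Hz Ht; apply Cre_1_sub_pos; rewrite Cnorm_exp, Cre_RtoC_mul, <- exp_0.
  apply exp_increasing; nra.
Qed.

Lemma singular_V_re z t : Cre z < 0 -> 0 <= t -> 0 < Cre (- z * phi 0 z t)%C.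
Proof.
  intros Hz Ht; destruct (Req_dec t 0) as [->|Ht0].
  - rewrite singular_V_at_0; simpl; lra.
  - rewrite singular_V_pos, Cre_RtoC_mul by lra.
    apply Rmult_lt_0_compat; [apply Rinv_0_lt_compat; lra|apply Cre_1_sub_exp_pos; lra].
Qed.

(** For [t > 0] the constant is the reciprocal of the one in [exp_ratio_bound]; at [t = 0] the value
    is [- z], of modulus at least [delta]. *)
Lemma singular_lower_bound delta B z t : 0 < delta -> singular_dom delta B z -> 0 <= t <= 1 ->
  delta / (1 + delta) <= Cnorm (- z * phi 0 z t)%C.
Proof.
  intros Hd [Hz HzB] Ht; destruct (Req_dec t 0) as [->|Ht0].
  - rewrite singular_V_at_0, Cnorm_opp.
    apply Rle_trans with delta.
    + apply Rmult_le_reg_r with (1 + delta); [lra|]; unfold Rdiv; rewrite Rmult_assoc, Rinv_l; nra.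
    + pose proof (Cre_le_norm z) as H; apply Rabs_le_between in H; lra.
  - rewrite singular_V_pos, Cnorm_mul, Cnorm_RtoC by lra.
    assert (0 < / t) by (apply Rinv_0_lt_compat; lra); rewrite Rabs_right by lra.
    pose proof (exp_ratio_bound delta t Hd ltac:(lra)) as H1.
    pose proof (exp_neg_lt_1 (delta * t) ltac:(nra)) as H2.
    set (u := 1 - exp (- (delta * t))) in *.
    assert (H3 : u <= Cnorm (C1 - Cexp (RtoC t * z))%C).
    { eapply Rle_trans; [|apply Cnorm_sub_ge]; rewrite Cnorm_C1, Cnorm_exp, Cre_RtoC_mul.
      assert (exp (t * Cre z) <= exp (- (delta * t))); [|unfold u; lra].
      destruct (Req_dec (t * Cre z) (- (delta * t))) as [->|]; [lra|].
      left; apply exp_increasing; nra. }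
    apply Rle_trans with (/ t * u); [|apply Rmult_le_compat_l; lra].
    replace (delta / (1 + delta)) with (/ ((1 + delta) / delta)) by (field; lra).
    replace (/ t * u) with (/ (t / u)) by (field; unfold u in *; lra).
    apply Rinv_le_contravar; auto; apply Rdiv_lt_0_compat; unfold u; lra.
Qed.

Lemma ubd_phi delta B n m : 0 < delta -> ubd (singular_dom delta B) n (fun z => phi m z).
Proof.
  intros Hd; revert m; induction n; intros m;
    (split; [exists 2; intros z t [Hz _] Ht; apply phi_bound; lra|]); auto.
  exists (fun z t => z * phi (S m) z t)%C; split; [intros; apply cder_phi|].
  apply ubd_mul; auto.
  apply ubd_const; exists B; intros z [_ H]; auto.
Qed.

(** Compares two derivatives of [t z phi 0 = exp (t z) - 1]; it yields a closed form of [phi 1] for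
    nonzero [s]. *)
Lemma phi_1 z s : z <> C0 -> (phi 0 z s + RtoC s * z * phi 1 z s)%C = Cexp (RtoC s * z)%C.
Proof.
  intros Hz0.
  assert (Hd1 : cder (fun s => RtoC s * z * phi 0 z s)%C s (z * (phi 0 z s + RtoC s * z * phi 1 z s))%C).
  { eapply cder_eq.
    - apply cder_mul; [apply cder_mul; [apply cder_id|apply cder_const]|apply cder_phi].
    - cbv beta; ring. }
  assert (Hd2 : cder (fun s => RtoC s * z * phi 0 z s)%C s (Cexp (RtoC s * z) * z)%C).
  { apply cder_ext with (fun s => Cexp (RtoC s * z) - C1)%C; [intros; symmetry; apply phi_0|].
    eapply cder_eq; [apply cder_sub; [apply cder_Cexp_scal|apply cder_const]|ring]. }
  pose proof (cder_uniq _ _ _ _ Hd1 Hd2) as E.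
  replace (phi 0 z s + RtoC s * z * phi 1 z s)%C with (Cinv z * (z * (phi 0 z s + RtoC s * z * phi 1 z s)))%C by (field; auto).
  rewrite E; field; auto.
Qed.

(* The logarithmic derivative of [(1 - exp s) / s] is odd up to the constant [1/2]. *)
Lemma singular_log_derivative_odd z t : Cre z < 0 ->
  (phi 1 z (- t) / phi 0 z (- t) - RtoC (1 / 2)%R)%C = (- (phi 1 z t / phi 0 z t - RtoC (1 / 2)%R))%C.
Proof.
  intros Hz.
  assert (Hz0 : z <> C0) by (intros E'; rewrite E' in Hz; simpl in Hz; lra).
  assert (Hp : forall t, phi 0 z t <> C0).
  { intros s E; apply (singular_V_neq0 z s Hz); rewrite E; ring. }
  assert (E2 : RtoC (1 / 2) = Cinv (C1 + C1)%C) by (apply CC_eq; simpl; field).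
  assert (H2 : (C1 + C1)%C <> C0) by (intros E; apply (f_equal Cre) in E; simpl in E; lra).
  destruct (Req_dec t 0) as [->|Ht].
  - rewrite Ropp_0, !phi_at_0.
    replace (RtoC (/ INR 2) / RtoC (/ INR 1))%C with (RtoC (1 / 2)); [ring|].
    rewrite <- RtoC_div; f_equal; simpl; field.
  - pose proof (phi_1 z t Hz0) as P1; pose proof (phi_1 z (- t) Hz0) as P2.
    pose proof (phi_0 z t) as Q1; pose proof (phi_0 z (- t)) as Q2.
    rewrite RtoC_opp in *.
    replace (- RtoC t * z)%C with (- (RtoC t * z))%C in * by ring.
    rewrite Cexp_opp in P2, Q2.
    pose proof (Cexp_neq0 (RtoC t * z)%C) as He.
    set (s := (RtoC t * z)%C) in *; set (e := Cexp s) in *.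
    assert (Hs : s <> C0) by (apply Cmul_integral; auto; apply RtoC_neq0; auto).
    assert (F1 : phi 0 z t = ((e - C1) / s)%C).
    { rewrite <- Q1; field; auto. }
    assert (F2 : phi 0 z (- t) = ((C1 - Cinv e) / s)%C).
    { replace (phi 0 z (- t)) with (- ((- s * phi 0 z (- t)) / s))%C by (field; auto).
      rewrite Q2; field; auto. }
    assert (G1 : phi 1 z t = ((e - phi 0 z t) / s)%C) by (rewrite <- P1; field; auto).
    assert (G2 : phi 1 z (- t) = (- ((Cinv e - phi 0 z (- t)) / s))%C) by (rewrite <- P2; field; auto).
    assert (He1 : (e - C1)%C <> C0).
    { intros E; apply (Hp t); rewrite F1, E; field; auto. }
    rewrite G1, G2, F1, F2, E2; field; repeat split; auto.
Qed.

Lemma cder_comp_opp f t l : cder f (- t) l -> cder (fun t => f (- t)) t (- l)%C.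
Proof.
  intros [H1 H2]; split; simpl.
  - eapply is_derive_eq.
    + apply (is_derive_compR (fun t => - t) (fun t => Cre (f t))); [apply is_derive_oppR, is_derive_idR|exact H1].
    + ring.
  - eapply is_derive_eq.
    + apply (is_derive_compR (fun t => - t) (fun t => Cim (f t))); [apply is_derive_oppR, is_derive_idR|exact H2].
    + ring.
Qed.

Lemma rsum_ln_ratio M : (1 <= M)%nat ->
  rsum M (fun m => ln ((INR m + 1) / INR M)) = ln (INR (fact M)) - INR M * ln (INR M).
Proof.
  intros HM; assert (HM0 : 0 < INR M) by (apply lt_0_INR; lia).
  rewrite (rsum_ext M _ (fun m => ln (INR (S m)) + (- ln (INR M)))).
  - rewrite rsum_add, rsum_const.
    replace (rsum M (fun m => ln (INR (S m)))) with (ln (INR (fact M))); [ring|].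
    clear; induction M.
    + simpl; apply ln_1.
    + change (rsum (S M) (fun m => ln (INR (S m)))) with (rsum M (fun m => ln (INR (S m))) + ln (INR (S M))).
      rewrite <- IHM, fact_simpl, mult_INR, ln_mult; [ring|apply lt_0_INR; lia|apply INR_fact_pos].
  - intros m _; rewrite <- S_INR, ln_div; [ring|apply lt_0_INR; lia|auto].
Qed.

Lemma stirling_term_scale l x : 0 < x ->
  stirling_term (S (S l)) x = stirling_term (S (S l)) 1 * (/ x) ^ S l.
Proof. intros Hx; unfold stirling_term; rewrite Rinv_1, pow1; ring. Qed.

(** Stirling's series written with [em_coef 1 M], so that its corrections cancel term by term those
    which [- ln t] leaves at [t = 1]. *)
Lemma stirling_expansion L : exists K, 0 <= K /\ forall M, (1 <= M)%nat ->
  Rabs (ln (INR (fact M)) - (1 / 2 * ln (2 * PI * INR M) + INR M * ln (INR M) - INR M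
    + rsum L (fun l => em_coef 1 M l * stirling_term (S (S l)) 1))) <= K * (/ INR M) ^ S L.
Proof.
  destruct (stirling_series (S L) ltac:(lia)) as (K & HK0 & HK).
  set (beta := bpoly_bound (S (S L)) / INR (fact (S (S L)))).
  exists (K + beta * Rabs (stirling_term (S (S L)) 1)); split.
  { apply Rplus_le_le_0_compat; auto; apply Rmult_le_pos; [|apply Rabs_pos].
    apply Rdiv_le_0_compat; [apply bpoly_bound_ge0|apply INR_fact_pos]. }
  intros M HM; specialize (HK M HM).
  assert (HM0 : 0 < INR M) by (apply lt_0_INR; lia).
  assert (Hs : stirling_sum (S (S L)) (INR M) = INR M * ln (INR M) - INR M + 1 / 2 * ln (INR M)
    + rsum L (fun l => em_coef 1 M l * stirling_term (S (S l)) 1)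
    + em_coef 1 M L * stirling_term (S (S L)) 1).
  { unfold stirling_sum; rewrite (rsum_shift (S (S L))), (rsum_shift (S L)), bpoly_0, bpoly_1.
    rewrite (rsum_ext (S L) _ (fun l => em_coef 1 M l * stirling_term (S (S l)) 1)).
    - change (INR (fact 0)) with 1; change (INR (fact 1)) with 1.
      cbn [rsum]; unfold stirling_term at 1 2; field.
    - intros l _; rewrite (stirling_term_scale l (INR M)) by auto; unfold em_coef; ring. }
  rewrite Hs in HK.
  rewrite ln_mult by (pose proof PI_RGT_0; lra).
  match goal with |- Rabs ?x <= _ => match type of HK with Rabs ?y <= _ =>
    replace x with (y + em_coef 1 M L * stirling_term (S (S L)) 1) by field end end.
  eapply Rle_trans; [apply Rabs_triang|]; rewrite Rmult_plus_distr_r.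
  apply Rplus_le_compat; auto.
  rewrite Rabs_mult.
  replace (beta * Rabs (stirling_term (S (S L)) 1) * (/ INR M) ^ S L)
    with (beta * (/ INR M) ^ S L * Rabs (stirling_term (S (S L)) 1)) by ring.
  apply Rmult_le_compat_r; [apply Rabs_pos|apply em_coef_bound; lra].
Qed.

(** Here [- Clog (1 - exp (t z))] is [- Clog V - ln t] with [V = (1 - exp (t z)) / t]. The smooth
    part goes through [log_sum_expansion] with [lam = 1]; the samples of [ln t] add up to ln M! - M
    ln M. *)
Lemma singular_expansion L delta B : 0 < delta ->
  exists K, 0 <= K /\ forall z M, singular_dom delta B z -> (1 <= M)%nat ->
    Cnorm (csum M (fun m => - Clog (C1 - Cexp (RtoC ((INR m + 1) / INR M)%R * z)))
      - (RtoC (INR M) * ((Li2 (Cexp z) - Li2 C1) / z)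
         + RtoC (1 / 2)%R * (Clog (- z) - Clog (C1 - Cexp z))
         - RtoC (1 / 2 * ln (2 * PI * INR M))%R
         + csum L (fun l => RtoC (em_coef 1 M l) *
             ((if Nat.eqb l 0 then RtoC (1 / 2)%R * z else C0) + z ^ S l * Li_neg l (Cexp z)))))%C
    <= K * (/ INR M) ^ S L.
Proof.
  intros Hd.
  destruct (stirling_expansion L) as (K2 & HK20 & HK2).
  set (dom := singular_dom delta B).
  assert (Hdz : forall z, dom z -> Cre z < 0) by (intros z [Hz _]; lra).
  set (V := fun (z : CC) t => (- z * phi 0 z t)%C).
  set (V' := fun (z : CC) t => (- z * (z * phi 1 z t))%C).
  destruct (log_sum_expansion dom L V V' (delta / (1 + delta))) as (A & K & HK0 & H).
  - apply Rdiv_lt_0_compat; lra.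
  - apply ubd_mul; [|apply ubd_phi; auto].
    apply ubd_const; exists B; intros z [_ Hz]; rewrite Cnorm_opp; auto.
  - apply ubd_mul; [|apply ubd_mul; [|apply ubd_phi; auto]].
    + apply ubd_const; exists B; intros z [_ Hz]; rewrite Cnorm_opp; auto.
    + apply ubd_const; exists B; intros z [_ Hz]; auto.
  - intros z t _; apply cder_scal, cder_phi.
  - intros z t Hz; apply singular_V_neq0; auto.
  - intros z t Hz Ht; apply singular_lower_bound with B; auto.
  - intros z t Hz Ht; apply singular_V_re; auto; lra.
  - exists (K + K2); split; [lra|]; intros z M Hp HM.
    destruct (H z Hp) as (H0 & H1 & H2 & H3 & H4); clear H.
    specialize (H4 1 M ltac:(lra) HM); specialize (HK2 M HM).
    pose proof (Hdz z Hp) as Hz.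
    assert (Hz0 : z <> C0) by (intros E; rewrite E in Hz; simpl in Hz; lra).
    assert (HM0 : 0 < INR M) by (apply lt_0_INR; lia).
    assert (Hph : forall t, phi 0 z t <> C0).
    { intros s E; apply (singular_V_neq0 z s Hz); rewrite E; ring. }
    assert (HA2 : forall t, A 2%nat z t = (- (z * (phi 1 z t / phi 0 z t)))%C).
    { intros t; rewrite H2; unfold V, V'; field; split; auto.
      intros E; apply Hz0; replace z with (- - z)%C by ring; rewrite E; ring. }
    assert (Hw1 : forall t, 0 < t -> (C1 - Cexp (RtoC t * z))%C <> C0).
    { intros t Ht; apply Cre_pos_neq0, Cre_1_sub_exp_pos; auto. }
    assert (HA2' : forall t, 0 < t -> A 2%nat z t =
      (z * Cexp (RtoC t * z) / (C1 - Cexp (RtoC t * z)) + RtoC (1 / t)%R)%C).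
    { intros t Ht; rewrite HA2.
      assert (Ht' : RtoC t <> C0) by (apply RtoC_neq0; lra).
      replace (phi 1 z t) with ((Cexp (RtoC t * z) - phi 0 z t) / (RtoC t * z))%C
        by (rewrite <- phi_1 by auto; field; auto).
      replace (phi 0 z t) with ((Cexp (RtoC t * z) - C1) / (RtoC t * z))%C
        by (rewrite <- phi_0; field; auto).
      pose proof (Hw1 t Ht) as Hne.
      assert (Hne' : (Cexp (RtoC t * z) - C1)%C <> C0).
      { intros E; apply Hne; replace (C1 - Cexp (RtoC t * z))%C with (- (Cexp (RtoC t * z) - C1))%C by ring; rewrite E; ring. }
      rewrite RtoC_div; change (RtoC 1) with C1; field; auto. }
    (* Away from 0 the derivatives of the smooth part split into a polylogarithm and a derivative of
       [ln t], which is the [stirling_term]. *)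
    assert (HA : forall l t, (l < S L)%nat -> 0 < t -> A (S (S l)) z t =
       (z ^ S l * Li_neg l (Cexp (RtoC t * z)) + RtoC (stirling_term (S (S l)) t))%C).
    { induction l; intros t Hl Ht.
      - rewrite HA2' by auto; simpl Li_neg; cbn [Cpow]; unfold stirling_term.
        replace ((-1) ^ 0 * INR (fact 0) * (/ t) ^ 1) with (1 / t) by (simpl; field; lra).
        pose proof (Hw1 t Ht); field; auto.
      - eapply cder_uniq; [apply H3; lia|].
        apply cder_ext_loc with (fun t => z ^ S l * Li_neg l (Cexp (RtoC t * z)) + RtoC (stirling_term (S (S l)) t))%C.
        { apply (filter_imp (fun s => 0 < s)).
          - intros s Hs; symmetry; apply IHl; [lia|auto].
          - apply (open_gt 0 t); auto. }
        eapply cder_eq.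
        + apply cder_add; [apply cder_scal, (cder_Li_neg l (fun t => Cexp (RtoC t * z))%C t z)|].
          * apply cder_Cexp_scal.
          * intros E; apply (Hw1 t Ht); rewrite E; ring.
          * apply cder_RtoC, is_derive_stirling_term; auto.
        + cbn [Cpow]; ring. }
    (* [A 2] is odd up to the constant [- z / 2], so from [A 3] on the derivatives alternate between
       even and odd. This uses their extension to negative [t]. *)
    assert (Hpar : forall l t, (l < L)%nat -> A (S (S (S l))) z (- t)%R = (RtoC ((-1) ^ l)%R * A (S (S (S l))) z t)%C).
    { induction l; intros t Hl.
      - assert (Ho : forall t, A 2%nat z (- t)%R = (- A 2%nat z t - z)%C).
        { intros s; rewrite !HA2.
          replace (phi 1 z (- s) / phi 0 z (- s))%C with
            ((phi 1 z (- s) / phi 0 z (- s) - RtoC (1 / 2)%R) + RtoC (1 / 2)%R)%C by ring.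
          rewrite singular_log_derivative_odd by auto.
          transitivity (z * (phi 1 z s / phi 0 z s) - (RtoC (1 / 2)%R + RtoC (1 / 2)%R) * z)%C; [ring|].
          rewrite <- RtoC_add; replace (1 / 2 + 1 / 2) with 1 by field; change (RtoC 1) with C1; ring. }
        simpl pow; change (RtoC 1) with C1.
        assert (E : (- A 3%nat z (- t)%R)%C = (- A 3%nat z t - C0)%C).
        { eapply cder_uniq; [apply cder_comp_opp, H3; lia|].
          apply cder_ext with (fun t => - A 2%nat z t - z)%C; [intros; symmetry; apply Ho|].
          apply cder_sub; [apply cder_opp, H3; lia|apply cder_const]. }
        replace (A 3%nat z (- t)%R) with (- - A 3%nat z (- t)%R)%C by ring; rewrite E; ring.
      - assert (E : (- A (S (S (S (S l)))) z (- t)%R)%C = (RtoC ((-1) ^ l)%R * A (S (S (S (S l)))) z t)%C).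
        { eapply cder_uniq; [apply cder_comp_opp, H3; lia|].
          apply cder_ext with (fun t => RtoC ((-1) ^ l)%R * A (S (S (S l))) z t)%C; [intros; symmetry; apply IHl; lia|].
          apply cder_scal, H3; lia. }
        replace (A (S (S (S (S l)))) z (- t)%R) with (- - A (S (S (S (S l)))) z (- t)%R)%C by ring; rewrite E.
        replace ((-1) ^ S l) with (- (-1) ^ l) by (simpl; ring); rewrite RtoC_opp; ring. }
    (* At [t = 0] the index [l = 0] gives [- z / 2]; at every later index either the Bernoulli
       number has odd index at least 3 or the derivative is an odd function. *)
    assert (HA0 : forall l, (l < L)%nat -> (RtoC (em_coef 1 M l) * A (S (S l)) z 0)%C =
      (RtoC (em_coef 1 M l) * (- (if Nat.eqb l 0 then RtoC (1 / 2)%R * z else C0)))%C).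
    { intros [|l] Hl.
      - f_equal; rewrite HA2, !phi_at_0; simpl Nat.eqb; cbv iota.
        rewrite <- RtoC_div; replace (/ INR 2 / / INR 1) with (1 / 2) by (simpl; field); ring.
      - simpl Nat.eqb; cbv iota.
        destruct (Nat.Even_or_Odd l) as [[j ->]|[j ->]].
        + unfold em_coef; rewrite bpoly_at_1 by lia.
          replace (S (S (S (2 * j)))) with (S (2 * S j)) by lia.
          rewrite bernoulli_odd by lia; unfold Rdiv; rewrite !Rmult_0_l.
          change (RtoC 0) with C0; ring.
        + pose proof (Hpar (2 * j + 1)%nat 0 ltac:(lia)) as E.
          rewrite Ropp_0, Nat.add_1_r, pow_1_odd in E; rewrite Nat.add_1_r.
          assert (E' : A (S (S (S (S (2 * j))))) z 0 = C0); [|rewrite E'; ring].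
          apply (f_equal (fun x => (RtoC (1 / 2) * (x + A (S (S (S (S (2 * j))))) z 0))%C)) in E.
          transitivity (RtoC (1 / 2)%R * (A (S (S (S (S (2 * j))))) z 0 + A (S (S (S (S (2 * j))))) z 0))%C.
          * apply CC_eq; simpl; field.
          * rewrite E; apply CC_eq; simpl; field. }
    assert (E1 : (RtoC 1 * z)%C = z) by (change (RtoC 1) with C1; ring).
    assert (HLi : (z * A 0%nat z 1 + RtoC 1 * z)%C = (Li2 (C1 * Cexp z) - Li2 C1)%C).
    { apply Li2_primitive with (A 1%nat z) (A 2%nat z); auto; [apply Cnorm_C1|..].
      - intros t _; apply H3; lia.
      - intros t _; apply H3; lia.
      - intros t Ht; rewrite HA2' by lra; replace (C1 * Cexp (RtoC t * z))%C with (Cexp (RtoC t * z)%C) by ring; reflexivity.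
      - rewrite H1 by lra; unfold V; rewrite singular_V_pos, Rinv_1, E1 by lra.
        do 2 f_equal; change (RtoC 1) with C1; ring. }
    replace (C1 * Cexp z)%C with (Cexp z) in HLi by ring; rewrite E1 in HLi.
    (* The sample points [(m + 1) / M] are positive reals, so [ln t] splits off the principal
       logarithm exactly. *)
    assert (Hlog : csum M (fun m => - Clog (C1 - Cexp (RtoC ((INR m + 1) / INR M)%R * z)))%C =
      (csum M (fun m => - Clog (V z ((INR m + 1) / INR M)%R)) - RtoC (ln (INR (fact M)) - INR M * ln (INR M))%R)%C).
    { rewrite <- rsum_ln_ratio, RtoC_rsum, <- csum_sub by auto.
      apply csum_ext; intros m _; unfold V.
      assert (Hm : 0 < (INR m + 1) / INR M) by (apply Rdiv_lt_0_compat; auto; pose proof (pos_INR m); lra).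
      rewrite <- singular_V_mul, Clog_RtoC_mul by (auto; apply singular_V_neq0; auto); ring. }
    rewrite Hlog, <- HLi.
    (* The extra 1 is the integral of [- ln t] over [0, 1], produced by [kap = 1]; times [M] it
       cancels the term [- M] of Stirling's formula. *)
    replace ((z * A 0%nat z 1 + z) / z)%C with (A 0%nat z 1 + C1)%C by (field; auto).
    rewrite !H1 in H4 by lra.
    unfold V at 2 3 in H4; rewrite singular_V_at_0, singular_V_pos, Rinv_1, !E1 in H4 by lra.
    rewrite (csum_ext L (fun l => _ * (A _ _ _ - A _ _ _))%C
      (fun l => RtoC (em_coef 1 M l) * ((if Nat.eqb l 0 then RtoC (1 / 2)%R * z else C0) + z ^ S l * Li_neg l (Cexp z))
         + RtoC (em_coef 1 M l * stirling_term (S (S l)) 1)%R)%C) in H4.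
    2:{ intros l Hl.
        transitivity (RtoC (em_coef 1 M l) * A (S (S l)) z 1 - RtoC (em_coef 1 M l) * A (S (S l)) z 0)%C; [ring|].
        rewrite HA0, HA, E1, RtoC_mul by (lia || lra); ring. }
    rewrite csum_add, <- RtoC_rsum, bpoly_1 in H4.
    replace (1 - 1 / 2) with (1 / 2) in H4 by field.
    set (st := rsum L _) in *.
    rewrite <- Cnorm_RtoC in HK2.
    match goal with |- Cnorm ?x <= _ => match type of H4 with Cnorm ?y <= _ =>
      match type of HK2 with Cnorm ?w <= _ => replace x with (y - w)%C end end end.
    + eapply Rle_trans; [apply Cnorm_sub|]; rewrite Rmult_plus_distr_r; lra.
    + rewrite !RtoC_sub, !RtoC_add, !RtoC_sub, !RtoC_add, !(RtoC_mul (INR M) (ln _)); change (RtoC 1) with C1.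
      replace (C1 * (C1 - Cexp z))%C with (C1 - Cexp z)%C by ring; ring.
Qed.

(** * Assembly over the residue classes *)

Lemma Cpow_neg_unity k rho i : primitive_root k rho -> (0 < i < k)%nat ->
  (Cpow_neg rho i ^ k)%C = C1 /\ Cpow_neg rho i <> C1.
Proof.
  intros (Hk & Hrk & Hrp) Hi.
  assert (Hr : Cnorm rho = 1) by (apply Cnorm_unity with k; auto).
  assert (Hr0 : rho <> C0) by (intros E; rewrite E, Cnorm_C0 in Hr; lra).
  assert (Hri : (rho ^ i)%C <> C0) by (apply Cpow_neq0; auto).
  unfold Cpow_neg; split.
  - rewrite Cpow_inv, <- Cpow_mul_r, Nat.mul_comm, Cpow_mul_r, Hrk, Cpow_C1 by auto.
    field; apply C1_neq_C0.
  - intros E; apply (Hrp i Hi).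
    transitivity (rho ^ i * Cinv (rho ^ i))%C; [rewrite E; ring|field; auto].
Qed.

Lemma Cpow_neg_0 rho : Cpow_neg rho 0 = C1.
Proof. unfold Cpow_neg; simpl; field; apply C1_neq_C0. Qed.

(** The exponent is [k * (m + 1) - i]: modulo [k] it leaves [rho ^ (- i)], and divided by [M * k] it
    is the sample point with shift [lam = 1 - i / k]. *)
Lemma q_power k M m i rho z : primitive_root k rho -> (1 <= M)%nat -> (i < k)%nat ->
  ((rho * Cexp (z / RtoC (INR (M * k)))) ^ S (k * m + (k - S i)))%C =
  (Cpow_neg rho i * Cexp (RtoC ((INR m + (1 - INR i / INR k)) / INR M)%R * z))%C.
Proof.
  intros (Hk & Hrk & Hrp) HM Hi.
  assert (Hr : Cnorm rho = 1) by (apply Cnorm_unity with k; auto).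
  assert (Hr0 : rho <> C0) by (intros E; rewrite E, Cnorm_C0 in Hr; lra).
  assert (Hri : (rho ^ i)%C <> C0) by (apply Cpow_neq0; auto).
  assert (HM0 : 0 < INR M) by (apply lt_0_INR; lia).
  assert (Hk0 : 0 < INR k) by (apply lt_0_INR; lia).
  set (n := S (k * m + (k - S i))).
  assert (Hn : (n + i)%nat = (k * (S m))%nat) by (unfold n; lia).
  rewrite Cpow_mul_l, Cexp_pow; f_equal.
  - unfold Cpow_neg.
    replace (rho ^ n)%C with (rho ^ n * rho ^ i * Cinv (rho ^ i))%C by (field; auto).
    rewrite <- Cpow_add, Hn, Cpow_mul_r, Hrk, Cpow_C1; ring.
  - f_equal.
    replace (INR m + (1 - INR i / INR k)) with (INR n / INR k).
    + rewrite mult_INR; unfold Cdiv; rewrite <- RtoC_inv.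
      transitivity (RtoC (INR n * / (INR M * INR k)) * z)%C; [rewrite RtoC_mul; ring|].
      do 2 f_equal; field; lra.
    + assert (E : INR n + INR i = INR k * (INR m + 1)).
      { rewrite <- plus_INR, Hn, mult_INR, S_INR; ring. }
      replace (INR n) with (INR k * (INR m + 1) - INR i) by lra; field; lra.
Qed.

Lemma qpoch_log q N : Cnorm q < 1 ->
  Cinv (qpoch q N) = Cexp (csum N (fun j => - Clog (C1 - q ^ S j))%C).
Proof.
  intros Hq; unfold qpoch.
  rewrite (Cprod_range_exp N _ (fun j => Clog (C1 - q ^ S j)%C)).
  - rewrite <- Cexp_opp; f_equal.
    transitivity ((- C1) * csum N (fun j => Clog (C1 - q ^ S j)%C))%C; [ring|].
    rewrite <- csum_scal; apply csum_ext; intros; ring.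
  - intros i _; rewrite Cexp_Clog; auto.
    apply Cre_pos_neq0, Cre_1_sub_pos; rewrite Cnorm_pow.
    apply Rle_lt_trans with (Cnorm q * 1); [simpl|lra].
    apply Rmult_le_compat_l; [apply Cnorm_ge0|].
    rewrite <- (pow1 i); apply pow_incr; pose proof (Cnorm_ge0 q); lra.
Qed.

Lemma Cpow_neg_norm k rho i : primitive_root k rho -> Cnorm (Cpow_neg rho i) = 1.
Proof.
  intros (Hk & Hrk & _).
  assert (Hr : Cnorm rho = 1) by (apply Cnorm_unity with k; auto).
  unfold Cpow_neg; rewrite Cnorm_inv, Cnorm_pow, Hr, pow1; [apply Rinv_1|].
  apply Cpow_neq0; intros E; rewrite E, Cnorm_C0 in Hr; lra.
Qed.

(** Numerators and denominators have positive real part, so the principal powers split. The exponent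
    [i / k - 1 / 2] is [- B_1 (1 - i / k)], the boundary coefficient of the Euler-Maclaurin
    formula. *)
Lemma gfun_log k rho z : primitive_root k rho -> Cre z < 0 ->
  gfun k rho z = Cexp (RtoC (1 / 2)%R * (Clog (- z) - RtoC (ln (2 * PI)) - Clog (C1 - Cexp z))
    + csum (k - 1) (fun i => RtoC (bernoulli_poly 1 (1 - INR (S i) / INR k)) *
        (Clog (C1 - Cpow_neg rho (S i)) - Clog (C1 - Cpow_neg rho (S i) * Cexp z))))%C.
Proof.
  intros Hrho Hz; unfold gfun; rewrite Cexp_add; f_equal.
  - assert (H1 : 0 < Cre (C1 - Cexp z)%C).
    { apply Cre_1_sub_pos; rewrite Cnorm_exp, <- exp_0; apply exp_increasing; auto. }
    pose proof PI_RGT_0 as Hpi.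
    unfold Cpowc; f_equal; f_equal; rewrite Clog_div.
    + rewrite Clog_RtoC_mul; [ring|lra|apply Cre_pos_neq0; auto].
    + simpl; lra.
    + rewrite Cre_RtoC_mul; apply Rmult_lt_0_compat; lra.
  - apply Cprod_range_exp; intros i Hi; unfold Cpowc; f_equal.
    pose proof (Cpow_neg_norm k rho (S i) Hrho) as Hn.
    destruct (Cpow_neg_unity k rho (S i) Hrho ltac:(lia)) as [_ Hne].
    rewrite Clog_div.
    + rewrite bpoly_1.
      replace (1 - INR (S i) / INR k - 1 / 2) with (- (INR (S i) / INR k - 1 / 2))
        by (field; apply not_0_INR; lia).
      rewrite RtoC_opp; ring.
    + apply Cre_1_sub_pos; rewrite Cnorm_mul, Hn, Cnorm_exp, Rmult_1_l, <- exp_0; apply exp_increasing; auto.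
    + apply Cre_1_sub_unit_pos; auto.
Qed.

Lemma bernoulli_2 : bernoulli 2 = 1 / 6.
Proof. unfold bernoulli; simpl; unfold Binomial.C; simpl; field. Qed.

(** Reflection turns the shift [1 - i / k] into [i / k] and produces the sign in [ffun]; the factor
    [k ^ (l + 1)] there changes powers of [N] into powers of [M]. *)
Lemma ffun_em_coef k M rho z l : (1 <= k)%nat -> (1 <= M)%nat ->
  (ffun k rho (S l) z / RtoC (INR (M * k) ^ S l)%R)%C =
  (RtoC (em_coef 1 M l) * ((if Nat.eqb l 0 then RtoC (1 / 2)%R * z else C0) + z ^ S l * Li_neg l (Cexp z))
   + csum (k - 1) (fun i => RtoC (em_coef (1 - INR (S i) / INR k) M l) *
       (z ^ S l * (Li_neg l (Cpow_neg rho (S i) * Cexp z) - Li_neg l (Cpow_neg rho (S i))))))%C.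
Proof.
  intros Hk HM.
  assert (HM0 : 0 < INR M) by (apply lt_0_INR; lia).
  assert (Hk0 : 0 < INR k) by (apply lt_0_INR; lia).
  pose proof (INR_fact_pos (S (S l))) as Hf.
  assert (HN : 0 < INR (M * k) ^ S l) by (apply pow_lt; rewrite mult_INR; nra).
  unfold ffun; rewrite Csum_range_csum.
  unfold Li_1m; replace (S l - 1)%nat with l by lia.
  set (s := (-1) ^ S (S l)) in *.
  set (b := s / INR (fact (S (S l))) * (/ INR M) ^ S l).
  set (X := (RtoC _ + _)%C).
  transitivity (RtoC b * z ^ S l * X)%C.
  { rewrite Cpow_mul_l, <- RtoC_pow.
    transitivity (RtoC s * RtoC (INR k ^ S l) * Cinv (RtoC (INR (fact (S (S l))))) *
      Cinv (RtoC (INR (M * k) ^ S l)) * z ^ S l * X)%C.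
    - field; split; apply RtoC_neq0; lra.
    - do 2 f_equal; rewrite <- !RtoC_inv, <- !RtoC_mul; f_equal; unfold b.
      rewrite mult_INR, Rpow_mult_distr, pow_inv.
      pose proof (pow_lt _ (S l) HM0); pose proof (pow_lt _ (S l) Hk0); field; lra. }
  unfold X.
  assert (E0 : em_coef 1 M l = b * bernoulli (S (S l))).
  { unfold em_coef, b; replace (bernoulli_poly (S (S l)) 1) with (s * bernoulli (S (S l))).
    - unfold Rdiv; ring.
    - unfold s; rewrite <- bpoly_at_0, <- bpoly_reflect, Rminus_0_r; reflexivity. }
  assert (Ei : forall i, em_coef (1 - INR (S i) / INR k) M l = b * bernoulli_poly (S (S l)) (INR (S i) / INR k)).
  { intros i; unfold em_coef, b; rewrite bpoly_reflect; fold s; unfold Rdiv; ring. }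
  rewrite (csum_ext (k - 1) (fun i => RtoC (em_coef _ M l) * _)%C
    (fun i => (RtoC b * z ^ S l) * (RtoC (bernoulli_poly (S (S l)) (INR (S i) / INR k)) *
      (Li_neg l (Cpow_neg rho (S i) * Cexp z) - Li_neg l (Cpow_neg rho (S i)))))%C).
  2:{ intros i _; rewrite Ei, RtoC_mul; ring. }
  rewrite csum_scal, E0, RtoC_mul.
  destruct l as [|l].
  (* The constant 1/12 is B_2 = 1/6 times the 1/2 left by the smooth function at [t = 0]. *)
  - simpl Nat.eqb; cbv iota; rewrite bernoulli_2.
    replace (1 / 12) with (1 / 6 * (1 / 2)) by field; rewrite (RtoC_mul (1 / 6)); cbn [Cpow]; ring.
  - change (Nat.eqb (S (S l)) 1) with false; change (Nat.eqb (S l) 0) with false; cbv iota.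
    change (RtoC 0) with C0; ring.
Qed.

(** The distribution relation at [exp z] and at 1, with the residue 0 split off: its factor [1 / k]
    supplies the [k] in the denominator of [pfun (k z)]. *)
Lemma pfun_distribution k M rho z : primitive_root k rho -> (1 <= M)%nat -> Cre z < 0 ->
  (RtoC (INR (M * k) / INR k)%R * pfun (RtoC (INR k) * z))%C =
  (RtoC (INR M) * ((Li2 (Cexp z) - Li2 C1) / z)
   + csum (k - 1) (fun i => RtoC (INR M) *
       ((Li2 (Cpow_neg rho (S i) * Cexp z) - Li2 (Cpow_neg rho (S i))) / z)))%C.
Proof.
  intros Hrho HM Hz; pose proof Hrho as (Hk & _).
  assert (Hk0 : 0 < INR k) by (apply lt_0_INR; lia).
  assert (Hz0 : z <> C0) by (intros E; rewrite E in Hz; simpl in Hz; lra).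
  assert (H1 : Cnorm (Cexp z) <= 1).
  { rewrite Cnorm_exp; left; rewrite <- exp_0; apply exp_increasing; auto. }
  pose proof (Li2_distribution k rho (Cexp z) Hrho H1) as D1.
  pose proof (Li2_distribution k rho C1 Hrho ltac:(rewrite Cnorm_C1; lra)) as D2.
  rewrite Cexp_pow in D1; rewrite Cpow_C1 in D2.
  assert (Ek : k = S (k - 1)) by lia.
  transitivity (csum k (fun i => RtoC (INR M) * Cinv z * (Li2 (Cpow_neg rho i * Cexp z) - Li2 (Cpow_neg rho i * C1)))%C).
  - rewrite csum_scal, csum_sub, D1, D2; unfold pfun.
    rewrite mult_INR; replace (INR M * INR k / INR k) with (INR M) by (field; lra).
    rewrite RtoC_inv; field; split; auto; apply RtoC_neq0; lra.
  - rewrite Ek at 1; rewrite csum_shift, Cpow_neg_0; f_equal.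
    + replace (C1 * Cexp z)%C with (Cexp z) by ring; replace (C1 * C1)%C with C1 by ring.
      unfold Cdiv; ring.
    + apply csum_ext; intros i _; replace (Cpow_neg rho (S i) * C1)%C with (Cpow_neg rho (S i)) by ring.
      unfold Cdiv; ring.
Qed.

Theorem theorem4p1 (k L : nat) (delta Cb : R) :
  (1 <= k)%nat -> (1 <= L)%nat -> 0 < delta -> 0 < Cb ->
  exists K : R, 0 < K /\
  forall rho : CC, primitive_root k rho ->
  forall (N : nat) (z : CC),
    (1 <= N)%nat -> Nat.divide k N -> Cre z <= - delta -> Cnorm z <= Cb ->
    exists E : CC, Cnorm E <= K / INR N ^ L /\
      Cinv (qpoch (Cmul rho (Cexp (Cdiv z (RtoC (INR N))))) N)
      = Cmul (Cmul (RtoC (sqrt (INR k / INR N))) (gfun k rho z))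
          (Cexp (Cadd (Cadd (Cmul (RtoC (INR N / INR k)) (pfun (Cmul (RtoC (INR k)) z)))
                            (Csum_range 1 (L - 1) (fun l =>
                               Cdiv (ffun k rho l z) (RtoC (INR N ^ l)))))
                      E)).
Proof.
  (* From here on the order of the error is [S L], and [L] counts the correction terms that are
     kept. *)
  intros Hk HL Hd HCb; destruct L as [|L]; [lia|].
  destruct (singular_expansion L delta Cb Hd) as (Ks & HKs0 & HKs).
  destruct (regular_expansion k L delta Cb Hk Hd HCb) as (Kr & HKr0 & HKr).
  assert (Hk0 : 0 < INR k) by (apply lt_0_INR; lia).
  assert (HkL : 0 < INR k ^ S L) by (apply pow_lt; auto).
  assert (Hk1 : 0 <= INR (k - 1) * Kr) by (apply Rmult_le_pos; auto; apply pos_INR).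
  (* One singular and [k - 1] regular classes; [k ^ S L] converts [M ^ - S L] into [N ^ - S L], and
     the added 1 makes the constant positive. *)
  exists ((Ks + INR (k - 1) * Kr) * INR k ^ S L + 1); split; [nra|].
  intros rho Hrho N z HN [M ->] Hz HzC.
  assert (HM : (1 <= M)%nat) by (destruct M; simpl in HN; lia).
  assert (HM0 : 0 < INR M) by (apply lt_0_INR; lia).
  assert (HN0 : 0 < INR (M * k)) by (apply lt_0_INR; lia).
  assert (Hz0 : Cre z < 0) by lra.
  set (q := (rho * Cexp (z / RtoC (INR (M * k))))%C).
  assert (Hq : Cnorm q < 1).
  { unfold q; destruct Hrho as (_ & Hrk & _).
    rewrite Cnorm_mul, (Cnorm_unity k rho Hk Hrk), Cnorm_exp, Rmult_1_l, <- exp_0.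
    apply exp_increasing; unfold Cdiv; rewrite <- RtoC_inv.
    pose proof (Rinv_0_lt_compat _ HN0); simpl; nra. }
  set (lam := fun i => 1 - INR i / INR k).
  set (T := fun i => csum M (fun m => - Clog (C1 - Cpow_neg rho i * Cexp (RtoC ((INR m + lam i) / INR M)%R * z)))%C).
  assert (HS : csum (M * k) (fun j => - Clog (C1 - q ^ S j))%C = (T 0%nat + csum (k - 1) (fun i => T (S i)))%C).
  (* Blocks of [k] consecutive exponents, summed first over the blocks, give the residue classes. *)
  { rewrite Nat.mul_comm, csum_blocks, csum_swap.
    rewrite (csum_ext k _ T).
    - replace k with (S (k - 1)) at 1 by lia; apply csum_shift.
    - intros i Hi; apply csum_ext; intros m _; unfold q; rewrite q_power; auto. }
  set (P0 := (RtoC (INR M) * ((Li2 (Cexp z) - Li2 C1) / z)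
         + RtoC (1 / 2)%R * (Clog (- z) - Clog (C1 - Cexp z))
         - RtoC (1 / 2 * ln (2 * PI * INR M))%R
         + csum L (fun l => RtoC (em_coef 1 M l) *
             ((if Nat.eqb l 0 then RtoC (1 / 2)%R * z else C0) + z ^ S l * Li_neg l (Cexp z))))%C).
  set (Pr := fun i => (RtoC (INR M) * ((Li2 (Cpow_neg rho i * Cexp z) - Li2 (Cpow_neg rho i)) / z)
         + RtoC (bernoulli_poly 1 (lam i)) * (Clog (C1 - Cpow_neg rho i) - Clog (C1 - Cpow_neg rho i * Cexp z))
         + csum L (fun l => RtoC (em_coef (lam i) M l) * (z ^ S l * (Li_neg l (Cpow_neg rho i * Cexp z) - Li_neg l (Cpow_neg rho i)))))%C).
  set (h := / INR M) in *.
  assert (H0 : Cnorm (T 0%nat - P0)%C <= Ks * h ^ S L).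
  { unfold T, P0; rewrite (csum_ext M _ (fun m => - Clog (C1 - Cexp (RtoC ((INR m + 1) / INR M)%R * z)))%C).
    - apply HKs; auto; split; auto.
    - intros m _; rewrite Cpow_neg_0; unfold lam; simpl (INR 0).
      replace (1 - 0 / INR k) with 1 by (field; lra); do 3 f_equal; ring. }
  assert (Hr : forall i, (i < k - 1)%nat -> Cnorm (T (S i) - Pr (S i))%C <= Kr * h ^ S L).
  { intros i Hi; apply HKr; auto.
    - destruct (Cpow_neg_unity k rho (S i) Hrho ltac:(lia)); repeat split; auto.
    - unfold lam; assert (0 <= INR (S i) / INR k <= 1); [|lra].
      pose proof (pos_INR (S i)); assert (INR (S i) <= INR k) by (apply le_INR; lia).
      split; [apply Rdiv_le_0_compat; lra|].
      apply Rmult_le_reg_r with (INR k); auto; unfold Rdiv; rewrite Rmult_assoc, Rinv_l; lra. }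
  (* [E] is the exact difference between the sums and their expansions, so only its bound is an
     estimate and the product formula is an identity. *)
  exists ((T 0%nat - P0) + csum (k - 1) (fun i => T (S i) - Pr (S i)))%C; split.
  - eapply Rle_trans; [apply Cnorm_add|].
    pose proof (Cnorm_csum_le _ _ _ Hr) as H2; rewrite rsum_const in H2.
    apply Rle_trans with ((Ks + INR (k - 1) * Kr) * h ^ S L); [lra|].
    assert (E : h ^ S L = INR k ^ S L / INR (M * k) ^ S L).
    { unfold h; rewrite mult_INR, Rpow_mult_distr, pow_inv.
      pose proof (pow_lt _ (S L) HM0); field; lra. }
    rewrite E; unfold Rdiv; rewrite <- Rmult_assoc.
    apply Rmult_le_compat_r; [|lra].
    apply Rlt_le, Rinv_0_lt_compat, pow_lt; auto.
  - rewrite (qpoch_log q _ Hq), gfun_log, (pfun_distribution k M rho) by auto.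
    (* The square root is [M ^ (- 1 / 2)], the part of Stirling's [ln (2 PI M) / 2] that does not
       enter [gfun]. *)
    replace (sqrt (INR k / INR (M * k))) with (exp (- (1 / 2 * ln (INR M)))).
    2:{ replace (INR k / INR (M * k)) with (exp (- (1 / 2 * ln (INR M))) * exp (- (1 / 2 * ln (INR M)))).
        - symmetry; apply sqrt_square, Rlt_le, exp_pos.
        - rewrite <- exp_plus; replace (- (1 / 2 * ln (INR M)) + - (1 / 2 * ln (INR M))) with (- ln (INR M)) by field.
          rewrite exp_Ropp, exp_ln, mult_INR by auto; field; lra. }
    rewrite <- Cexp_RtoC, <- !Cexp_add, HS; f_equal.
    rewrite Csum_range_csum; replace (S L - 1)%nat with L by lia.
    rewrite (csum_ext L _ _ (fun l _ => ffun_em_coef k M rho z l Hk HM)), csum_add, csum_swap, csum_sub.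
    unfold Pr; rewrite !csum_add; fold (lam).
    change (fun i => RtoC (bernoulli_poly 1 (1 - INR (S i) / INR k)) *
      (Clog (C1 - Cpow_neg rho (S i)) - Clog (C1 - Cpow_neg rho (S i) * Cexp z)))%C with
      (fun i => RtoC (bernoulli_poly 1 (lam (S i))) *
      (Clog (C1 - Cpow_neg rho (S i)) - Clog (C1 - Cpow_neg rho (S i) * Cexp z)))%C.
    unfold P0; pose proof PI_RGT_0.
    rewrite (ln_mult (2 * PI) (INR M)), Rmult_plus_distr_l, !RtoC_add, RtoC_opp, (RtoC_mul _ (ln (2 * PI))) by lra.
    unfold lam; ring.
Qed.
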